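(* Let $d\ge 1$, let $V\subseteq\mathbb{R}^d$ be a finite full-dimensional point set in convex position, let $\mathcal{P}=\operatorname{conv}(V)$, and let $U=\{\mathbf{u}_1,\ldots,\mathbf{u}_n\}\subseteq V$ with $|U|=n$. Then $U$ is a spine of $V$ if and only if there exists a $U$-spinal triangulation of $V$. In this case, if $n\ge 1$, the $U$-spinal triangulations of $V$ are exactly the lifts of the star triangulations of $\hat{V}$, where $\hat{V}$ is the orthogonal projection of $V$ to the orthogonal complement of the affine space spanned by $U$. Furthermore (still in the case that $U$ is a spine of $V$), if $n\ge 2$, then $$\binom{d}{n-1}\operatorname{vol}(\mathcal{P})=\operatorname{vol}(U)\operatorname{vol}(\hat{\mathcal{P}}),$$ where $\hat{\mathcal{P}}$ is the image of $\mathcal{P}$ under the same projection.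
   Context: A set in $\mathbb{R}^d$ is full-dimensional if its affine hull is $\mathbb{R}^d$; $V$ is in convex position if $x\notin\operatorname{conv}(V\setminus\{x\})$ for all $x\in V$. Facets of a $d$-dimensional polytope are its $(d-1)$-dimensional faces. Spine: $U\subseteq V$ with $|U|=n$ is a spine of $V$ if each facet of $\mathcal{P}=\operatorname{conv}(V)$ contains at least $n-1$ points of $U$. (If $U$ is a spine, its points are affinely independent.) A simplicial complex is a finite set of simplices closed under taking faces (the empty set being a face) such that any two intersect in a common face. A triangulation of a finite full-dimensional point set $W$ (not necessarily in convex position) is a simplicial complex whose vertex set is exactly $W$ and whose underlying space (union of its simplices) is $\operatorname{conv}(W)$. A simplicial complex is $U$-spinal if every maximal simplex has all points of $U$ among its vertices; a $U$-spinal triangulation of $V$ is a triangulation of $V$ that is $U$-spinal. Projection (for $U$ a spine, $n\ge1$): let $\mathbb{A}_U$ be the linear subspace of $\mathbb{R}^d$ spanned by the differences of points of $U$ (of dimension $n-1$), $\mathbb{A}_U^\perp$ its orthogonal complement, and $e=d-n+1=\dim\mathbb{A}_U^\perp$. Let $\Phi_U:\mathbb{R}^d\to\mathbb{A}_U^\perp\cong\mathbb{R}^e$ be the map $x\mapsto$ orthogonal projection of $x-\mathbf{u}_1$ to $\mathbb{A}_U^\perp$; thus $\Phi_U$ maps every point of $U$ to $\mathbf{0}$. (If $\mathbf{0}\in U$ this is just the orthogonal projection to $\mathbb{A}_U^\perp$.) Write $\hat{X}=\Phi_U(X)$. A star triangulation of $\hat{V}$ is a triangulation of the point set $\hat{V}\subseteq\mathbb{R}^e$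 in which all $e$-simplices contain $\mathbf{0}$ as a vertex. For an $e$-simplex $\tau$ with vertices in $\hat{V}$ and having $\mathbf{0}$ as a vertex, its lift is the simplex in $\mathbb{R}^d$ spanned by all $v\in V$ for which $\Phi_U(v)$ is a vertex of $\tau$. The lift of a star triangulation is the set of lifts of its maximal simplices together with all their faces. Volumes: $\operatorname{vol}(\mathcal{P})$ is $d$-dimensional, $\operatorname{vol}(\hat{\mathcal{P}})$ is $e$-dimensional, and $\operatorname{vol}(U)$ is the $(n-1)$-dimensional volume of the simplex spanned by $U$; the $0$-dimensional volume of a point is $1$. *)

(* Defs.v *)
From HB Require Import structures.
From mathcomp Require Import all_boot all_order all_algebra finmap.
From mathcomp Require Import all_classical all_reals all_analysis.

Set Implicit Arguments.
Unset Strict Implicit.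
Unset Printing Implicit Defensive.

Import Order.TTheory GRing.Theory Num.Theory.

Local Open Scope classical_set_scope.
Local Open Scope ring_scope.

Section Polytopes.
Context {R : realType} {d : nat}.
Implicit Types (X P F : set 'rV[R]_d) (V : {fset 'rV[R]_d}) (k : nat).

Definition dot (x y : 'rV[R]_d) : R := \sum_i x 0 i * y 0 i.

Definition affine_hull X : set 'rV[R]_d :=
  [set x | exists m (p : 'I_m -> 'rV[R]_d) (w : 'I_m -> R),
    [/\ forall i, X (p i), \sum_i w i = 1 & x = \sum_i w i *: p i]].

Definition convex_hull X : set 'rV[R]_d :=
  [set x | exists m (p : 'I_m -> 'rV[R]_d) (w : 'I_m -> R),
    [/\ forall i, X (p i), forall i, 0 <= w i,
        \sum_i w i = 1 & x = \sum_i w i *: p i]].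

(* X is nonempty and its affine hull is a k-dimensional flat *)
Definition has_dim X k : Prop :=
  exists (p : 'rV[R]_d) (B : 'M[R]_(k, d)),
    row_free B /\ affine_hull X = [set p + y *m B | y in [set: 'rV[R]_k]].

Definition full_dimensional V : Prop := affine_hull [set` V] = setT.

Definition convex_position V : Prop :=
  forall x, x \in V -> ~ convex_hull [set` (V `\ x)%fset] x.

(* intersection with a supporting hyperplane; a = 0 yields the improper faces,
   which are never facets of a full-dimensional polytope *)
Definition face P F : Prop :=
  exists (a : 'rV[R]_d) (b : R),
    (forall x, P x -> dot a x <= b) /\ F = P `&` [set x | dot a x = b].

Definition facet P F : Prop := face P F /\ has_dim F d.-1.

(* |U| - 1 <= |U `&` F| in the integers, so that U = fset0 is unconstrained *)
Definition spine V (U : {fset 'rV[R]_d}) : Prop :=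
  (U `<=` V)%fset /\
  forall F, facet (convex_hull [set` V]) F ->
    (#|` U| <= #|` [fset u in U | `[< F u >] ]%fset|.+1)%N.

End Polytopes.

(* A simplex is represented by its vertex set, and its underlying space is
   [convex_hull] of that set. *)
Section Triangulations.
Context {R : realType} {d : nat}.
Implicit Types (V U W s t r : {fset 'rV[R]_d}) (T : {fset {fset 'rV[R]_d}}).

Definition affinely_independent s : Prop :=
  forall c : 'rV[R]_d -> R,
    \sum_(x <- s) c x = 0 -> \sum_(x <- s) c x *: x = 0 ->
    forall x, x \in s -> c x = 0.

Definition simplicial_complex T : Prop :=
  [/\ forall s, s \in T -> affinely_independent s,
      forall s t, s \in T -> (t `<=` s)%fset -> t \in T
    & forall s t, s \in T -> t \in T ->
        exists r, [/\ (r `<=` s)%fset, (r `<=` t)%fset &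
          convex_hull [set` s] `&` convex_hull [set` t] = convex_hull [set` r]]].

Definition maximal_simplex T s : bool :=
  (s \in T) && [forall t : T, (s `<=` val t)%fset ==> (val t == s)].

(* W need not span the ambient space: this is also used for point sets that are
   full-dimensional in a linear subspace. *)
Definition triangulation W T : Prop :=
  [/\ simplicial_complex T, fcover T = W &
      \bigcup_(s in [set` T]) convex_hull [set` s] = convex_hull [set` W]].

Definition spinal U T : Prop :=
  forall s, maximal_simplex T s -> (U `<=` s)%fset.

Definition spinal_triangulation V U T : Prop :=
  triangulation V T /\ spinal U T.

(* for W spanning an e-dimensional linear subspace *)
Definition star_triangulation (e : nat) W T : Prop :=
  triangulation W T /\ forall s, s \in T -> #|` s| = e.+1 -> 0 \in s.

End Triangulations.

Section Projection.
Context {R : realType} {d : nat}.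
Implicit Types (V U t : {fset 'rV[R]_d}).

(* Linear subspaces are row spaces of matrices. *)
Definition direction U : 'M[R]_d :=
  (\sum_(u <- U) \sum_(v <- U) <<u - v>>)%MS.

Definition direction_ortho U : 'M[R]_d := kermx (direction U)^T.

(* codim U = d - #|U| + 1 is the dimension of [direction_ortho U] when the
   points of U are affinely independent; then #|U| <= d + 1. *)
Definition codim U : nat := (d.+1 - #|` U|)%N.

(* x |-> orthogonal projection of x - u1 to the orthogonal complement of the
   direction of U, as a point of that subspace of R^d *)
Definition Phi U (u1 x : 'rV[R]_d) : 'rV[R]_d :=
  (x - u1) *m proj_mx (direction_ortho U) (direction U).

Definition lift_simplex V U (u1 : 'rV[R]_d) t : {fset 'rV[R]_d} :=
  [fset v in V | Phi U u1 v \in t]%fset.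

Definition lift_complex V U (u1 : 'rV[R]_d) (T : {fset {fset 'rV[R]_d}}) :
    {fset {fset 'rV[R]_d}} :=
  (\bigcup_(t <- T | maximal_simplex T t) fpowerset (lift_simplex V U u1 t))%fset.

End Projection.

Section Volume.
Context {R : realType}.

(* n-dimensional Lebesgue measure, as the iterated product of the Lebesgue
   measure on the line; the measure on R^0 is the unit mass *)
Fixpoint lebesgue_tuple (n : nat) :
    set (n.-tuple (measurableTypeR R)) -> \bar R :=
  match n with
  | 0 => fun A => \d_([tuple]) A
  | m.+1 => fun A =>
      (@lebesgue_measure R \x @lebesgue_tuple m)%E
        [set z : measurableTypeR R * m.-tuple (measurableTypeR R) |
          A [tuple of z.1 :: z.2]]
  end.

Definition lebesgue_rV (n : nat) (X : set 'rV[R]_n) : \bar R :=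
  lebesgue_tuple [set t : n.-tuple _ | X (\row_i tnth t i)].

(* k-dimensional volume of a subset X of a k-flat in R^d: the Lebesgue measure of
   X in orthonormal coordinates y |-> p + y *m B on such a flat. For Borel X it
   does not depend on the coordinates, so the infimum is over a constant
   family. *)
Definition vol (k d : nat) (X : set 'rV[R]_d) : \bar R :=
  ereal_inf [set v | exists (p : 'rV[R]_d) (B : 'M[R]_(k, d)),
    [/\ B *m B^T = 1%:M,
        X `<=` [set p + y *m B | y in [set: 'rV[R]_k]] &
        v = lebesgue_rV [set y : 'rV[R]_k | X (p + y *m B)]]].

End Volume.

(* Main.v *)
(** Write hat for [Phi U u1] and W for V \ U. If a point b of P = conv V is such
    that the ray from u in U through b leaves P at b, then some facet of P contains
    b but not u; when U is a spine, that facet contains U \ u. Consequently no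
    hat q, q in W, lies in the hull of 0 and the other hat v, and if a point of P is
    written as an affine combination of V whose part on W is nonnegative and has the
    least possible mass over its projection, then the coefficients on U are
    nonnegative. This makes the lifts of the simplices of a star triangulation cover
    P. Conversely a U-spinal triangulation, seen near a relative interior point of
    conv U, projects to a fan around 0, which is that of a star triangulation. A star
    triangulation is obtained from the supports of the conic combinations that
    minimize the mass and then a generic weight. Finally, the simplices of a
    U-spinal triangulation can cover a facet only if one of them has d vertices on
    it, so that the facet misses at most one point of U.

    For the volume put k = |U| - 1. The fibre of P over y in hat P is a translate of
    t(y) conv U, where 1 - t(y) is the gauge of hat P at y. Since {t >= s} is
    (1 - s) hat P, the integral of t^k is vol (hat P) times the integral of
    k s^(k-1) (1-s)^e over [0, 1], which is 1 / 'C(d, k). *)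
Require Import Defs.
From HB Require Import structures.
From mathcomp Require Import all_boot all_order all_algebra finmap.
From mathcomp Require Import all_classical all_reals all_analysis measurable_realfun ring lra.

Set Implicit Arguments.
Unset Strict Implicit.
Unset Printing Implicit Defensive.

Import Order.TTheory GRing.Theory Num.Theory.

Local Open Scope classical_set_scope.
Local Open Scope ring_scope.

(** * Combinations over finite sets *)

Section Hulls.
Context {R : realType} {d : nat}.
Implicit Types (s t V : {fset 'rV[R]_d}) (c : 'rV[R]_d -> R) (x : 'rV[R]_d).

(** The difficulty is one of signs: once the projection of a point of P is written over W, its
    coefficients on [U] are only affine coordinates. Minimality makes them nonnegative because u
    projects to 0: going on along the ray from u multiplies the projection by a factor larger than
    one, so a ray that stayed in P would give a cheaper representation of the same projected point.
    One minus the minimal mass is also the mass left for [U], so the same minimum governs both the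
    covering by lifts and the size of the fibres in the volume formula. A triangulation of hat V has
    to use each of its points as a vertex; this is where it matters that no hat q lies in the hull
    of 0 and the others. The generic weight breaks ties between minimizers: unique optima make
    simplices meet in common faces, and optimality that depends on the support alone makes the
    family closed under faces. An empty [U] is reduced to a one-point spine. Scaling and orthogonal
    invariance of the measure are obtained from the uniqueness of translation-invariant measures,
    tested on a cube and on a ball. *)

Definition comb s c : 'rV[R]_d := \sum_(v <- s) c v *: v.
Definition mass s c : R := \sum_(v <- s) c v.

(** The points [p i] may repeat; collecting the weights by value replaces an indexed combination by
    a coefficient function. *)
Lemma comb_regroup s m (p : 'I_m -> 'rV[R]_d) (w : 'I_m -> R) :
  (forall i, p i \in s) ->
  mass s (fun v => \sum_(i | p i == v) w i) = \sum_i w i /\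
  comb s (fun v => \sum_(i | p i == v) w i) = \sum_i w i *: p i.
Proof.
move=> ps.
have E (T : nmodType) (F : 'I_m -> T) :
    \sum_(v <- s) \sum_(i | p i == v) F i = \sum_i F i.
  rewrite (exchange_big_dep predT)//=; apply: eq_bigr => i _.
  by rewrite -big_filter (eq_filter (a2 := pred1 (p i)))//
     ?filter_pred1_uniq ?fset_uniq// big_seq1.
split; first exact: E.
rewrite -(E _ (fun i => w i *: p i)); apply: eq_bigr => v _.
by rewrite scaler_suml; apply: eq_bigr => i /eqP ->.
Qed.

Lemma comb_enum s c : exists m (p : 'I_m -> 'rV[R]_d),
  [/\ forall i, p i \in s, mass s c = \sum_i c (p i)
    & comb s c = \sum_i c (p i) *: p i].
Proof.
exists (size s), (fun i => tnth (in_tuple s) i); split => [i||].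
- exact: mem_tnth.
- by rewrite /mass big_tnth.
- by rewrite /comb big_tnth.
Qed.

Lemma sum_fsetI (T : nmodType) s V (F : 'rV[R]_d -> T) : (s `<=` V)%fset ->
  (forall v, v \notin s -> F v = 0) ->
  \sum_(v <- s) F v = \sum_(v <- V) F v.
Proof. by move=> sV F0; apply: big_fset_incl => // v _; exact: F0. Qed.

Lemma mass_sub s V c : (s `<=` V)%fset -> (forall v, v \notin s -> c v = 0) ->
  mass s c = mass V c.
Proof. exact: sum_fsetI. Qed.

Lemma comb_sub s V c : (s `<=` V)%fset -> (forall v, v \notin s -> c v = 0) ->
  comb s c = comb V c.
Proof. by move=> sV c0; apply: sum_fsetI => // v /c0 ->; rewrite scale0r. Qed.

Lemma affine_hullP s x : affine_hull [set` s] x <->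
  exists c, mass s c = 1 /\ x = comb s c.
Proof.
split=> [[m [p [w [ps w1 ->]]]]|[c [c1 ->]]].
  have [E1 E2] := @comb_regroup s m p w ps.
  by exists (fun v => \sum_(i | p i == v) w i); rewrite E1 E2.
have [m [p [ps E1 E2]]] := comb_enum s c.
by exists m, p, (c \o p); split => //=; rewrite -?E1 -?E2.
Qed.

Lemma convex_hullP s x : convex_hull [set` s] x <->
  exists c, [/\ forall v, 0 <= c v, forall v, v \notin s -> c v = 0,
                mass s c = 1 & x = comb s c].
Proof.
split=> [[m [p [w [ps w0 w1 ->]]]]|[c [c0 cs c1 ->]]].
  have [E1 E2] := @comb_regroup s m p w ps.
  exists (fun v => \sum_(i | p i == v) w i); rewrite E1 E2; split => // v.
    exact: sumr_ge0.
  by move=> vs; apply: big1 => i /eqP iv; move: vs; rewrite -iv ps.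
have [m [p [ps E1 E2]]] := comb_enum s c.
by exists m, p, (c \o p); split => //=; rewrite -?E1 -?E2.
Qed.

(** Since the coefficients vanish off [s], points of different simplices can be compared as
    combinations over one common set [V]. *)
Lemma convex_hull_subP s V x : (s `<=` V)%fset -> convex_hull [set` s] x <->
  exists c, [/\ forall v, 0 <= c v, forall v, v \notin s -> c v = 0,
                mass V c = 1 & x = comb V c].
Proof.
move=> sV; rewrite convex_hullP; split=> -[c [c0 cs c1 ->]]; exists c.
  by split => //; rewrite -?(mass_sub sV)// (comb_sub sV).
by split => //; rewrite ?(mass_sub sV)// (comb_sub sV).
Qed.

Lemma eq_mass s c1 c2 : {in s, c1 =1 c2} -> mass s c1 = mass s c2.
Proof. by move=> h; rewrite /mass big_seq [RHS]big_seq; exact: eq_bigr. Qed.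

Lemma eq_comb s c1 c2 : {in s, c1 =1 c2} -> comb s c1 = comb s c2.
Proof.
move=> h; rewrite /comb big_seq [RHS]big_seq.
by apply: eq_bigr => v /h ->.
Qed.

Lemma mass_restrict s c : mass s (fun v => if v \in s then c v else 0) = mass s c.
Proof. by apply: eq_mass => v ->. Qed.

Lemma comb_restrict s c : comb s (fun v => if v \in s then c v else 0) = comb s c.
Proof. by apply: eq_comb => v ->. Qed.

Lemma combD s c1 c2 : comb s (fun v => c1 v + c2 v) = comb s c1 + comb s c2.
Proof. by rewrite -big_split; apply: eq_bigr => v _; rewrite scalerDl. Qed.

Lemma combZ s a c : comb s (fun v => a * c v) = a *: comb s c.
Proof. by rewrite scaler_sumr; apply: eq_bigr => v _; rewrite scalerA. Qed.

Lemma combB s c1 c2 : comb s (fun v => c1 v - c2 v) = comb s c1 - comb s c2.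
Proof. by rewrite -sumrB; apply: eq_bigr => v _; rewrite scalerBl. Qed.

Lemma massD s c1 c2 : mass s (fun v => c1 v + c2 v) = mass s c1 + mass s c2.
Proof. exact: big_split. Qed.

Lemma massZ s a c : mass s (fun v => a * c v) = a * mass s c.
Proof. by rewrite mulr_sumr. Qed.

Lemma massB s c1 c2 : mass s (fun v => c1 v - c2 v) = mass s c1 - mass s c2.
Proof. exact: sumrB. Qed.

Lemma mass_ge0 s c : (forall v, v \in s -> 0 <= c v) -> 0 <= mass s c.
Proof. by move=> c0; rewrite /mass big_seq; apply: sumr_ge0. Qed.

Lemma mass_point s x : x \in s -> mass s (fun v => (v == x)%:R) = 1.
Proof.
move=> xs; rewrite /mass (big_fsetD1 x)//= eqxx big_seq big1 ?addr0// => v.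
by rewrite in_fsetD1 => /andP[/negbTE -> _].
Qed.

Lemma comb_point s x : x \in s -> comb s (fun v => (v == x)%:R) = x.
Proof.
move=> xs; rewrite /comb (big_fsetD1 x)//= eqxx scale1r.
rewrite big_seq big1 ?addr0// => v.
by rewrite in_fsetD1 => /andP[/negbTE -> _]; rewrite scale0r.
Qed.

Lemma convex_hull_point s x : x \in s -> convex_hull [set` s] x.
Proof.
move=> xs; apply/convex_hullP; exists (fun v => (v == x)%:R).
by split; rewrite ?mass_point ?comb_point// => v; case: eqP => // ->; rewrite xs.
Qed.

Lemma convex_hullS s t : (s `<=` t)%fset ->
  convex_hull [set` s] `<=` convex_hull [set` t].
Proof.
move=> st x /(convex_hull_subP _ st)[c [c0 cs c1 ->]].
apply/convex_hullP; exists c; split => // v vt; apply: cs.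
by apply: contra vt; exact: (fsubsetP st).
Qed.

Lemma convex_hull_conv s x y (a : R) : 0 <= a <= 1 ->
  convex_hull [set` s] x -> convex_hull [set` s] y ->
  convex_hull [set` s] (a *: x + (1 - a) *: y).
Proof.
move=> /andP[a0 a1] /convex_hullP[c [c0 cs c1 ->]] /convex_hullP[e [e0 es e1 ->]].
apply/convex_hullP; exists (fun v => a * c v + (1 - a) * e v).
rewrite combD massD !combZ !massZ c1 e1; split => //.
- by move=> v; rewrite addr_ge0// mulr_ge0// subr_ge0.
- by move=> v vs; rewrite cs// es// !mulr0 addr0.
- by rewrite !mulr1 addrCA subrr addr0.
Qed.

Lemma dotE (a x : 'rV[R]_d) : dot a x = (x *m a^T) 0 0.
Proof. by rewrite mxE; apply: eq_bigr => i _; rewrite mxE mulrC. Qed.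

Lemma dotD (a x y : 'rV[R]_d) : dot a (x + y) = dot a x + dot a y.
Proof. by rewrite !dotE mulmxDl mxE. Qed.

Lemma dotZ (a x : 'rV[R]_d) k : dot a (k *: x) = k * dot a x.
Proof. by rewrite !dotE -scalemxAl mxE. Qed.

Lemma dotN (a x : 'rV[R]_d) : dot a (- x) = - dot a x.
Proof. by rewrite !dotE mulNmx mxE. Qed.

Lemma dotB (a x y : 'rV[R]_d) : dot a (x - y) = dot a x - dot a y.
Proof. by rewrite dotD dotN. Qed.

Lemma dotC (a x : 'rV[R]_d) : dot a x = dot x a.
Proof. by apply: eq_bigr => i _; rewrite mulrC. Qed.

Lemma dotNl (a x : 'rV[R]_d) : dot (- a) x = - dot a x.
Proof. by rewrite dotC dotN dotC. Qed.

Lemma dot0l (x : 'rV[R]_d) : dot 0 x = 0.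
Proof. by apply: big1 => i _; rewrite mxE mul0r. Qed.

Lemma dot0r (x : 'rV[R]_d) : dot x 0 = 0.
Proof. by rewrite dotC dot0l. Qed.

Lemma dot_comb a s c : dot a (comb s c) = \sum_(v <- s) c v * dot a v.
Proof.
rewrite dotE /comb mulmx_suml summxE; apply: eq_bigr => v _.
by rewrite -scalemxAl mxE -dotE.
Qed.

(** The workhorse for facets: with total mass 1, the slack of an inequality is the weighted sum of
    the slacks at the vertices, so that signs and tightness can be read off term by term. *)
Lemma slack_comb a b s c : mass s c = 1 ->
  b - dot a (comb s c) = \sum_(v <- s) c v * (b - dot a v).
Proof.
move=> c1; under eq_bigr do rewrite mulrBr.
by rewrite sumrB -mulr_suml -/(mass s c) c1 mul1r dot_comb.
Qed.

End Hulls.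

(** * Affine geometry by row spaces of homogenized points *)

Section Homogenization.
Context {R : realType} {d : nat}.
Implicit Types (s t V : {fset 'rV[R]_d}) (c : 'rV[R]_d -> R) (x v a : 'rV[R]_d).

(** The extra coordinate records the mass of a combination: affine hulls become row spaces, affine
    independence becomes full row rank, and dimensions go up by one. *)
Definition homog x : 'rV[R]_(d + 1) := row_mx x 1%:M.

Definition hmx s : 'M[R]_(#|` s|, d + 1) := \matrix_(i < #|` s|) homog s`_i.

Lemma hmx_mul s c :
  (\row_i c s`_i) *m hmx s = row_mx (comb s c) (mass s c)%:M.
Proof.
rewrite mulmx_sum_row.
transitivity (\sum_(v <- s) c v *: homog v).
  rewrite (big_nth 0) big_mkord; apply: eq_bigr => i _.
  by rewrite rowK mxE.
rewrite /comb /mass; elim: (enum_fset s) => [|v r IH].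
  by rewrite !big_nil scalar_mx_is_semi_additive row_mx0.
rewrite !big_cons IH /homog scale_row_mx add_row_mx scale_scalar_mx mulr1.
by rewrite raddfD.
Qed.

Lemma hmx_coef s (u : 'rV[R]_#|` s|) : exists c, u = \row_i c s`_i.
Proof.
exists (fun v => if insub (index v s) is Some i then u 0 i else 0).
apply/rowP => i; rewrite mxE index_uniq ?fset_uniq//.
by rewrite insubT//= => h; congr (u 0 _); apply: val_inj.
Qed.

Lemma hmx_subP s x (m : R) : (row_mx x m%:M <= hmx s)%MS <->
  exists c, mass s c = m /\ x = comb s c.
Proof.
split=> [/submxP[u]|[c [<- ->]]]; last by rewrite -hmx_mul submxMl.
have [c ->] := hmx_coef u; rewrite hmx_mul => /eq_row_mx[-> /eqP E].
exists c; split => //; apply/esym; move/eqP: E => /matrixP /(_ 0 0).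
by rewrite !mxE.
Qed.

Lemma hom_sub s x : (homog x <= hmx s)%MS <-> affine_hull [set` s] x.
Proof. by rewrite affine_hullP; exact: hmx_subP. Qed.

Lemma hom_subw s x : x \in s -> (homog x <= hmx s)%MS.
Proof.
move=> xs; apply/hmx_subP; exists (fun v => (v == x)%:R).
by rewrite mass_point// comb_point.
Qed.

Lemma hmx_sub m s (A : 'M[R]_(m, d + 1)) :
  (forall v, v \in s -> (homog v <= A)%MS) -> (hmx s <= A)%MS.
Proof. by move=> h; apply/row_subP => i; rewrite rowK h// mem_nth. Qed.

Lemma hmxS s t : (s `<=` t)%fset -> (hmx s <= hmx t)%MS.
Proof. by move=> /fsubsetP st; apply: hmx_sub => v /st; exact: hom_subw. Qed.

Lemma affinely_independentP s :
  affinely_independent s <-> \rank (hmx s) = #|` s|.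
Proof.
split=> [si|/eqP]; last first.
  rewrite -/(row_free _) => /row_freeP[B hB] c c1 c2 v vs.
  have := hmx_mul s c; rewrite /comb /mass c1 c2 raddf0 row_mx0.
  move/(congr1 (mulmx^~ B)); rewrite -mulmxA hB mulmx1 mul0mx.
  move: vs; rewrite -index_mem => vs /rowP /(_ (Ordinal vs)).
  by rewrite !mxE nth_index// -index_mem.
apply/eqP; rewrite -/(row_free _) -kermx_eq0; apply/eqP/row_matrixP => i.
have : row i (kermx (hmx s)) *m hmx s = 0.
  by apply/sub_kermxP; exact: row_sub.
have [c ->] := hmx_coef (row i (kermx (hmx s))).
rewrite hmx_mul -row_mx0 => /eq_row_mx[c2 /matrixP/(_ 0 0)].
rewrite !mxE => c1; apply/rowP => j; rewrite !mxE.
by rewrite si// mem_nth.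
Qed.

Lemma affinely_independent_coef s c e : affinely_independent s ->
  mass s c = mass s e -> comb s c = comb s e -> forall v, v \in s -> c v = e v.
Proof.
move=> si m q v vs; apply/eqP; rewrite -subr_eq0; apply/eqP.
apply: (si (fun v => c v - e v)) => //.
  by rewrite [LHS]massB m subrr.
by rewrite [LHS]combB q subrr.
Qed.

Lemma affinely_independentS s t : (s `<=` t)%fset ->
  affinely_independent t -> affinely_independent s.
Proof.
move=> st ti c c1 c2 v vs.
pose e v := if v \in s then c v else 0.
have ec : {in s, e =1 c} by move=> w ws; rewrite /e ws.
have e0 w : w \notin s -> e w = 0 by rewrite /e => /negbTE ->.
rewrite -(ec _ vs); apply: (ti e); last exact: (fsubsetP st).
  by rewrite -/(mass t e) -(mass_sub st)// -[RHS]c1; exact: eq_mass.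
by rewrite -/(comb t e) -(comb_sub st)// -[RHS]c2; exact: eq_comb.
Qed.

Lemma full_sub m (A : 'M[R]_(m, d + 1)) :
  (forall x, (homog x <= A)%MS) -> \rank A = (d + 1)%N.
Proof.
move=> h; have A1 : ((1%:M : 'M[R]_(d + 1)) <= A)%MS.
  apply/row_subP => i; rewrite -[row i _]hsubmxK.
  set l := lsubmx _; set r := rsubmx _.
  (* The vector [homog 0] is the last unit vector, so it corrects the last coordinate of
     [homog l]. *)
  have -> : row_mx l r = homog l + (r 0 0 - 1) *: homog 0.
    rewrite /homog scale_row_mx add_row_mx scaler0 addr0; congr row_mx.
    rewrite [LHS]mx11_scalar scale_scalar_mx mulr1 raddfB/=.
    by rewrite addrC subrK.
  by rewrite addmx_sub ?scalemx_sub ?h.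
by apply/eqP; rewrite eqn_leq rank_leq_col -[leqLHS](mxrank1 R) mxrankS.
Qed.

Lemma full_dimensionalP V : full_dimensional V <-> \rank (hmx V) = (d + 1)%N.
Proof.
split=> [V1|/eqP V1].
  by apply: full_sub => x; apply/hom_sub; rewrite V1.
rewrite /full_dimensional -subTset => x _.
apply/hom_sub/submx_full.
by rewrite /row_full V1.
Qed.

(** The columns of [cokermx A] are the equations of the row space. One that fails at [homog x]
    splits into a linear part and a constant. *)
Lemma separate_flat m (A : 'M[R]_(m, d + 1)) x : ~~ (homog x <= A)%MS ->
  exists a b, (forall v, (homog v <= A)%MS -> dot a v = b) /\ dot a x <> b.
Proof.
rewrite submxE => /eqP/rowP nx.
have /existsNP[j jP] : ~ forall j, (homog x *m cokermx A) 0 j = 0.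
  by move=> h; apply: nx => j; rewrite h mxE.
pose h := col j (cokermx A).
have hE y : (homog y *m h) 0 0 = dot (usubmx h)^T y + dsubmx h 0 0.
  rewrite -[h]vsubmxK mul_row_col mxE mul1mx dotE trmxK.
  by rewrite col_mxKu col_mxKd.
exists (usubmx h)^T, (- dsubmx h 0 0); split => [v|E].
  rewrite submxE => /eqP vA; apply/eqP; rewrite -addr_eq0 -hE; apply/eqP.
  by rewrite /h colE mulmxA vA mul0mx mxE.
apply: jP; have := hE x; rewrite E addNr /h colE mulmxA -colE mxE; exact.
Qed.

Lemma annihilator m (A : 'M[R]_(m, d + 1)) : (\rank A < d + 1)%N ->
  exists a b, (forall v, (homog v <= A)%MS -> dot a v = b) /\
    exists x, dot a x <> b.
Proof.
move=> rA; have /existsNP[x /negP xA] : ~ forall x, (homog x <= A)%MS.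
  by move=> /full_sub E; rewrite E ltnn in rA.
by have [a [b [h1 h2]]] := separate_flat xA; exists a, b; split => //; exists x.
Qed.

Lemma rank_col_homog k (p : 'rV[R]_d) (B : 'M[R]_(k, d)) :
  \rank (col_mx (homog p) (row_mx B 0)) = (\rank B).+1.
Proof.
have -> : row_mx B 0 = B *m row_mx 1%:M (0 : 'M[R]_(d, 1)).
  by rewrite mul_mx_row mulmx1 mulmx0.
have rf : row_free (row_mx 1%:M 0 : 'M[R]_(d, d + 1)).
  apply/row_freeP; exists (col_mx 1%:M 0).
  by rewrite mul_row_col mulmx1 mul0mx addr0.
rewrite -addsmxE mxrank_disjoint_sum ?mxrankMfree//.
  rewrite -[RHS]add1n; congr (_ + _)%N.
  apply/eqP; rewrite eqn_leq rank_leq_row lt0n mxrank_eq0.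
  apply/negP => /eqP/matrixP/(_ 0 (rshift d 0)).
  by rewrite row_mxEr !mxE/= => /eqP; rewrite oner_eq0.
apply/eqP/rowV0P => v; rewrite sub_capmx => /andP[/sub_rVP[k0 ->]].
move=> /submxP[y]; rewrite mulmxA mul_mx_row mulmx0 mulmx1 => /matrixP/(_ 0 (rshift d 0)).
rewrite mxE !row_mxEr !mxE/= mulr1 => ->; by rewrite scale0r.
Qed.

(** A base point at height one together with [k] independent directions at height zero gives rank
    [k.+1]. *)
Lemma has_dim_leq_rank (X : set 'rV[R]_d) k s :
  has_dim X k -> X `<=` affine_hull [set` s] -> (k < \rank (hmx s))%N.
Proof.
move=> [p [B [/eqP B1 XE]]] Xs.
have Ys : affine_hull X `<=` affine_hull [set` s].
  move=> _ [m [q [w [Xq w1 ->]]]]; apply/hom_sub.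
  have -> : homog (\sum_i w i *: q i) = \sum_i w i *: homog (q i).
    apply/rowP => j; rewrite summxE; case: (split_ordP j) => l ->.
      rewrite /homog row_mxEl summxE; apply: eq_bigr => i _.
      by rewrite [RHS]mxE row_mxEl mxE.
    rewrite /homog row_mxEr ord1 mxE -[LHS]w1; apply: eq_bigr => i _.
    by rewrite mxE row_mxEr mxE mulr1.
  apply: summx_sub => i _; apply: scalemx_sub; apply/hom_sub/Xs/Xq.
have hB y : (homog (p + y *m B) <= hmx s)%MS.
  by apply/hom_sub/Ys; rewrite XE; exists y.
pose C := col_mx (homog p) (row_mx B 0).
have <- : \rank C = k.+1 by rewrite rank_col_homog B1.
apply: mxrankS; rewrite col_mx_sub; apply/andP; split.
  by have := hB 0; rewrite mul0mx addr0.
apply/row_subP => i.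
have -> : row i (row_mx B 0) =
    homog (p + delta_mx 0 i *m B) - (homog p : 'rV[R]_(d + 1)).
  rewrite /homog opp_row_mx add_row_mx subrr addrAC subrr add0r -rowE.
  by rewrite row_row_mx row0.
rewrite addmx_sub ?hB// eqmx_opp.
by have := hB 0; rewrite mul0mx addr0.
Qed.

End Homogenization.

(** * Farkas' lemma and facets *)

Lemma seq_argmin {R : realType} {T : eqType} (F : T -> R) (r : seq T) x :
  x \in r -> exists2 y, y \in r & forall z, z \in r -> F y <= F z.
Proof.
elim: r x => // y r IH x _; case: r IH => [_|w r IH].
  by exists y; rewrite ?mem_head// => z; rewrite inE => /eqP ->.
have [z zr zm] := IH w (mem_head _ _).
have [yz|zy] := leP (F y) (F z).
  exists y; first exact: mem_head.
  by move=> t; rewrite in_cons => /predU1P[-> //|/zm]; exact: le_trans.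
exists z; first by rewrite in_cons zr orbT.
by move=> t; rewrite in_cons => /predU1P[->|/zm//]; exact: ltW.
Qed.

(* Bartl's induction: when the functional found for the first vectors is negative
   on the new one, project everything along the new vector. *)
Lemma farkas {R : realType} {d : nat} n (f : nat -> 'rV[R]_d) (b : 'rV[R]_d) :
  (exists c : nat -> R, (forall i, 0 <= c i) /\ b = \sum_(i < n) c i *: f i) \/
  (exists a, (forall i, (i < n)%N -> 0 <= dot a (f i)) /\ dot a b < 0).
Proof.
elim: n f b => [|n IH] f b.
  have [->|/rV0Pn[j bj]] := eqVneq b 0.
    by left; exists (fun=> 0); split => //; rewrite big_ord0.
  right; exists (- b); split => //; rewrite dotC dotN oppr_lt0 /dot.
  rewrite (bigD1 j)//= ltr_pwDl//; first by rewrite -expr2 exprn_even_gt0.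
  by apply: sumr_ge0 => i _; rewrite -expr2 sqr_ge0.
have [[c [c0 cb]]|[a [a0 ab]]] := IH f b.
  left; exists (fun i => if (i < n)%N then c i else 0); split => [i|].
    by case: ifP.
  rewrite big_ord_recr/= ltnn scale0r addr0 cb.
  by apply: eq_bigr => i _; rewrite ltn_ord.
have [av|av] := leP 0 (dot a (f n)).
  right; exists a; split => // i; rewrite ltnS leq_eqVlt => /predU1P[->//|].
  exact: a0.
pose p x := x - (dot a x / dot a (f n)) *: f n.
have av0 : dot a (f n) != 0 by rewrite lt_eqF.
have [[c [c0 cb]]|[e [e0 eb]]] := IH (p \o f) (p b).
  (* The coefficient of [f n]. It is nonnegative because [a] is negative on [b] and on [f n] and
     nonnegative on the earlier vectors. *)
  pose m := dot a b / dot a (f n) -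
    \sum_(i < n) c i * (dot a (f i) / dot a (f n)).
  left; exists (fun i => if (i < n)%N then c i else m); split => [i|].
    case: ifP => // _; rewrite /m subr_ge0.
    apply: (@le_trans _ _ 0); last by rewrite ltW// nmulr_rgt0// invr_lt0.
    apply: sumr_le0 => j _; rewrite mulr_ge0_le0// mulr_ge0_le0//.
      exact: a0.
    by rewrite invr_le0 ltW.
  have -> : b = p b + (dot a b / dot a (f n)) *: f n by rewrite subrK.
  rewrite big_ord_recr/= ltnn cb /m scalerBl scaler_suml.
  under [X in _ = X + _]eq_bigr do rewrite ltn_ord.
  have -> : \sum_(i < n) c i *: (p \o f) i = \sum_(i < n) c i *: f i -
      \sum_(i < n) (c i * (dot a (f i) / dot a (f n))) *: f n.
    by rewrite -sumrB; apply: eq_bigr => i _; rewrite /p/= scalerBr scalerA.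
  by rewrite -addrA [- _ + _]addrC.
(* The functional [g] is [e] composed with the projection [p]; it therefore vanishes on [f n]. *)
right; pose g := e - (dot e (f n) / dot a (f n)) *: a.
have gE x : dot g x = dot e (p x).
  rewrite /p dotB dotZ dotC /g dotB dotZ !(dotC x); congr (_ - _).
  by rewrite mulrAC [RHS]mulrAC [dot e _ * _]mulrC.
exists g; split => [i|]; last by rewrite gE.
rewrite gE ltnS leq_eqVlt => /predU1P[->|]; last exact: e0.
by rewrite /p divff// scale1r subrr dot0r.
Qed.

Section Facets.
Context {R : realType} {d : nat}.
Implicit Types (s t V U : {fset 'rV[R]_d}) (c : 'rV[R]_d -> R) (x v a : 'rV[R]_d).

Lemma farkas_fset s x :
  (exists2 c, forall v, 0 <= c v & x = comb s c) \/
  (exists2 a, forall v, v \in s -> 0 <= dot a v & dot a x < 0).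
Proof.
have [[c [c0 ->]]|[a [a0 ax]]] := @farkas R d #|` s| (fun i => s`_i) x.
  left; exists (fun v => c (index v s)) => //.
  rewrite /comb [RHS](big_nth 0) big_mkord; apply: eq_bigr => i _.
  by rewrite index_uniq ?fset_uniq.
by right; exists a => // v vs; rewrite -(nth_index 0 vs) a0// index_mem.
Qed.

Definition tight V a (b : R) : {fset 'rV[R]_d} := [fset v in V | dot a v == b]%fset.

Definition valid V a (b : R) := forall v, v \in V -> dot a v <= b.

Lemma tightP V a b v : reflect (v \in V /\ dot a v = b) (v \in tight V a b).
Proof.
by rewrite /tight !inE /=; apply: (iffP andP) => -[vV /eqP].
Qed.

Lemma tight_sub V a b : (tight V a b `<=` V)%fset.
Proof. by apply/fsubsetP => v /tightP[]. Qed.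

Lemma valid_hull V a b x : valid V a b -> convex_hull [set` V] x -> dot a x <= b.
Proof.
move=> ab /convex_hullP[c [c0 _ c1 ->]].
rewrite -subr_ge0 slack_comb// big_seq; apply: sumr_ge0 => v vV.
by rewrite mulr_ge0// subr_ge0 ab.
Qed.

Lemma valid_hull_tight V a b c : valid V a b -> (forall v, v \in V -> 0 <= c v) ->
  mass V c = 1 -> dot a (comb V c) = b ->
  forall v, v \in V -> c v != 0 -> dot a v = b.
Proof.
move=> ab c0 c1 /eqP; rewrite eq_sym -subr_eq0 slack_comb// big_seq.
rewrite psumr_eq0; last by move=> v vV; rewrite mulr_ge0 ?c0// subr_ge0 ab.
move=> /allP h v vV cv; have := h v vV; rewrite vV/= mulf_eq0 (negbTE cv)/=.
by rewrite subr_eq0 => /eqP.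
Qed.

Lemma affine_functional_eq V a b x : full_dimensional V ->
  (forall v, v \in V -> dot a v = b) -> dot a x = b.
Proof.
move=> VF h; have : affine_hull [set` V] x by rewrite VF.
move=> /affine_hullP[c [c1 ->]]; apply/eqP; rewrite eq_sym -subr_eq0.
rewrite slack_comb// big_seq big1// => v /h ->.
by rewrite subrr mulr0.
Qed.

Lemma hmx_dot V a b v : (forall w, w \in V -> dot a w = b) ->
  (homog v <= hmx V)%MS -> dot a v = b.
Proof.
move=> h /hom_sub/affine_hullP[c [c1 ->]]; apply/eqP.
rewrite eq_sym -subr_eq0 slack_comb// big_seq big1// => w /h ->.
by rewrite subrr mulr0.
Qed.

(** As long as the tight points have rank below d, some nonconstant affine function vanishes on them
    and at [u]. Adding the largest multiple of it that keeps the inequality valid makes a new vertex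
    tight and leaves the slack at [u] unchanged. The point [u] may lie on either side: inside, the
    facet avoids it; outside, the facet separates it from the hull. *)
Lemma rotate_to_facet V a b u : full_dimensional V -> valid V a b ->
  dot a u <> b -> exists a' b', [/\ valid V a' b',
    dot a' u - b' = dot a u - b, (tight V a b `<=` tight V a' b')%fset &
    \rank (hmx (tight V a' b')) = d].
Proof.
move=> VF.
have [n] := ubnP (#|` V| - #|` tight V a b|); elim: n a b => // n IH a b.
rewrite ltnS => nle ab au.
have [|/negP rd] := boolP (\rank (hmx (tight V a b)) == d).
  by move/eqP => rd; exists a, b.
have rlt : (\rank (col_mx (hmx (tight V a b)) (homog u)) < d + 1)%N.
  rewrite -addsmxE.
  have r1 : (\rank (hmx (tight V a b)) < d)%N.
    rewrite ltn_neqAle; apply/andP; split; first exact/negP.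
    rewrite -ltnS -[X in (_ < X)%N]addn1 ltn_neqAle rank_leq_col andbT.
    apply/eqP => E; apply: au; apply: (@hmx_dot (tight V a b)).
      by move=> w /tightP[].
    by apply: submx_full; rewrite /row_full E.
  apply: leq_ltn_trans (mxrank_adds_leqif _ _) _.
  have := rank_leq_row (homog u); rewrite -(leq_add2l (\rank (hmx (tight V a b)))).
  by move=> /leq_ltn_trans; apply; rewrite ltn_add2r.
have [e [f [ef [x ex]]]] := annihilator rlt.
have eu : dot e u = f by apply: ef; rewrite -addsmxE addsmxSr.
have et v : v \in tight V a b -> dot e v = f.
  by move=> /hom_subw h; apply: ef; rewrite -addsmxE (submx_trans h)// addsmxSl.
(* The function is not constant on [V], so up to sign it is positive at some vertex. *)
wlog [w wV ew] : e f ef ex eu et / exists2 w, w \in V & f < dot e w.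
  move=> H.
  have /existsNP[w /not_implyP[wV ew]] : ~ forall v, v \in V -> dot e v = f.
    by move=> h; apply: ex; exact: affine_functional_eq h.
  have [ltw|ltw|fe] := ltgtP f (dot e w); last by case: ew.
    by apply: (H e f) => //; exists w.
  apply: (H (- e) (- f)) => [v /ef|||v /et|]; rewrite ?dotNl.
  - by move=> ->.
  - by move/oppr_inj.
  - by rewrite eu.
  - by move=> ->.
  - by exists w => //; rewrite dotNl ltrN2.
pose V' := [fset v in V | f < dot e v]%fset.
(* Ratio test: [q v] is the multiple at which [v] becomes tight, and the smallest one is the first
   to be reached. *)
pose q v := (b - dot a v) / (dot e v - f).
have wV' : w \in V' by rewrite !inE/= wV.
have [y yV' ymin] := @seq_argmin _ _ q (enum_fset V') w wV'.
have /andP[yV fy] : (y \in V) && (f < dot e y).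
  by have : y \in V' := yV'; rewrite !inE.
have q0 v : v \in V -> f < dot e v -> 0 <= q v.
  by move=> vV fv; rewrite divr_ge0 ?subr_ge0 ?ab// ltW.
pose a' := a + q y *: e; pose b' := b + q y * f.
have slackE v : b' - dot a' v = b - dot a v - q y * (dot e v - f).
  rewrite (dotC a') dotD dotZ !(dotC v) /b' mulrBr !opprB.
  by rewrite opprD addrACA; congr (_ + _); rewrite addrC.
have nty : y \notin tight V a b.
  by apply/negP => /et ye; rewrite ye ltxx in fy.
have yt : y \in tight V a' b'.
  apply/tightP; split => //; apply/eqP; rewrite eq_sym -subr_eq0 slackE.
  by rewrite /q divfK ?subrr// subr_eq0 gt_eqF.
have st : (tight V a b `<=` tight V a' b')%fset.
  apply/fsubsetP => v vt; have [vV av] := tightP _ _ _ _ vt.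
  apply/tightP; split => //; apply/eqP; rewrite eq_sym -subr_eq0 slackE.
  by rewrite av (et _ vt) !subrr mulr0 subrr.
have u' : dot a' u - b' = dot a u - b.
  by apply: oppr_inj; rewrite !opprB slackE eu subrr mulr0 subr0.
have [|||a2 [b2 [h1 h2 h3 h4]]] := IH a' b'.
- apply: leq_trans nle; rewrite ltn_sub2l//; last first.
    apply: fproper_ltn_card; rewrite fproperE st/=.
    by apply: contra nty => /fsubsetP; apply.
  apply: fproper_ltn_card; rewrite fproperE tight_sub/=.
  by apply: contra nty => /fsubsetP; apply.
- move=> v vV; rewrite -subr_ge0 slackE subr_ge0.
  have [fv|fv] := ltP f (dot e v); last first.
    apply: (@le_trans _ _ 0); last by rewrite subr_ge0 ab.
    by rewrite mulr_ge0_le0 ?q0// subr_le0.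
  rewrite -ler_pdivlMr ?subr_gt0//; apply: ymin.
  by have -> : (v \in enum_fset V') = (v \in V') by []; rewrite !inE/= vV.
- by move/eqP; rewrite -subr_eq0 u' subr_eq0 => /eqP.
by exists a2, b2; split => //; [rewrite h2|exact: fsubset_trans h3].
Qed.

Lemma facet_of_tight V a b u : (0 < d)%N -> valid V a b -> dot a u <> b ->
  \rank (hmx (tight V a b)) = d ->
  facet (convex_hull [set` V]) (convex_hull [set` V] `&` [set x | dot a x = b]).
Proof.
move=> d0 ab au rt; split.
  by exists a, b; split => // x; exact: valid_hull.
set t := tight V a b in rt.
have tE v : v \in t -> dot a v = b by case/tightP.
pose h : 'cV[R]_(d + 1) := col_mx a^T (- b)%:M.
have hE x : (homog x *m h) 0 0 = dot a x - b.
  by rewrite mul_row_col mul1mx !mxE dotE mxE eqxx.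
have th : (hmx t <= kermx h)%MS.
  apply: hmx_sub => v vt; apply/sub_kermxP/matrixP => i j.
  by rewrite !ord1 hE tE// subrr mxE.
have h0 : h != 0.
  by apply: contra_notN au => /eqP h0; apply/eqP; rewrite -subr_eq0 -hE h0 mulmx0 mxE.
have rh : \rank h = 1%N.
  by apply/eqP; rewrite eqn_leq rank_leq_col lt0n mxrank_eq0 h0.
(* Both spaces have rank d, so the inclusion is an equality: every point of the hyperplane is an
   affine combination of tight vertices. *)
have ht : (kermx h <= hmx t)%MS.
  have := mxrank_leqif_sup th; rewrite mxrank_ker rh addnK rt => /leqifP.
  by case: ifP => // _; rewrite ltnn.
have tE' x : dot a x = b -> (homog x <= hmx t)%MS.
  move=> ax; apply: submx_trans ht; apply/sub_kermxP/matrixP => i j.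
  by rewrite !ord1 hE ax subrr mxE.
have [p pt] : exists p, p \in t.
  have [t0|] := eqVneq t fset0; last by case/fset0Pn => p; exists p.
  have := rank_leq_row (hmx t); rewrite rt t0 cardfs0 leqNgt; by rewrite d0.
have a0 : a != 0.
  apply: contra_notN au => /eqP a0; rewrite -(tE _ pt) a0.
  by rewrite !dot0l.
have ra : \rank (kermx a^T) = d.-1.
  rewrite mxrank_ker mxrank_tr; suff -> : \rank a = 1%N by rewrite subn1.
  by apply/eqP; rewrite eqn_leq rank_leq_row lt0n mxrank_eq0 a0.
exists p, (castmx (ra, erefl d) (row_base (kermx a^T))); split.
  by rewrite row_free_castmx row_base_free.
apply/seteqP; split => [_ [m [q [w [qF w1 ->]]]]|x [y _ <-]].
  have /submxP[y yE] : (\sum_i w i *: q i - p <= row_base (kermx a^T))%MS.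
    rewrite eq_row_base; apply/sub_kermxP/matrixP => i j; rewrite !ord1 -dotE mxE dotB.
    rewrite (tE _ pt) dotE mulmx_suml summxE.
    rewrite (eq_bigr (fun i => w i * b)) -?mulr_suml ?w1 ?mul1r ?subrr// => k _.
    by rewrite -scalemxAl mxE -dotE; case: (qF k) => _ /= ->.
  exists (castmx (erefl 1%N, ra) y) => //.
  have -> : castmx (erefl 1%N, ra) y *m castmx (ra, erefl d) (row_base (kermx a^T))
      = y *m row_base (kermx a^T) by case: _ / ra.
  by rewrite -yE addrC subrK.
set B := castmx _ _.
have : dot a (p + y *m B) = b.
  rewrite dotD (tE _ pt) dotE.
  have /sub_kermxP -> : (y *m B <= kermx a^T)%MS; last by rewrite mxE addr0.
  by rewrite (submx_trans (submxMl _ _))// {}/B; case: _ / ra; rewrite castmx_id eq_row_base.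
move=> /tE'/hom_sub/affine_hullP[c [c1 ->]].
have [m [q [qt m1 ->]]] := comb_enum t c.
exists m, q, (c \o q); split => //= [i|]; last by rewrite -m1.
have [qV qa] := tightP _ _ _ _ (qt i).
by split => //; exact: convex_hull_point.
Qed.

(** Apply Farkas to the vectors from [b] to the vertices. If [b - u] is in their cone, a short step
    past [b] stays in the hull. Otherwise the separating functional gives an inequality tight at [b]
    and strict at [u], which can be rotated to a facet. *)
Lemma facet_avoiding V b u : (0 < d)%N -> full_dimensional V ->
  convex_hull [set` V] b ->
  (forall k, 0 < k -> ~ convex_hull [set` V] (b + k *: (b - u))) ->
  exists a m, [/\ valid V a m, dot a b = m, dot a u < m
    & facet (convex_hull [set` V]) (convex_hull [set` V] `&` [set x | dot a x = m])].
Proof.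
move=> d0 VF bP nk.
have [] := @farkas_fset [fset v - b | v in V]%fset (b - u).
  move=> [c c0 cE]; exfalso.
  have {}cE : b - u = \sum_(v <- V) c (v - b) *: (v - b).
    by rewrite cE /comb big_imfset//= => v w _ _ /addIr.
  pose C := mass V (fun v => c (v - b)).
  have C0 : 0 <= C by exact: mass_ge0.
  have {}cE : comb V (fun v => c (v - b)) = (b - u) + C *: b.
    by rewrite cE /C scaler_suml -big_split; apply: eq_bigr => v _ /=;
      rewrite scalerBr subrK.
  (* With no mass at all, [b] equals [u] and the ray does not move; otherwise the step [C^-1] lands
     on a convex combination. *)
  have [C00|Cn0] := eqVneq C 0.
    have c00 v : v \in V -> c (v - b) = 0.
      move=> vV; apply/eqP; move/eqP: C00.
      rewrite /C /mass psumr_eq0// => /allP/(_ v vV).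
      by [].
    have bu : b - u = 0.
      move: cE; rewrite C00 scale0r addr0 => <-.
      by rewrite /comb big_seq big1// => v /c00 ->; rewrite scale0r.
    by apply: (nk 1) => //; rewrite bu scaler0 addr0.
  have Cp : 0 < C by rewrite lt_def Cn0.
  apply: (nk C^-1); first by rewrite invr_gt0.
  have -> : b + C^-1 *: (b - u) = comb V (fun v => C^-1 * c (v - b)).
    by rewrite combZ cE [RHS]scalerDr scalerA mulVf// scale1r addrC.
  apply/convex_hullP; exists (fun v => if v \in V then C^-1 * c (v - b) else 0).
  split.
  - by move=> v; case: ifP => // _; rewrite mulr_ge0// invr_ge0.
  - by move=> v /negbTE ->.
  - by rewrite mass_restrict massZ mulVf.
  - by rewrite comb_restrict.
move=> [a a0 au].
have ab : valid V (- a) (dot (- a) b).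
  move=> v vV; rewrite !dotNl lerN2 -subr_ge0 -dotB; apply: a0.
  by apply/imfsetP; exists v.
have au' : dot (- a) u < dot (- a) b.
  by rewrite !dotNl ltrN2 -subr_lt0 -dotB.
have [|e [f [h1 h2 h3 h4]]] := rotate_to_facet VF ab (u := u).
  by apply/eqP; rewrite lt_eqF.
have eu : dot e u < f by rewrite -subr_lt0 h2 subr_lt0.
exists e, f; split => //.
(* The vertices that carry [b] are tight for the first inequality, and the rotation keeps them
   tight. *)
- have [c [c0 cs c1 cE]] := (convex_hullP _ _).1 bP.
  apply/eqP; rewrite eq_sym -subr_eq0 cE slack_comb// big_seq big1// => v vV.
  have [->|cv] := eqVneq (c v) 0; first by rewrite mul0r.
  suff /(fsubsetP h3)/tightP[_ ->] : v \in tight V (- a) (dot (- a) b).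
    by rewrite subrr mulr0.
  apply/tightP; split => //.
  by apply: (valid_hull_tight ab _ c1) => //; rewrite -cE.
- by apply: (facet_of_tight d0 h1 _ h4 (u := u)); apply/eqP; rewrite lt_eqF.
Qed.

End Facets.

(** * Spines and the projection *)

Section ConvexPosition.
Context {R : realType} {d : nat}.
Implicit Types (s t V U : {fset 'rV[R]_d}) (c : 'rV[R]_d -> R) (x v a : 'rV[R]_d).

Lemma convex_position_coef V v c : convex_position V -> v \in V ->
  (forall w, w \in V -> 0 <= c w) -> mass V c = 1 -> comb V c = v -> c v = 1.
Proof.
move=> VC vV c0 c1 cv; apply/eqP/negPn/negP => nv.
have split1 (T : nmodType) (F : 'rV[R]_d -> T) :
    \sum_(w <- V) F w = F v + \sum_(w <- (V `\ v)%fset) F w.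
  by rewrite (big_fsetD1 v).
have m1 : mass (V `\ v)%fset c = 1 - c v.
  by rewrite -c1 /mass split1 addrC addrK.
have n0 : 1 - c v != 0 by rewrite subr_eq0 eq_sym.
have cl : c v <= 1.
  rewrite -subr_ge0 -m1; apply: mass_ge0 => w.
  by rewrite in_fsetD1 => /andP[_ /c0].
apply: (VC v vV); apply/convex_hullP.
exists (fun w => if w \in (V `\ v)%fset then (1 - c v)^-1 * c w else 0); split.
- move=> w; case: ifP => //; rewrite in_fsetD1 => /andP[_ /c0 cw].
  by rewrite mulr_ge0// invr_ge0 subr_ge0.
- by move=> w /negbTE ->.
- by rewrite mass_restrict massZ m1 mulVf.
- have cE : comb (V `\ v)%fset c = (1 - c v) *: v.
    by rewrite scalerBl scale1r -[X in X - _]cv /comb split1 addrC addrK.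
  by rewrite comb_restrict combZ cE scalerA mulVf// scale1r.
Qed.

(** Solving for [v] writes it as the average of [y] and [x] with weights proportional to 1 and [k].
    Convex position puts all the mass at [v], hence also the mass of [x]. *)
Lemma extreme V v x y (k : R) : convex_position V -> v \in V -> 0 < k ->
  convex_hull [set` V] x -> convex_hull [set` V] y ->
  v + k *: (v - x) = y -> x = v.
Proof.
move=> VC vV k0 /convex_hullP[c [c0 cs c1 ->]] /convex_hullP[e [e0 es e1 ->]] E.
have k1 : 0 < 1 + k by rewrite ltr_wpDl.
pose f w := (1 + k)^-1 * (e w + k * c w).
have fv : comb V f = v.
  rewrite /f combZ combD -E combZ -addrA -scalerDr subrK.
  by rewrite -{1}[v]scale1r -scalerDl scalerA mulVf ?scale1r// gt_eqF.
have f1 : mass V f = 1.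
  by rewrite /f massZ massD massZ c1 e1 mulr1 mulVf// gt_eqF.
have fv1 : f v = 1.
  apply: (convex_position_coef VC) => // w _.
  apply: mulr_ge0; first by rewrite invr_ge0 ltW.
  by apply: addr_ge0 => //; apply: mulr_ge0 => //; exact: ltW.
have le1 g : (forall w, 0 <= g w) -> mass V g = 1 -> g v <= 1.
  by move=> g0 <-; rewrite /mass (big_fsetD1 v)//= lerDl; exact: sumr_ge0.
have cv : c v = 1.
  apply/eqP; rewrite eq_le le1//= leNgt; apply/negP => cv.
  suff : f v < 1 by rewrite fv1 ltxx.
  rewrite /f mulrC ltr_pdivrMr// mul1r; apply: ler_ltD; first exact: le1.
  by rewrite -[ltRHS]mulr1 ltr_pM2l.
have /eqP : mass (V `\ v)%fset c = 0.
  by apply: (addrI 1); rewrite -{1}cv -[LHS](big_fsetD1 v (F := c))//= addr0.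
rewrite psumr_eq0// => /allP cw.
rewrite /comb (big_fsetD1 v)//= cv scale1r big_seq big1 ?addr0// => w /cw /eqP ->.
by rewrite scale0r.
Qed.

Lemma vertex_facet V v x : (0 < d)%N -> full_dimensional V ->
  convex_position V -> v \in V -> convex_hull [set` V] x -> x <> v ->
  exists a m, [/\ valid V a m, dot a v = m, dot a x < m
    & facet (convex_hull [set` V]) (convex_hull [set` V] `&` [set y | dot a y = m])].
Proof.
move=> d0 VF VC vV xP xv; apply: facet_avoiding => //.
  exact: convex_hull_point.
by move=> k k0 kP; apply: xv; exact: (extreme VC vV k0 xP kP).
Qed.

(** The facet contains at least |U| - 1 points of [U], all of them in [U] minus [u], so it contains
    the whole of that set. *)
Lemma spine_facet V U a m u w : spine V U ->
  facet (convex_hull [set` V]) (convex_hull [set` V] `&` [set y | dot a y = m]) ->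
  u \in U -> dot a u < m -> w \in U -> w != u -> dot a w = m.
Proof.
move=> [_ SU] /SU + uU am wU wu; set F := (X in (_ <= #|` X|.+1)%N) => le.
have FU : (F `<=` (U `\ u)%fset)%fset.
  apply/fsubsetP => v; rewrite /F !inE/= => /andP[-> /asboolP[_ /= E]].
  by rewrite andbT; apply/eqP => vu; move: am; rewrite -E vu ltxx.
have /eqP FE : F == (U `\ u)%fset.
  rewrite eqEfcard FU/= -ltnS; apply: leq_trans le.
  by rewrite [leqRHS](cardfsD1 u) uU.
have : w \in F by rewrite FE !inE wu.
by rewrite /F !inE => /andP[_ /asboolP[]].
Qed.

Lemma another_vertex V u : (0 < d)%N -> full_dimensional V ->
  exists2 v, v \in V & v != u.
Proof.
move=> d0 /full_dimensionalP rV.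
have : (1 < #|` V|)%N.
  by apply: leq_trans (rank_leq_row (hmx V)); rewrite rV addn1 ltnS.
rewrite (cardfsD1 u) => V1.
have /fset0Pn[v] : (V `\ u)%fset != fset0.
  by rewrite -cardfs_gt0; move: V1; case: (u \in V) => //= /ltnW.
by rewrite !inE => /andP[vu vV]; exists v.
Qed.

Lemma facet_missing V U u : (0 < d)%N -> full_dimensional V ->
  convex_position V -> spine V U -> u \in U ->
  exists a m, [/\ valid V a m, dot a u < m
    & forall w, w \in U -> w != u -> dot a w = m].
Proof.
move=> d0 VF VC SU uU; have [v vV vu] := another_vertex u d0 VF.
have uV : u \in V by apply: (fsubsetP SU.1).
have [||a [m [h1 h2 h3 h4]]] := vertex_facet d0 VF VC vV (x := u).
- exact: convex_hull_point.
- by move=> uv; rewrite uv eqxx in vu.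
by exists a, m; split => // w wU wu; exact: (spine_facet SU h4 uU).
Qed.

(** The slack of a facet that misses [u] vanishes on the rest of [U], so evaluating it on an affine
    relation isolates the coefficient of [u]. *)
Lemma spine_independent V U : (0 < d)%N -> full_dimensional V ->
  convex_position V -> spine V U -> affinely_independent U.
Proof.
move=> d0 VF VC SU c c1 c2 u uU.
have [a [m [av au aw]]] := facet_missing d0 VF VC SU uU.
have : \sum_(w <- U) c w * (m - dot a w) = 0.
  under eq_bigr do rewrite mulrBr.
  by rewrite sumrB -mulr_suml c1 mul0r -dot_comb [comb _ _]c2 dot0r subrr.
rewrite (big_fsetD1 u)//= big_seq big1 ?addr0 => [/eqP|w]; last first.
  by rewrite !inE => /andP[wu wU]; rewrite aw// subrr mulr0.
by rewrite mulf_eq0 subr_eq0 (gt_eqF au) orbF => /eqP.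
Qed.

End ConvexPosition.

(** * The projection along the direction of U *)

Section ProjectionFacts.
Context {R : realType} {d : nat}.
Variable U : {fset 'rV[R]_d}.
Implicit Types (x y u : 'rV[R]_d) (c : 'rV[R]_d -> R).

(** Turns the matrix sum into combinations of total mass 0, the form in which the kernel of the
    projection is used throughout. *)
Lemma direction_sub x : (x <= direction U)%MS <->
  exists c, mass U c = 0 /\ x = comb U c.
Proof.
split=> [|[c [c0 ->]]].
  pose Q y := exists c, mass U c = 0 /\ y = comb U c.
  have Q0 : Q 0.
    by exists (fun=> 0); rewrite /mass /comb !big1// => u _; rewrite scale0r.
  have QD y z : Q y -> Q z -> Q (y + z).
    move=> [c [c0 ->]] [e [e0 ->]]; exists (fun v => c v + e v).
    by rewrite massD combD c0 e0 addr0.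
  have sumQ (r : seq 'rV[R]_d) (A : 'rV[R]_d -> 'M[R]_d) : {subset r <= U} ->
      (forall u, u \in U -> forall y : 'rV_d, (y <= A u)%MS -> Q y) ->
      forall y : 'rV_d, (y <= \sum_(u <- r) A u)%MS -> Q y.
    elim: r => [|u r IH] rU AQ y.
      by rewrite big_nil submx0 => /eqP ->.
    rewrite big_cons => /sub_addsmxP[[p q] /= ->]; apply: QD.
      by apply: (AQ u); rewrite ?submxMl// rU// mem_head.
    apply: IH; rewrite ?submxMl// => v vr.
    by apply: rU; rewrite in_cons vr orbT.
  apply: (sumQ _ _) => // u uU; apply: (sumQ _ _) => // v vU y.
  rewrite genmxE => /sub_rVP[k ->].
  exists (fun w => k * ((w == u)%:R - (w == v)%:R)).
  by rewrite massZ massB combZ combB !mass_point// !comb_point// subrr mulr0.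
have [U0|/fset0Pn[u0 uU]] := eqVneq U fset0.
  by rewrite /comb U0 big_nil sub0mx.
have -> : comb U c = \sum_(u <- U) c u *: (u - u0).
  under [RHS]eq_bigr do rewrite scalerBr.
  by rewrite sumrB -scaler_suml [X in X *: _]c0 scale0r subr0.
rewrite big_seq; apply: summx_sub => u uU'; apply: scalemx_sub.
rewrite /direction (big_fsetD1 u)//= (big_fsetD1 u0)//=.
by rewrite -!addsmxA (submx_trans _ (addsmxSl _ _))// genmxE.
Qed.

Lemma direction_ortho_cap : (direction_ortho U :&: direction U = 0)%MS.
Proof.
apply/eqP/rowV0P => v; rewrite sub_capmx => /andP[/sub_kermxP vo /submxP[y vy]].
have : dot v v = 0.
  by rewrite dotE {2}vy trmx_mul mulmxA vo mul0mx mxE.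
rewrite /dot => /eqP; rewrite psumr_eq0 => [/allP h|i _]; last first.
  by rewrite -expr2 sqr_ge0.
apply/rowP => i; have := h i (mem_index_enum _).
by rewrite mulf_eq0 orbb mxE => /eqP.
Qed.

Hypothesis UI : affinely_independent U.
Variable u1 : 'rV[R]_d.
Hypothesis u1U : u1 \in U.

Lemma rank_direction : (\rank (direction U)).+1 = #|` U|.
Proof.
rewrite -((affinely_independentP U).1 UI) -(rank_col_homog u1).
apply/eqP; rewrite eqn_leq !mxrankS//.
  apply: hmx_sub => u uU.
  have -> : homog u = homog u1 + row_mx (u - u1) 0.
    by rewrite add_row_mx addr0 addrC subrK.
  rewrite -addsmxE addmx_sub_adds//.
  have /submxP[y ->] : (u - u1 <= direction U)%MS.
    apply/direction_sub; exists (fun w => (w == u)%:R - (w == u1)%:R).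
    by rewrite massB combB !mass_point// !comb_point// subrr.
  by apply/submxP; exists y; rewrite mul_mx_row mulmx0.
rewrite col_mx_sub hom_subw//=; apply/row_subP => i; rewrite row_row_mx row0.
have /direction_sub[c [c0 ->]] := row_sub i (direction U).
have -> : (0 : 'rV[R]_1) = 0%:M by rewrite raddf0.
by apply/hmx_subP; exists c.
Qed.

Lemma card_spine_le : (#|` U| <= d.+1)%N.
Proof. by rewrite -rank_direction ltnS rank_leq_row. Qed.

Lemma rank_direction_ortho : \rank (direction_ortho U) = codim U.
Proof. by rewrite mxrank_ker mxrank_tr /codim -rank_direction subSS. Qed.

Lemma direction_full x : (x <= direction_ortho U + direction U)%MS.
Proof.
apply: submx_full; rewrite /row_full mxrank_disjoint_sum ?direction_ortho_cap//.
rewrite rank_direction_ortho /codim -rank_direction subSS subnK//.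
exact: rank_leq_row.
Qed.

Let Pi := proj_mx (direction_ortho U) (direction U).

Lemma proj_ker x : x *m Pi = 0 <-> (x <= direction U)%MS.
Proof.
split=> [x0|xD]; last by apply: proj_mx_0 => //; exact: direction_ortho_cap.
rewrite -(add_proj_mx direction_ortho_cap (direction_full x)) x0 add0r.
exact: proj_mx_sub.
Qed.

Lemma proj_onto_ortho x : (x <= direction_ortho U)%MS -> x *m Pi = x.
Proof. by apply: proj_mx_id; exact: direction_ortho_cap. Qed.

Lemma proj_sub_ortho x : (x *m Pi <= direction_ortho U)%MS.
Proof. exact: proj_mx_sub. Qed.

Lemma PhiE x : Phi U u1 x = x *m Pi - u1 *m Pi.
Proof. by rewrite /Phi mulmxBl. Qed.

Lemma Phi_eq x y : Phi U u1 x = Phi U u1 y <->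
  exists c, mass U c = 0 /\ x = y + comb U c.
Proof.
split=> [|[c [c0 ->]]].
  rewrite !PhiE => /addIr E.
  have /proj_ker/direction_sub[c [c0 cE]] : (x - y) *m Pi = 0.
    by rewrite mulmxBl E subrr.
  by exists c; rewrite -cE addrC subrK.
rewrite !PhiE mulmxDl; have /proj_ker -> : (comb U c <= direction U)%MS.
  by apply/direction_sub; exists c.
by rewrite addr0.
Qed.

Lemma Phi_base : Phi U u1 u1 = 0.
Proof. by rewrite PhiE subrr. Qed.

Lemma Phi_U u : u \in U -> Phi U u1 u = 0.
Proof.
move=> uU; rewrite -Phi_base; apply/Phi_eq.
exists (fun w => (w == u)%:R - (w == u1)%:R).
by rewrite massB combB !mass_point// !comb_point// subrr addrC subrK.
Qed.

Lemma Phi_comb (s : {fset 'rV[R]_d}) c : mass s c = 1 ->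
  Phi U u1 (comb s c) = \sum_(v <- s) c v *: Phi U u1 v.
Proof.
move=> c1; rewrite PhiE /comb mulmx_suml.
under [RHS]eq_bigr do rewrite PhiE scalerBr scalemxAl.
by rewrite sumrB -scaler_suml -/(mass s c) c1 scale1r.
Qed.

Lemma rank_Phi V : full_dimensional V ->
  \rank (hmx [fset Phi U u1 v | v in V]%fset) = (codim U).+1.
Proof.
move=> VF; rewrite -rank_direction_ortho -(rank_col_homog 0).
apply/eqP; rewrite eqn_leq !mxrankS//.
  rewrite col_mx_sub; have hP x : (homog (Phi U u1 x) <= hmx [fset Phi U u1 v | v in V]%fset)%MS.
    have : affine_hull [set` V] x by rewrite VF.
    move=> [m [p [w [pV w1 ->]]]]; apply/hom_sub.
    exists m, (Phi U u1 \o p), w; split => //.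
      by move=> i /=; rewrite in_imfset//; exact: pV.
    rewrite PhiE mulmx_suml.
    under [RHS]eq_bigr do rewrite /= PhiE scalerBr scalemxAl.
    by rewrite sumrB -scaler_suml w1 scale1r.
  apply/andP; split; first by rewrite -Phi_base.
  apply/row_subP => i; rewrite row_row_mx row0.
  (* Moving from [u1] by an orthogonal vector projects to that vector, so the projection of
     full-dimensional [V] spans the complement. *)
  have E : row i (direction_ortho U) = Phi U u1 (u1 + row i (direction_ortho U)).
    by rewrite /Phi addrAC subrr add0r proj_onto_ortho// row_sub.
  have -> : row_mx (row i (direction_ortho U)) 0 =
      homog (Phi U u1 (u1 + row i (direction_ortho U))) - homog (Phi U u1 u1).
    by rewrite opp_row_mx add_row_mx subrr Phi_base subr0 -E.
  by rewrite addmx_sub ?eqmx_opp ?hP.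
apply: hmx_sub => _ /imfsetP[v _ ->].
have /submxP[y yE] : (Phi U u1 v <= direction_ortho U)%MS by exact: proj_mx_sub.
rewrite -addsmxE; have -> : homog (Phi U u1 v) = homog 0 + row_mx (Phi U u1 v) 0.
  by rewrite add_row_mx add0r addr0.
rewrite addmx_sub_adds// yE; apply/submxP; exists y.
by rewrite mul_mx_row mulmx0.
Qed.

End ProjectionFacts.

(** * Conic combinations of least mass *)

(** Finitely many positive thresholds have a positive minimum; together with [small_ge0] this serves
    all perturbation arguments below. *)
Lemma small_all {R : realType} {T : eqType} (r : seq T) (P : T -> R -> Prop) :
  (forall v, v \in r -> exists2 d0, 0 < d0 & forall e, 0 < e -> e <= d0 -> P v e) ->
  exists2 d0, 0 < d0 & forall e, 0 < e -> e <= d0 -> forall v, v \in r -> P v e.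
Proof.
elim: r => [|v r IH] h; first by exists 1 => // e _ _ w; rewrite in_nil.
have [|d0 d0p h0] := IH; first by move=> w wr; apply: h; rewrite in_cons wr orbT.
have [d1 d1p h1] := h v (mem_head _ _).
exists (Num.min d0 d1); first by rewrite lt_min d0p d1p.
move=> e e0; rewrite le_min => /andP[ed0 ed1] w; rewrite in_cons => /predU1P[->|].
  exact: h1.
exact: h0.
Qed.

Lemma small_ge0 {R : realType} (x y : R) : 0 <= x -> (x = 0 -> 0 <= y) ->
  exists2 d0, 0 < d0 & forall e, 0 < e -> e <= d0 -> 0 <= x + e * y.
Proof.
move=> x0 xy; have [y0|y0] := leP 0 y.
  by exists 1 => // e e0 _; rewrite addr_ge0// mulr_ge0// ltW.
have xp : 0 < x.
  by rewrite lt_def x0 andbT; apply/eqP => /xy; rewrite leNgt y0.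
exists (x / - y) => [|e e0]; first by rewrite divr_gt0// oppr_gt0.
by rewrite ler_pdivlMr ?oppr_gt0// mulrN -subr_ge0 opprK.
Qed.

Section GenericWeights.
Context {R : realType} {d : nat}.
Implicit Types (W : {fset 'rV[R]_d}).

(* The weights are powers of one number that avoids the roots of finitely many
   nonzero polynomials. *)
Lemma generic_weights (I : eqType) (r : seq I) W (C : I -> 'rV[R]_d -> R) :
  (forall i, i \in r -> exists2 v, v \in W & C i v != 0) ->
  exists2 g : 'rV[R]_d -> R, (forall v, 0 < g v) &
    forall i, i \in r -> \sum_(v <- W) C i v * g v != 0.
Proof.
move=> hC; pose p i : {poly R} := \poly_(k < #|` W|) C i W`_k.
have p0 i : i \in r -> p i != 0.
  move=> /hC[v vW]; apply: contra_neq => p0.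
  have := congr1 (fun q : {poly R} => q`_(index v W)) p0.
  by rewrite coef_poly index_mem vW coef0 nth_index.
have pr0 : \prod_(i <- r) p i != 0 by rewrite prodf_seq_neq0; apply/allP.
set q := \prod_(i <- r) p i in pr0.
have [t t0 qt] : exists2 t : R, 0 < t & ~~ root q t.
  (* These are [size q] distinct positive numbers, more than the nonzero polynomial [q] can have as
     roots. *)
  pose rs : seq R := [seq k.+1%:R | k <- iota 0 (size q)].
  have /allPn[t /mapP[k _ ->] nr] : ~~ all (root q) rs.
    apply/negP => ar; have urs : uniq rs.
      by rewrite map_inj_uniq ?iota_uniq// => k l /eqP; rewrite eqr_nat => /eqP [].
    by have := max_poly_roots pr0 ar urs; rewrite size_map size_iota ltnn.
  by exists k.+1%:R.
exists (fun v => t ^+ index v W) => [v|i ir]; first exact: exprn_gt0.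
rewrite (big_nth 0) big_mkord.
have -> : \sum_(k < #|` W|) C i W`_k * t ^+ index W`_k W = (p i).[t].
  rewrite horner_poly; apply: eq_bigr => k _.
  by rewrite index_uniq// fset_uniq.
move: qt; rewrite /q /root horner_prod prodf_seq_neq0 => /allP/(_ i ir).
exact.
Qed.

End GenericWeights.

(* Nonnegative combinations of the points f v, v in W, that are optimal for the
   lexicographic objective (total mass, g-weighted mass), where g is generic. *)
Section LexicographicOptimum.
Context {R : realType} {d : nat}.
Variables (W : {fset 'rV[R]_d}) (f : 'rV[R]_d -> 'rV[R]_d).
Implicit Types (l m c : 'rV[R]_d -> R) (s : {fset 'rV[R]_d}).

Definition vcomb l := \sum_(v <- W) l v *: f v.

Definition nneg l := forall v, 0 <= l v.

Lemma vcombD l m : vcomb (fun v => l v + m v) = vcomb l + vcomb m.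
Proof. by rewrite -big_split; apply: eq_bigr => v _; rewrite scalerDl. Qed.

Lemma vcombB l m : vcomb (fun v => l v - m v) = vcomb l - vcomb m.
Proof. by rewrite -sumrB; apply: eq_bigr => v _; rewrite scalerBl. Qed.

Lemma vcombZ k l : vcomb (fun v => k * l v) = k *: vcomb l.
Proof. by rewrite scaler_sumr; apply: eq_bigr => v _; rewrite scalerA. Qed.

Lemma eq_vcomb l m : {in W, l =1 m} -> vcomb l = vcomb m.
Proof.
move=> h; rewrite /vcomb big_seq [RHS]big_seq.
by apply: eq_bigr => v /h ->.
Qed.

Definition mass_opt l := nneg l /\
  forall m, nneg m -> vcomb m = vcomb l -> mass W l <= mass W m.

Variable g : 'rV[R]_d -> R.

Definition gmass l := \sum_(v <- W) l v * g v.

Lemma gmassD l m : gmass (fun v => l v + m v) = gmass l + gmass m.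
Proof. by rewrite -big_split; apply: eq_bigr => v _; rewrite mulrDl. Qed.

Lemma gmassB l m : gmass (fun v => l v - m v) = gmass l - gmass m.
Proof. by rewrite -sumrB; apply: eq_bigr => v _; rewrite mulrBl. Qed.

Lemma gmassZ k l : gmass (fun v => k * l v) = k * gmass l.
Proof. by rewrite mulr_sumr; apply: eq_bigr => v _; rewrite mulrA. Qed.

Lemma eq_gmass l m : {in W, l =1 m} -> gmass l = gmass m.
Proof.
move=> h; rewrite /gmass big_seq [RHS]big_seq.
by apply: eq_bigr => v /h ->.
Qed.

Lemma gmass_restrict l : gmass (fun v => if v \in W then l v else 0) = gmass l.
Proof. by apply: eq_gmass => v ->. Qed.

Definition negobj (x y : R) := x < 0 \/ (x = 0 /\ y < 0).

Definition better m l := negobj (mass W m - mass W l) (gmass m - gmass l).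

Definition opt l := nneg l /\ forall m, nneg m -> vcomb m = vcomb l -> ~ better m l.

Lemma opt_mass_opt l : opt l -> mass_opt l.
Proof.
move=> [l0 lo]; split => // m m0 ml; rewrite leNgt; apply/negP => lt.
by apply: (lo m) => //; left; rewrite subr_lt0.
Qed.

Definition dependency s c := [/\ forall v, v \notin s -> c v = 0, vcomb c = 0
  & exists2 v, v \in W & c v != 0].

Hypothesis generic : forall s c, dependency s c ->
  exists e, dependency s e /\ gmass e != 0.

Definition supp l := [fset v in W | l v != 0]%fset.

Lemma mem_supp l v : (v \in supp l) = (v \in W) && (l v != 0).
Proof. by rewrite /supp !inE. Qed.

Lemma supp_sub l : (supp l `<=` W)%fset.
Proof. by apply/fsubsetP => v; rewrite !inE => /andP[]. Qed.

Lemma negobjZ k x y : 0 < k -> negobj x y -> negobj (k * x) (k * y).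
Proof. by move=> k0 [x0|[-> y0]]; [left|right]; rewrite ?mulr0 pmulr_rlt0. Qed.

(** If the mass of the relation is zero, its generic weight is not; hence one of its two signs
    improves the lexicographic objective. *)
Lemma dependency_neg s c : dependency s c -> exists e,
  dependency s e /\ negobj (mass W e) (gmass e).
Proof.
move=> /generic[e [[e0 ef [w wW ew]] eg]].
have [h|h] : negobj (mass W e) (gmass e) \/ negobj (- mass W e) (- gmass e).
  have [lt|gt|eq] := ltgtP (mass W e) 0.
  - by left; left.
  - by right; left; rewrite oppr_lt0.
  - have := eg; rewrite neq_lt eq oppr0 => /orP[lt|gt].
      by left; right.
    by right; right; rewrite oppr_lt0.
- by exists e; split => //; split => //; exists w.
exists (fun v => -1 * e v); rewrite massZ gmassZ !mulN1r; split => //; split.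
- by move=> v /e0 ->; rewrite mulr0.
- by rewrite vcombZ ef scaler0.
- by exists w; rewrite // mulN1r oppr_eq0.
Qed.

(** A short move along an improving relation preserves the combination, and it keeps the
    coefficients nonnegative because the relation lives on the support of [l]. *)
Lemma opt_independent l c : opt l -> ~ dependency (supp l) c.
Proof.
move=> [l0 lo] /dependency_neg[e [[e0 ef _] en]].
have [d0 d0p h] : exists2 d0, 0 < d0 & forall x, 0 < x -> x <= d0 ->
    forall v, v \in enum_fset W -> 0 <= l v + x * e v.
  apply: small_all => v vW; apply: small_ge0 => // lv.
  by rewrite e0// !inE lv eqxx andbF.
have ee v : v \notin W -> e v = 0.
  by move=> vW; apply: e0; apply: contra vW; exact: (fsubsetP (supp_sub l)).
apply: (lo (fun v => l v + d0 * e v)) => [v||].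
- have [vW|/ee ->] := boolP (v \in W); first exact: h.
  by rewrite mulr0 addr0.
- by rewrite vcombD vcombZ ef scaler0 addr0.
- rewrite /better massD gmassD massZ gmassZ [X in negobj X]addrC addKr.
  by rewrite [X in negobj _ X]addrC addKr; exact: negobjZ.
Qed.

(** The midpoint is again optimal and its support contains both supports, so the difference of the
    two optima would be a relation on it. *)
Lemma opt_unique l m : opt l -> opt m -> vcomb l = vcomb m -> {in W, l =1 m}.
Proof.
move=> lo mo lm; have [l0 lo'] := lo; have [m0 mo'] := mo.
have Nlm := mo' l l0 lm; have Nml := lo' m m0 (esym lm).
have mE : mass W l = mass W m.
  have [lt|gt|//] := ltgtP (mass W l) (mass W m).
    by case: Nlm; left; rewrite subr_lt0.
  by case: Nml; left; rewrite subr_lt0.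
have gE : gmass l = gmass m.
  have [lt|gt|//] := ltgtP (gmass l) (gmass m).
    by case: Nlm; right; rewrite mE subrr subr_lt0.
  by case: Nml; right; rewrite mE subrr subr_lt0.
pose n v := 2^-1 * (l v + m v).
have half (T : lmodType R) (x : T) : 2^-1 *: (x + x) = x.
  by rewrite -mulr2n -(scaler_nat 2 x) scalerA mulVf ?scale1r // pnatr_eq0.
have nm : mass W n = mass W l by rewrite massZ massD -mE; exact: half.
have ng : gmass n = gmass l by rewrite gmassZ gmassD -gE; exact: half.
have nc : vcomb n = vcomb l by rewrite vcombZ vcombD -lm half.
have no : opt n.
  split=> [v|k k0 kn]; first by rewrite mulr_ge0// addr_ge0.
  by rewrite /better nm ng; apply: lo'; rewrite // kn.
move=> v vW; apply/eqP/negPn/negP => nlm.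
apply: (@opt_independent n (fun v => if v \in W then l v - m v else 0)) => //.
split=> [w|| ]; last by exists v; rewrite ?vW ?subr_eq0.
  rewrite !inE; case: ifP => //= wW /negPn; rewrite mulf_eq0 invr_eq0.
  rewrite pnatr_eq0/= paddr_eq0// => /andP[/eqP -> /eqP ->].
  by rewrite subrr.
rewrite (@eq_vcomb _ (fun v => l v - m v)) => [|w ->//].
by rewrite vcombB lm subrr.
Qed.

(** An improvement [n] of [m] would improve [l] as well, by adding a small multiple of [n - m]. Thus
    optimality depends only on the support and passes to smaller supports. *)
Lemma opt_sub l m : opt l -> nneg m ->
  (forall v, v \in W -> m v != 0 -> l v != 0) -> opt m.
Proof.
move=> [l0 lo] m0 ml; split => // n n0 nm nb.
have [d0 d0p h] : exists2 d0, 0 < d0 & forall x, 0 < x -> x <= d0 ->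
    forall v, v \in enum_fset W -> 0 <= l v + x * (n v - m v).
  apply: small_all => v vW; apply: small_ge0 => // lv.
  have [->|mv] := eqVneq (m v) 0; first by rewrite subr0.
  by have := ml v vW mv; rewrite lv eqxx.
apply: (lo (fun v => if v \in W then l v + d0 * (n v - m v) else 0)) => [v||].
- by case: ifP => // vW; exact: h.
- rewrite (@eq_vcomb _ (fun v => l v + d0 * (n v - m v))) => [|v ->//].
  by rewrite vcombD vcombZ vcombB nm subrr scaler0 addr0.
- rewrite /better mass_restrict gmass_restrict massD gmassD massZ gmassZ massB gmassB.
  rewrite [X in negobj X]addrC addKr.
  by rewrite [X in negobj _ X]addrC addKr; exact: negobjZ.
Qed.

Lemma negobjD x y x' y' : negobj x y -> negobj x' y' -> negobj (x + x') (y + y').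
Proof.
move=> [x0|[-> y0]] [x0'|[-> y0']]; rewrite ?add0r ?addr0.
- by left; rewrite -[ltRHS]addr0 ltrD.
- by left.
- by left.
- by right; split; rewrite -?[ltRHS](addr0 0) ?ltrD.
Qed.

Lemma better_trans l m n : better l m -> better m n -> better l n.
Proof.
move=> lm mn; have := negobjD lm mn.
by rewrite !addrA !subrK.
Qed.

(* Moving along an improving dependency until a coefficient vanishes. *)
Lemma basic_not_worse l : nneg l -> exists m, [/\ nneg m, vcomb m = vcomb l,
  (forall n, better n m -> better n l) & forall c, ~ dependency (supp m) c].
Proof.
have [k] := ubnP #|` supp l|; elim: k l => // k IH l; rewrite ltnS => lk l0.
have [[c /dependency_neg[e [[e0 ef ew] en]]]|h] :=
    pselect (exists c, dependency (supp l) c); last first.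
  by exists l; split => // c lc; apply: h; exists c.
have ee v : v \notin W -> e v = 0.
  by move=> vW; apply: e0; apply: contra vW; exact: (fsubsetP (supp_sub l)).
(* Without a negative coefficient the mass could not decrease; it would be zero, and [e] would
   vanish on [W]. *)
have [w wW ew0] : exists2 w, w \in W & e w < 0.
  have [//|nw] := pselect (exists2 w, w \in W & e w < 0).
  have ep v : v \in W -> 0 <= e v.
    by move=> vW; rewrite leNgt; apply/negP => ev; apply: nw; exists v.
  have := mass_ge0 ep; have [|[m0 gm]] := en; first by rewrite ltNge => /negbTE ->.
  have ez v : v \in W -> e v = 0.
    move=> vW; move/eqP: m0; rewrite /mass big_seq psumr_eq0// => /allP/(_ v vW).
    by rewrite vW => /eqP.
  by have [v vW] := ew; rewrite ez// eqxx.
pose q v := l v / - e v.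
pose N := [fset v in W | e v < 0]%fset.
have wN : w \in N by rewrite !inE wW.
have [y yN ymin] := @seq_argmin _ _ q (enum_fset N) w wN.
have /andP[yW ey] : (y \in W) && (e y < 0) by have : y \in N := yN; rewrite !inE.
have q0 : 0 <= q y by rewrite divr_ge0// oppr_ge0 ltW.
pose m v := l v + q y * e v.
have m0 : nneg m.
  move=> v; have [ev|ev] := ltP (e v) 0; last by rewrite addr_ge0// mulr_ge0.
  have vW : v \in W.
    by apply: contraLR ev => /ee ->; rewrite ltxx.
  rewrite /m -[e v]opprK mulrN subr_ge0 -ler_pdivlMr ?oppr_gt0//.
  apply: ymin; have -> : (v \in enum_fset N) = (v \in N) by [].
  by rewrite !inE vW.
have my : m y = 0.
  by rewrite /m /q invrN mulrN mulNr divfK ?subrr// lt_eqF.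
have qp : 0 < q y.
  rewrite divr_gt0 ?oppr_gt0// lt_def l0 andbT; apply/eqP => ly.
  by move: ey; rewrite e0 ?ltxx// !inE ly eqxx andbF.
have sm : (supp m `<` supp l)%fset.
  rewrite fproperEneq; apply/andP; split; last first.
    apply/fsubsetP => v; rewrite !inE => /andP[-> mv] /=.
    apply: contra mv => /eqP lv; rewrite /m lv e0 ?mulr0 ?addr0//.
    by rewrite !inE lv eqxx andbF.
  apply/negP => /eqP/fsetP/(_ y); rewrite !inE yW my eqxx/= => /esym/negbFE/eqP ly.
  by move: qp; rewrite /q ly mul0r ltxx.
have [n [n0 nm nb nd]] := IH m (leq_trans (fproper_ltn_card sm) lk) m0.
exists n; split => //.
  by rewrite nm vcombD vcombZ ef scaler0 addr0.
have ml : better m l.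
  rewrite /better massD gmassD massZ gmassZ [X in negobj X]addrC addKr.
  by rewrite [X in negobj _ X]addrC addKr; exact: negobjZ.
by move=> k' /nb /better_trans; apply.
Qed.

Lemma basic_unique l m : (forall c, ~ dependency (supp l) c) ->
  supp l = supp m -> vcomb l = vcomb m -> {in W, l =1 m}.
Proof.
move=> ld slm lm v vW; apply/eqP/negPn/negP => nlm.
apply: (ld (fun v => if v \in W then l v - m v else 0)); split=> [w||].
- case: ifPn => // wW ws; have := ws; rewrite slm; move: ws.
  by rewrite !inE wW/= => /negPn/eqP -> /negPn/eqP ->; rewrite subrr.
- rewrite (@eq_vcomb _ (fun v => l v - m v)) => [|w ->//].
  by rewrite vcombB lm subrr.
- by exists v; rewrite ?vW ?subr_eq0.
Qed.

(** No compactness is used: a basic solution is determined by its support, so there are finitely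
    many of them, and each feasible point is matched by a basic one that is at least as good. The
    optimum is picked by minimizing the mass and then the weight over this finite list. *)
Lemma opt_exists l : nneg l -> exists2 m, opt m & vcomb m = vcomb l.
Proof.
move=> l0; pose basic m := [/\ nneg m, vcomb m = vcomb l &
  forall c, ~ dependency (supp m) c].
have /choice[B BP] : forall s, exists m, (exists2 m, basic m & supp m = s) ->
    basic m /\ supp m = s.
  move=> s; have [[m bm ms]|n] := pselect (exists2 m, basic m & supp m = s).
    by exists m.
  by exists (fun=> 0).
pose r := [seq s <- enum_fset (fpowerset W) | `[<basic (B s)>]].
have rP m : basic m -> exists2 s, s \in r & {in W, B s =1 m}.
  move=> bm; have [bB sB] : basic (B (supp m)) /\ supp (B (supp m)) = supp m.
    by apply: BP; exists m.
  exists (supp m).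
    rewrite mem_filter; apply/andP; split; first exact/asboolP.
    by have : supp m \in fpowerset W by rewrite fpowersetE supp_sub.
  have [h1 h2 h3] := bB; have [_ h4 _] := bm.
  by apply: basic_unique; rewrite // h2 h4.
have [b0 [b00 bl _ bd]] := basic_not_worse l0.
have [s0 s0r _] : exists2 s, s \in r & {in W, B s =1 b0} by exact: rP.
have [s1 s1r s1m] := @seq_argmin _ _ (fun s => mass W (B s)) r s0 s0r.
pose r' := [seq s <- r | mass W (B s) == mass W (B s1)].
have s1r' : s1 \in r' by rewrite mem_filter eqxx s1r.
have [s2 s2r s2m] := @seq_argmin _ _ (fun s => gmass (B s)) r' s1 s1r'.
move: s2r; rewrite mem_filter => /andP[/eqP s2E]; rewrite mem_filter.
move=> /andP[/asboolP[b2 bl2 _] _].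
exists (B s2) => //; split => // n n0 nl nb.
have [n' [n'0 n'n nb' n'd]] := basic_not_worse n0.
have [s3 s3r s3E] : exists2 s, s \in r & {in W, B s =1 n'}.
  by apply: rP; split => //; rewrite n'n nl.
have mE : mass W (B s3) = mass W n' by exact: eq_mass.
have gE : gmass (B s3) = gmass n' by exact: eq_gmass.
have h3 := s1m s3 s3r.
(* Since [n] beats [B s2], if [B s2] beat [n'] then it would also beat [n]. *)
have nn' : ~ better (B s2) n'.
  move=> /nb' /better_trans/(_ nb); rewrite /better !subrr.
  by case=> [|[_]]; rewrite ltxx.
have n'2 : ~ better n' (B s2).
  case=> [|[/eqP]]; first by rewrite -mE subr_lt0 s2E ltNge h3.
  rewrite subr_eq0 subr_lt0 -mE -gE s2E => E; rewrite ltNge => /negP; apply.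
  by apply: s2m; rewrite mem_filter E.
have E1 : mass W n' = mass W (B s2).
  have [lt|gt|//] := ltgtP (mass W n') (mass W (B s2)).
    by case: n'2; left; rewrite subr_lt0.
  by case: nn'; left; rewrite subr_lt0.
have E2 : gmass n' = gmass (B s2).
  have [lt|gt|//] := ltgtP (gmass n') (gmass (B s2)).
    by case: n'2; right; rewrite E1 subrr subr_lt0.
  by case: nn'; right; rewrite E1 subrr subr_lt0.
suff : better n n by rewrite /better !subrr; case=> [|[_]]; rewrite ltxx.
have : better n n' by rewrite /better E1 E2.
exact: nb'.
Qed.

End LexicographicOptimum.

(** It suffices to choose one relation for each subset of [W] that carries any; this leaves finitely
    many conditions on the weights. *)
Lemma generic_exists {R : realType} {d : nat} (W : {fset 'rV[R]_d})
    (f : 'rV[R]_d -> 'rV[R]_d) :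
  exists g, forall s c, dependency W f s c ->
    exists e, dependency W f s e /\ gmass W g e != 0.
Proof.
have /choice[C CP] : forall s, exists c, (exists c, dependency W f s c) ->
    dependency W f s c.
  move=> s; have [[c cs]|n] := pselect (exists c, dependency W f s c).
    by exists c.
  by exists (fun=> 0).
pose r := [seq s <- enum_fset (fpowerset W) | `[<dependency W f s (C s)>]].
have [|g _ gP] := @generic_weights R d _ r W C.
  by move=> s; rewrite mem_filter => /andP[/asboolP[_ _ h]].
exists g => s c [c0 cf cW]; pose s' := (s `&` W)%fset.
have sd : dependency W f s' (C s').
  apply: CP; exists (fun v => if v \in W then c v else 0); split.
  - move=> v; rewrite inE negb_and; case: ifP => //= vW.
    by rewrite orbF => /c0.
  - by rewrite (@eq_vcomb _ _ _ _ _ c) => [//|v ->].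
  - by have [v vW cv] := cW; exists v; rewrite ?vW.
exists (C s'); split.
  have [h1 h2 h3] := sd; split => // v vs; apply: h1.
  by rewrite inE (negbTE vs).
apply: gP; rewrite mem_filter; apply/andP; split; first exact/asboolP.
by have : s' \in fpowerset W by rewrite fpowersetE fsubsetIr.
Qed.

(** * Separation and pure triangulations *)

Section Complexes.
Context {R : realType} {d : nat}.
Implicit Types (s t r V X : {fset 'rV[R]_d}) (T : {fset {fset 'rV[R]_d}}).
Implicit Types (x y z v a : 'rV[R]_d) (c : 'rV[R]_d -> R).

Lemma separate_hull s x : ~ convex_hull [set` s] x ->
  exists a b, valid s a b /\ b < dot a x.
Proof.
move=> nx; have [[c [c0 cE]]|[h [h0 hx]]] :=
    @farkas R (d + 1) #|` s| (fun i => homog s`_i) (homog x).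
  exfalso; apply: nx; apply/convex_hullP.
  exists (fun v => if v \in s then c (index v s) else 0).
  have E : homog x = row_mx (comb s (fun v => c (index v s)))
      (mass s (fun v => c (index v s)))%:M.
    rewrite -hmx_mul mulmx_sum_row cE; apply: eq_bigr => i _.
    by rewrite rowK mxE index_uniq// fset_uniq.
  have [E1 /matrixP/(_ 0 0)] := eq_row_mx E.
  rewrite !mxE/= mulr1n mulr1n => E2; split => //.
  - by move=> v; case: ifP.
  - by move=> v /negbTE ->.
  - by rewrite mass_restrict -E2.
  - by rewrite comb_restrict.
have hE y : dot h (homog y) = dot (lsubmx h) y + h 0 (rshift d 0).
  rewrite /dot big_split_ord/=; congr (_ + _).
    by apply: eq_bigr => i _; rewrite /homog row_mxEl mxE.
  by rewrite big_ord1 /homog row_mxEr mxE mulr1.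
exists (- lsubmx h), (h 0 (rshift d 0)); split.
  move=> v vs; rewrite dotNl -subr_ge0 opprK addrC -hE.
  by rewrite -(nth_index 0 vs); apply: h0; rewrite index_mem.
by rewrite dotNl -subr_gt0 -opprD oppr_gt0 -hE.
Qed.

(** Each flat misses some point of [X], so some affine function vanishes on the flat but not on all
    of [X]. Generic positive weights, normalized, make all these functions nonzero at the resulting
    convex combination. *)
Lemma generic_point X (L : seq {fset 'rV[R]_d}) : X != fset0 ->
  (forall t, t \in L -> exists2 v, v \in X & ~~ (homog v <= hmx t)%MS) ->
  exists2 z, convex_hull [set` X] z & forall t, t \in L ->
    exists a b, (forall w, w \in t -> dot a w = b) /\ dot a z != b.
Proof.
move=> /fset0Pn[x0 x0X] hL.
have /choice[F FP] : forall t, exists ab : 'rV[R]_d * R, t \in L ->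
    (forall w, w \in t -> dot ab.1 w = ab.2) /\
    exists2 v, v \in X & dot ab.1 v - ab.2 != 0.
  move=> t; have [tL|_] := boolP (t \in L); last by exists (0, 0).
  have [v vX /separate_flat[a [b [h1 h2]]]] := hL t tL.
  exists (a, b) => _; split=> [w wt|]; first by apply: h1; exact: hom_subw.
  by exists v => //=; rewrite subr_eq0; exact/eqP.
have [t tL|g g0 gP] :=
  @generic_weights R d _ L X (fun t v => dot (F t).1 v - (F t).2).
  by have [_] := FP t tL.
have G0 : 0 < mass X g.
  by rewrite /mass (big_fsetD1 x0)//= ltr_pwDl//; apply: sumr_ge0 => v _; exact: ltW.
pose e v := (mass X g)^-1 * g v.
have e1 : mass X e = 1 by rewrite massZ mulVf// gt_eqF.
exists (comb X e).
  apply/convex_hullP; exists (fun v => if v \in X then e v else 0); split.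
  - move=> v; case: ifP => // _; apply: mulr_ge0; last exact: ltW.
    by rewrite invr_ge0 ltW.
  - by move=> v /negbTE ->.
  - by rewrite mass_restrict.
  - by rewrite comb_restrict.
move=> t tL; exists (F t).1, (F t).2; have [h1 _] := FP t tL; split => //.
rewrite -subr_eq0 -opprB oppr_eq0 slack_comb//.
have -> : \sum_(v <- X) e v * ((F t).2 - dot (F t).1 v) =
    - (mass X g)^-1 * \sum_(v <- X) (dot (F t).1 v - (F t).2) * g v.
  rewrite mulr_sumr; apply: eq_bigr => v _.
  by rewrite /e; ring.
by rewrite mulf_neq0 ?gP// oppr_eq0 invr_eq0 gt_eqF.
Qed.

Lemma maximalP T s : reflect (s \in T /\ forall t, t \in T -> (s `<=` t)%fset -> t = s)
  (maximal_simplex T s).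
Proof.
apply: (iffP andP) => -[sT h]; split => //.
  by move=> t tT st; move/forallP/(_ [` tT]%fset): h => /=; rewrite st => /eqP.
apply/forallP => t; apply/implyP => st; apply/eqP.
by apply: h => //; exact: fsvalP.
Qed.

Lemma maximal_above T s : s \in T ->
  exists2 t, maximal_simplex T t & (s `<=` t)%fset.
Proof.
move=> sT; pose r := [seq t <- enum_fset T | (s `<=` t)%fset].
have sr : s \in r by rewrite mem_filter fsubset_refl.
have [t tr tm] := @seq_argmin R _ (fun t => - #|` t|%:R) r s sr.
move: tr; rewrite mem_filter => /andP[st tT]; exists t => //.
apply/maximalP; split => // t' t'T tt'.
have : t' \in r by rewrite mem_filter (fsubset_trans st tt').
move=> /tm; rewrite lerN2 ler_nat => le; apply/eqP.
by rewrite eq_sym eqEfcard tt' le.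
Qed.

Lemma fcoverP T x : reflect (exists2 s, s \in T & x \in s) (x \in fcover T).
Proof.
apply: (iffP (bigfcupP _ _ _ _)) => [[s]|[s sT xs]]; first by rewrite andbT; exists s.
by exists s; rewrite ?andbT.
Qed.

Lemma independent_card s X k : affinely_independent s -> (s `<=` X)%fset ->
  \rank (hmx X) = k -> (#|` s| <= k)%N.
Proof. by move=> /affinely_independentP <- /hmxS sX <-; exact: mxrankS. Qed.

Lemma triangulation_sub W T s : triangulation W T -> s \in T -> (s `<=` W)%fset.
Proof.
by move=> [_ <- _] sT; apply/fsubsetP => x xs; apply/fcoverP; exists s.
Qed.

(** Walk from the barycentre [b] of [s] towards a generic point [z]. Near [b] the segment avoids the
    simplices of lower dimension and the full simplices that do not contain [b]; since it is
    covered, some full simplex contains [b], and it meets [s] in a face that must be all of [s]. *)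
Lemma triangulation_pure W T k s : triangulation W T ->
  \rank (hmx W) = k.+1 -> s \in T ->
  exists t, [/\ t \in T, (s `<=` t)%fset & #|` t| = k.+1].
Proof.
move=> tri rW; have [[TI TC TX] TW Tcov] := tri.
wlog : s / s != fset0 => [H sT|s0 sT].
  have [s0|] := eqVneq s fset0; last by move=> h; exact: H.
  have [p pW] : exists p, p \in W.
    have [W0|/fset0Pn//] := eqVneq W fset0.
    by have := rank_leq_row (hmx W); rewrite rW W0 cardfs0.
  move: pW; rewrite -TW => /fcoverP[t tT pt].
  have [||t' [h1 h2 h3]] := H [fset p]%fset.
  - by apply/fset0Pn; exists p; rewrite inE.
  - by apply: (TC t) => //; rewrite fsub1set.
  by exists t'; rewrite s0; split => //; exact: fsub0set.
pose n := #|` s|.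
have n0 : (n%:R : R) != 0 by rewrite pnatr_eq0 /n cardfs_eq0.
pose b := comb s (fun=> n%:R^-1).
have b1 : mass s (fun=> n%:R^-1 : R) = 1.
  by rewrite /mass big_const_seq count_predT iter_addr_0 -[LHS]mulr_natr mulVf.
have bW : convex_hull [set` W] b.
  apply: (convex_hullS (triangulation_sub tri sT)); apply/convex_hullP.
  exists (fun v => if v \in s then n%:R^-1 else 0); split.
  - by move=> v; case: ifP => // _; rewrite invr_ge0.
  - by move=> v /negbTE ->.
  - by rewrite mass_restrict.
  - by rewrite comb_restrict.
pose L : seq {fset 'rV[R]_d} := [seq t <- enum_fset T | (#|` t| < k.+1)%N].
have [|t|z zW zL] := @generic_point W L.
- by apply/fset0Pn; case/fset0Pn: s0 => p ps; exists p;
    exact: (fsubsetP (triangulation_sub tri sT)).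
- rewrite mem_filter => /andP[tk tT].
  have [//|nh] := pselect (exists2 v, v \in W & ~~ (homog v <= hmx t)%MS).
  have : (hmx W <= hmx t)%MS.
    by apply: hmx_sub => v vW; apply/negPn/negP => h; apply: nh; exists v.
  move=> /mxrankS; rewrite rW => /leq_trans/(_ (rank_leq_row _)).
  by rewrite leqNgt tk.
have [t tT [tk bt]] : exists2 t, t \in T & #|` t| = k.+1 /\ convex_hull [set` t] b.
  have [//|nh] := pselect (exists2 t, t \in T & #|` t| = k.+1 /\ convex_hull [set` t] b).
  exfalso; pose x e := e *: z + (1 - e) *: b.
  have xdot a e : dot a (x e) = dot a b + e * (dot a z - dot a b).
    by rewrite dotD !dotZ mulrBl mulrBr mul1r addrCA.
  have [d0 d0p h] : exists2 d0, 0 < d0 & forall e, 0 < e -> e <= d0 ->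
      forall t, t \in enum_fset T -> ~ convex_hull [set` t] (x e).
    apply: small_all => t tT.
    have [tk|tk] := eqVneq #|` t| k.+1.
      have nb : ~ convex_hull [set` t] b by move=> bt; apply: nh; exists t.
      have [a [m [am bm]]] := separate_hull nb.
      have [||d3 d3p h3] := @small_ge0 R ((dot a b - m) / 2) (dot a z - dot a b).
      - by rewrite divr_ge0// subr_ge0 ltW.
      - by move/eqP; rewrite mulf_eq0 invr_eq0 pnatr_eq0 orbF subr_eq0 gt_eqF.
      exists d3 => // e e0 ed /(valid_hull am); rewrite xdot leNgt => /negP; apply.
      by have := h3 e e0 ed; move: bm; lra.
    have tL : t \in L.
      rewrite mem_filter (tT : t \in T) andbT ltn_neqAle tk/=.
      by apply: independent_card rW; [exact: TI|exact: triangulation_sub tri tT].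
    (* A hyperplane contains the small simplex but not [z]. If [b] lies on it, the segment leaves it
       at once; if not, the segment stays off it for small [e]. *)
    have [a [m [am az]]] := zL t tL.
    have xt e : convex_hull [set` t] (x e) -> dot a (x e) = m.
      move=> /convex_hullP[c [_ _ c1 ->]]; apply/eqP.
      rewrite eq_sym -subr_eq0 slack_comb// big_seq big1// => v /am ->.
      by rewrite subrr mulr0.
    have [ab|ab] := eqVneq (dot a b) m.
      exists 1 => // e e0 _ /xt; rewrite xdot ab => /eqP.
      rewrite -subr_eq0 addrAC subrr add0r mulf_eq0 gt_eqF//= subr_eq0.
      by rewrite (negbTE az).
    have [||d1 d1p h1] := @small_ge0 R (`|dot a b - m| / 2) (- `|dot a z - dot a b|).
    - by rewrite divr_ge0.
    - by move/eqP; rewrite mulf_eq0 invr_eq0 pnatr_eq0 orbF normr_eq0 subr_eq0 (negbTE ab).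
    exists d1 => // e e0 ed /xt; rewrite xdot => /eqP; rewrite -subr_eq0 addrAC.
    rewrite addr_eq0 => /eqP E.
    have := h1 e e0 ed; rewrite mulrN E normrN normrM gtr0_norm// subr_ge0.
    rewrite ler_pdivlMr// mulr_natr mulr2n gerDl leNgt => /negP; apply.
    by rewrite -(gtr0_norm e0) -normrM -normrN -E normr_gt0 subr_eq0.
  pose e := Num.min d0 1.
  have e0 : 0 < e by rewrite lt_min d0p/=.
  have : convex_hull [set` W] (x e).
    by apply: convex_hull_conv => //; rewrite ltW//= ge_min lexx orbT.
  rewrite -Tcov => -[t /= tT]; apply: h => //; by rewrite ge_min lexx.
exists t; split => //.
(* All barycentric coordinates of [b] in [s] are positive, so a face of [s] that contains [b] has
   all the vertices of [s]. *)
have [r [rs rt rE]] := TX s t sT tT.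
have : convex_hull [set` r] b.
  rewrite -rE; split => //; apply/convex_hullP.
  exists (fun v => if v \in s then n%:R^-1 else 0); split.
  - by move=> v; case: ifP => // _; rewrite invr_ge0.
  - by move=> v /negbTE ->.
  - by rewrite mass_restrict.
  - by rewrite comb_restrict.
move=> /(convex_hull_subP _ rs)[c [_ cr c1 bE]].
have h := affinely_independent_coef (TI s sT) (etrans b1 (esym c1)) bE.
apply: fsubset_trans rt; apply/fsubsetP => v vs; apply/negPn/negP => /cr.
by rewrite -h// => /eqP; rewrite invr_eq0 (negbTE n0).
Qed.

End Complexes.

(** * Star triangulations and their lifts *)

Lemma Phi_sum {R : realType} {d : nat} (U : {fset 'rV[R]_d}) u1 m (p : 'I_m -> 'rV[R]_d) w :
  \sum_i w i = 1 -> Phi U u1 (\sum_i w i *: p i) = \sum_i w i *: Phi U u1 (p i).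
Proof.
move=> w1; rewrite /Phi mulmxBl mulmx_suml.
under [RHS]eq_bigr do rewrite mulmxBl scalerBr scalemxAl.
by rewrite sumrB -scaler_suml w1 scale1r.
Qed.

Lemma convex_hull_Phi {R : realType} {d : nat} (U s : {fset 'rV[R]_d}) u1 :
  convex_hull [set` [fset Phi U u1 v | v in s]%fset] =
  Phi U u1 @` convex_hull [set` s].
Proof.
apply/seteqP; split => [y [m [p [w [ps w0 w1 ->]]]]|_ [_ [m [p [w [ps w0 w1 ->]]]] <-]].
  have /choice[q qP] : forall i, exists v, v \in s /\ p i = Phi U u1 v.
    by move=> i; have /imfsetP[v vs ->] := ps i; exists v.
  exists (\sum_i w i *: q i); last first.
    by rewrite Phi_sum//; apply: eq_bigr => i _; have [_ ->] := qP i.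
  by exists m, q, w; split => // i; have [] := qP i.
exists m, (Phi U u1 \o p), w; split => //; last exact: Phi_sum.
by move=> i /=; rewrite in_imfset//; exact: ps.
Qed.

Section Spine.
Context {R : realType} {d : nat}.
Variables (V U : {fset 'rV[R]_d}) (u1 : 'rV[R]_d).
Hypotheses (d0 : (0 < d)%N) (VF : full_dimensional V).
Hypothesis UV : (U `<=` V)%fset.
Hypothesis UI : affinely_independent U.
Hypothesis u1U : u1 \in U.
Implicit Types (s t r : {fset 'rV[R]_d}) (T : {fset {fset 'rV[R]_d}}).
Implicit Types (x y z v w u p q : 'rV[R]_d) (a c l m : 'rV[R]_d -> R).

Local Notation W := (V `\` U)%fset.
Local Notation hat := (Phi U u1).
Local Notation hatV := [fset Phi U u1 v | v in V]%fset.
Local Notation vc := (vcomb W hat).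
Local Notation e := (codim U).

Lemma sumV (M : nmodType) (F : 'rV[R]_d -> M) :
  \sum_(v <- V) F v = \sum_(v <- W) F v + \sum_(v <- U) F v.
Proof.
pose F1 v := if v \in U then 0 else F v.
pose F2 v := if v \in U then F v else 0.
have -> : \sum_(v <- V) F v = \sum_(v <- V) F1 v + \sum_(v <- V) F2 v.
  rewrite -big_split; apply: eq_bigr => v _.
  by rewrite /F1 /F2 /=; case: ifP; rewrite ?add0r ?addr0.
have F1E : {in W, F =1 F1} by move=> v; rewrite inE /F1 => /andP[/negbTE ->].
have F2E : {in U, F =1 F2} by move=> v; rewrite /F2 => ->.
have E1 : \sum_(v <- V) F1 v = \sum_(v <- W) F1 v.
  apply/esym; apply: big_fset_incl.
    by apply/fsubsetP => v; rewrite inE => /andP[].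
  by move=> v vV; rewrite inE vV andbT negbK /F1 => ->.
have E2 : \sum_(v <- V) F2 v = \sum_(v <- U) F2 v.
  apply/esym; apply: big_fset_incl => // v vV.
  by rewrite /F2 => /negbTE ->.
rewrite E1 E2; congr (_ + _); rewrite big_seq [RHS]big_seq; apply: eq_bigr => v.
  by move=> /F1E ->.
by move=> /F2E ->.
Qed.

Lemma massV c : mass V c = mass W c + mass U c.
Proof. exact: sumV. Qed.

Lemma combV c : comb V c = comb W c + comb U c.
Proof. exact: sumV. Qed.

Lemma inW v : (v \in W) = (v \notin U) && (v \in V).
Proof. by rewrite inE. Qed.

Lemma WV v : v \in W -> v \in V.
Proof. by rewrite inW => /andP[]. Qed.

Lemma WU v : v \in W -> v \notin U.
Proof. by rewrite inW => /andP[]. Qed.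

Lemma UVW v : v \in V -> v \in U \/ v \in W.
Proof. by move=> vV; rewrite inW vV andbT; case: (boolP (v \in U)); [left|right]. Qed.

Lemma hatU u : u \in U -> hat u = 0.
Proof. exact: Phi_U. Qed.

Lemma hat_comb c : mass V c = 1 -> hat (comb V c) = vc c.
Proof.
move=> c1; rewrite Phi_comb// sumV.
have -> : \sum_(v <- U) c v *: hat v = 0; last by rewrite addr0.
by rewrite big_seq big1// => u uU; rewrite hatU// scaler0.
Qed.

Lemma vc_proj l : vc l = (comb W l - mass W l *: u1) *m
  proj_mx (direction_ortho U) (direction U).
Proof.
rewrite mulmxBl /comb mulmx_suml -scalemxAl scaler_suml -sumrB.
by apply: eq_bigr => v _; rewrite /Phi mulmxBl scalerBr -scalemxAl.
Qed.

Lemma vc0_rep l : vc l = 0 ->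
  exists a, mass W l + mass U a = 0 /\ comb W l + comb U a = 0.
Proof.
rewrite vc_proj => /(proj_ker UI u1U)/direction_sub[c [c0 cE]].
exists (fun v => - mass W l * (v == u1)%:R - c v).
rewrite massB combB massZ combZ mass_point// comb_point// c0 mulr1.
split; first by rewrite subr0 subrr.
by rewrite -cE; apply/rowP => i; rewrite !mxE; ring.
Qed.

(** The fibres of the projection are translates of the direction of [U], so coefficients on [U]
    complete any [W]-part to a representation of mass 1; nothing is known yet about their signs. *)
Lemma hat_rep l x : hat x = vc l ->
  exists a, mass W l + mass U a = 1 /\ x = comb W l + comb U a.
Proof.
rewrite vc_proj PhiE => E.
have : (x - u1 - (comb W l - mass W l *: u1)) *m
    proj_mx (direction_ortho U) (direction U) = 0.
  by rewrite mulmxBl -E mulmxBl subrr.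
move=> /(proj_ker UI u1U)/direction_sub[c [c0 cE]].
exists (fun v => (1 - mass W l) * (v == u1)%:R + c v).
rewrite massD combD massZ combZ mass_point// comb_point// c0 mulr1.
split; first by rewrite addr0 addrC subrK.
rewrite -cE scalerBl scale1r.
apply/rowP => i; rewrite !mxE; ring.
Qed.

Lemma vc_comb c c' a a' : mass W c + mass U a = mass W c' + mass U a' ->
  comb W c + comb U a = comb W c' + comb U a' -> vc c = vc c'.
Proof.
move=> mE cE; apply/eqP; rewrite -subr_eq0 -vcombB vc_proj; apply/eqP.
apply/(proj_ker UI u1U)/direction_sub.
exists (fun v => a' v - a v - (mass W c - mass W c') * (v == u1)%:R).
rewrite !massB !combB massZ combZ mass_point// comb_point// mulr1; split.
  by move: mE; lra.
congr (_ - _); move/rowP: cE => cE; apply/rowP => i; have := cE i.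
by rewrite !mxE; lra.
Qed.

(** * Position of the projected vertices around the origin *)

Section RadialPosition.
Hypothesis VC : convex_position V.
Hypothesis SU : spine V U.

(** Otherwise [q] is an affine combination with nonnegative [W]-part. A facet through [q] that
    misses [u] contains the rest of [U]; its slack at [q] being 0, the coefficient of [u] is at most
    0. But the coefficients on [U] sum to [1 - mass W l >= 0], so all vanish, and [q] is a convex
    combination of other vertices. *)
Lemma hat_extreme q l : q \in W -> nneg l -> l q = 0 -> mass W l <= 1 ->
  hat q <> vc l.
Proof.
move=> qW l0 lq l1 /hat_rep[a [m1 qE]].
have qV := WV qW.
have a0 u : u \in U -> 0 <= - a u.
  move=> uU; have uV := fsubsetP UV _ uU.
  have [||b [k [h1 h2 h3 h4]]] := vertex_facet d0 VF VC qV (x := u).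
  - exact: convex_hull_point.
  - by move=> uq; move: (WU qW); rewrite -uq uU.
  pose c v := if v \in U then a v else l v.
  have cW : mass W c = mass W l.
    by apply: eq_mass => v /WU/negbTE; rewrite /c => ->.
  have cU : mass U c = mass U a by apply: eq_mass => v; rewrite /c => ->.
  have qc : q = comb V c.
    rewrite combV {1}qE; congr (_ + _); apply: eq_comb => v; rewrite /c.
      by move=> /WU/negbTE ->.
    by move=> ->.
  have : k - dot b q = 0 by rewrite h2 subrr.
  rewrite {1}qc slack_comb ?massV ?cW ?cU// sumV.
  have -> : \sum_(v <- U) c v * (k - dot b v) = a u * (k - dot b u).
    rewrite (big_fsetD1 u)//= /c uU big_seq big1 ?addr0// => v.
    rewrite !inE => /andP[vu vU]; rewrite (spine_facet SU h4 uU h3 vU vu).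
    by rewrite subrr mulr0.
  move=> /eqP; rewrite addrC addr_eq0 => /eqP E.
  rewrite -(pmulr_lge0 _ (_ : 0 < k - dot b u)) ?subr_gt0// mulNr E opprK.
  rewrite big_seq; apply: sumr_ge0 => v vW; rewrite /c (negbTE (WU vW)).
  by rewrite mulr_ge0// subr_ge0 h1// WV.
have sa : mass U (fun u => - a u) = 0.
  apply/eqP; rewrite eq_le mass_ge0// andbT /mass sumrN oppr_le0 -/(mass U a).
  by move: m1 l1; lra.
have az u : u \in U -> a u = 0.
  move=> uU; move/eqP: sa; rewrite /mass big_seq psumr_eq0// => /allP/(_ u uU).
  by rewrite uU/= oppr_eq0 => /eqP.
have mU : mass U a = 0 by rewrite /mass big_seq big1.
have cU : comb U a = 0 by rewrite /comb big_seq big1// => u /az ->; rewrite scale0r.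
pose c v := if v \in U then 0 else l v.
have c1 : mass V c = 1.
  rewrite massV -m1 mU; congr (_ + _); first by apply: eq_mass => v /WU/negbTE; rewrite /c => ->.
  by rewrite /mass big_seq big1// => u; rewrite /c => ->.
have cq : comb V c = q.
  rewrite combV qE cU; congr (_ + _); first by apply: eq_comb => v /WU/negbTE; rewrite /c => ->.
  by rewrite /comb big_seq big1// => u; rewrite /c => ->; rewrite scale0r.
have : c q = 1.
  by apply: (convex_position_coef VC) => // w _; rewrite /c; case: ifP.
by rewrite /c (negbTE (WU qW)) lq => /eqP; rewrite eq_sym oner_eq0.
Qed.

Lemma vc_point q : q \in W -> vc (fun v => (v == q)%:R) = hat q.
Proof.
move=> qW; rewrite /vcomb (big_fsetD1 q)//= eqxx scale1r big_seq big1 ?addr0//.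
by move=> v; rewrite in_fsetD1 => /andP[/negbTE -> _]; rewrite scale0r.
Qed.

Lemma hat_neq0 q : q \in W -> hat q != 0.
Proof.
move=> qW; apply/eqP => q0; apply: (@hat_extreme q (fun=> 0)) => //.
  by rewrite /mass big1.
by rewrite q0 /vcomb big1// => v _; rewrite scale0r.
Qed.

Lemma hat_inj : {in W &, injective hat}.
Proof.
move=> p q pW qW E; apply/eqP/negPn/negP => pq.
apply: (@hat_extreme p (fun v => (v == q)%:R)) => //.
- by rewrite (negbTE pq).
- by rewrite mass_point.
- by rewrite vc_point.
Qed.

(** Let [b] be the normalized [W]-part of [x]. By minimality the ray from [u] leaves the hull at
    [b], which gives a facet through [b] that misses [u]. All terms of the slack at [x] then vanish
    except that of [u], which therefore has the sign of a slack. *)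
Lemma mass_opt_hull l a x : mass_opt W hat l -> convex_hull [set` V] x ->
  x = comb W l + comb U a -> mass W l + mass U a = 1 ->
  forall u, u \in U -> 0 <= a u.
Proof.
move=> [l0 lo] xP xE m1 u uU.
pose c v := if v \in U then a v else l v.
have cW : mass W c = mass W l.
  by apply: eq_mass => v /WU/negbTE; rewrite /c => ->.
have cU : mass U c = mass U a by apply: eq_mass => v; rewrite /c => ->.
have xc : x = comb V c.
  rewrite combV xE; congr (_ + _); apply: eq_comb => v; rewrite /c.
    by move=> /WU/negbTE ->.
  by move=> ->.
have c1 : mass V c = 1 by rewrite massV cW cU.
have key b k : valid V b k -> dot b u < k ->
    (forall w, w \in U -> w != u -> dot b w = k) ->
    (forall v, v \in W -> l v != 0 -> dot b v = k) -> 0 <= a u.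
  move=> bk bu bU bW; have := valid_hull bk xP; rewrite -subr_ge0 xc slack_comb// sumV.
  rewrite big_seq big1 ?add0r => [|v vW]; last first.
    rewrite /c (negbTE (WU vW)); have [->|lv] := eqVneq (l v) 0; first by rewrite mul0r.
    by rewrite bW// subrr mulr0.
  rewrite (big_fsetD1 u)//= /c uU big_seq big1 ?addr0 => [|v].
    by rewrite pmulr_lge0// subr_gt0.
  by rewrite !inE => /andP[vu vU]; rewrite bU// subrr mulr0.
have M0 : 0 <= mass W l by exact: mass_ge0.
(* With empty [W]-part there is no [b], and any facet that misses [u] will do. *)
have [Mz|Mn] := eqVneq (mass W l) 0.
  have [b [k [h1 h2 h3]]] := facet_missing d0 VF VC SU uU.
  apply: (key b k) => // v vW lv; move: lv.
  move/eqP: Mz; rewrite /mass psumr_eq0// => /allP/(_ v vW) /=.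
  by move=> /eqP ->; rewrite eqxx.
have Mp : 0 < mass W l by rewrite lt_def Mn.
set M := mass W l in Mp Mn M0.
pose f v := if v \in W then M^-1 * l v else 0.
have f0 : nneg f.
  by move=> v; rewrite /f; case: ifP => // _; rewrite mulr_ge0// invr_ge0.
have fV v : v \notin V -> f v = 0.
  by rewrite /f => /negP vV; case: ifP => // /WV.
have mUf : mass U f = 0.
  by rewrite /mass big_seq big1// => v vU; rewrite /f inW vU.
have f1 : mass V f = 1 by rewrite massV mUf addr0 /f mass_restrict massZ mulVf.
have vf : vc f = M^-1 *: vc l.
  by rewrite -vcombZ; apply: eq_vcomb => v; rewrite /f => ->.
set b := comb V f.
have bP : convex_hull [set` V] b by apply/convex_hullP; exists f.
have [[k k0 kP]|nk] := pselect (exists2 k, 0 < k & convex_hull [set` V] (b + k *: (b - u))).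
  exfalso; have [n [n0 ns n1 nE]] := (convex_hullP _ _).1 kP.
  have h : vc n = (1 + k) *: vc f.
    rewrite -vcombZ; apply: (@vc_comb _ _ n (fun v => - k * (v == u)%:R)).
      rewrite -massV n1 massZ massZ mass_point// -(addr0 (mass W f)) -mUf -massV f1.
      by rewrite mulr1 mulr1; lra.
    rewrite -combV -nE combZ combZ comb_point// /b combV.
    have -> : comb U f = 0.
      by rewrite /comb big_seq big1// => v vU; rewrite /f inW vU scale0r.
    by apply/rowP => i; rewrite !mxE; ring.
  have k1 : 0 < 1 + k by lra.
  (* The point past [b] projects to [1 + k] times the projection of [b]; rescaled to the projection
     of [x], its [W]-part has mass at most [M / (1 + k)]. *)
  have : mass W l <= mass W (fun v => M / (1 + k) * n v).
    apply: lo => [v|]; first by rewrite mulr_ge0// divr_ge0// ltW.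
    rewrite vcombZ h vf !scalerA.
    by rewrite divfK ?gt_eqF// divff// scale1r.
  rewrite massZ leNgt => /negP; apply; rewrite -[ltRHS]mulr1 -mulrA ltr_pM2l//.
  rewrite mulrC ltr_pdivrMr// mul1r.
  have : mass W n <= 1 by rewrite -n1 massV lerDl mass_ge0.
  lra.
have [|b' [k [h1 h2 h3 h4]]] := facet_avoiding d0 VF bP (u := u).
  by move=> k k0 kP; apply: nk; exists k.
apply: (key b' k) => // [w wU wu|v vW lv]; first exact: (spine_facet SU h4 uU).
apply: (@valid_hull_tight _ _ V b' k f) => //; first exact: WV.
by rewrite /f vW mulf_neq0// invr_eq0.
Qed.

Lemma mem_hatV p : p \in hatV -> p = 0 \/ exists2 v, v \in W & p = hat v.
Proof.
move=> /imfsetP[v /= vV ->]; have [vU|vW] := UVW vV; first by left; exact: hatU.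
by right; exists v.
Qed.

Lemma hat0 : 0 \in hatV.
Proof. by rewrite -(hatU u1U); apply: in_imfset; exact: (fsubsetP UV). Qed.

Lemma hatW v : v \in W -> hat v \in hatV.
Proof. by move=> vW; apply: in_imfset; exact: WV. Qed.

Lemma sum_hatV (M : nmodType) (F : 'rV[R]_d -> M) :
  \sum_(p <- hatV) F p = F 0 + \sum_(v <- W) F (hat v).
Proof.
rewrite (big_fsetD1 0) ?hat0//=; congr (_ + _).
have -> : (hatV `\ 0)%fset = [fset hat v | v in W]%fset.
  apply/fsetP => p; rewrite in_fsetD1; apply/andP/imfsetP => [[p0 /mem_hatV[pE|[v vW pE]]]|].
  - by rewrite pE eqxx in p0.
  - by exists v.
  by move=> [v /= vW ->]; rewrite hat_neq0// hatW.
by rewrite big_imfset//=; exact: hat_inj.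
Qed.

Lemma mass_hatV c : mass hatV c = c 0 + mass W (c \o hat).
Proof. exact: sum_hatV. Qed.

Lemma comb_hatV c : comb hatV c = vc (c \o hat).
Proof. by rewrite /comb sum_hatV scaler0 add0r. Qed.

(** Coefficients on [W] and a value at the apex define a function on the projected set because the
    projection is injective on [W] and avoids 0 there. *)
Lemma extend_coef l (k : R) : exists c, [/\ c 0 = k,
  forall v, v \in W -> c (hat v) = l v & forall p, p \notin hatV -> c p = 0].
Proof.
have /choice[c cP] : forall p, exists m : R, [/\ p = 0 -> m = k,
    forall v, v \in W -> p = hat v -> m = l v & p \notin hatV -> m = 0].
  move=> p; have [p0|p0] := eqVneq p 0.
    exists k; split => // [v vW E|]; last by rewrite p0 hat0.
    by have := hat_neq0 vW; rewrite -E p0 eqxx.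
  have [[v vW pE]|nv] := pselect (exists2 v, v \in W & p = hat v).
    exists (l v); split => [E|w wW E|]; first by rewrite E eqxx in p0.
      by congr l; apply: hat_inj => //; rewrite -pE.
    by rewrite pE hatW.
  exists 0; split => // [E|v vW E]; first by rewrite E eqxx in p0.
  by case: nv; exists v.
exists c; split => [|v vW|p pV].
- by have [h _ _] := cP 0; exact: h.
- by have [_ h _] := cP (hat v); exact: h.
- by have [_ _ h] := cP p; exact: h.
Qed.

Lemma conv_hat s y : (s `<=` hatV)%fset -> convex_hull [set` s] y <->
  exists l k, [/\ nneg l, 0 <= k, k != 0 -> 0 \in s,
    forall v, v \in W -> l v != 0 -> hat v \in s & k + mass W l = 1 /\ y = vc l].
Proof.
move=> sV; rewrite (convex_hull_subP _ sV); split.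
  move=> [c [c0 cs c1 ->]]; exists (c \o hat), (c 0); split => //.
  - by move=> v; exact: c0.
  - by apply: contraNT => /cs ->.
  - by move=> v vW; apply: contraNT => /cs /= ->.
  - by rewrite -mass_hatV comb_hatV.
move=> [l [k [l0 k0 ks ls [m1 ->]]]].
have [c [ck cl c0]] := extend_coef l k.
exists c; split.
- move=> p; have [/mem_hatV[->|[v vW ->]]|/c0 ->//] := boolP (p \in hatV).
    by rewrite ck.
  by rewrite cl.
- move=> p ps; have [/mem_hatV[pE|[v vW pE]]|/c0 ->//] := boolP (p \in hatV).
    by rewrite pE ck; apply/eqP; apply: contraNT ps => /ks; rewrite pE.
  by rewrite pE cl//; apply/eqP; apply: contraNT ps => /(ls v vW); rewrite pE.
- by rewrite mass_hatV ck -m1; congr (_ + _); exact: eq_mass.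
- by rewrite comb_hatV; apply: eq_vcomb => v vW; rewrite /= cl.
Qed.

Lemma conv_hatV y : convex_hull [set` hatV] y <->
  exists l, [/\ nneg l, mass W l <= 1 & y = vc l].
Proof.
rewrite conv_hat//; split=> [[l [k [l0 k0 _ _ [m1 ->]]]]|[l [l0 l1 ->]]].
  by exists l; split => //; rewrite -m1 lerDr.
exists l, (1 - mass W l); split; rewrite ?subrK ?subr_ge0//.
  by move=> _; exact: hat0.
by move=> v vW _; exact: hatW.
Qed.

(** With the apex 0 among the vertices, its coefficient absorbs the total mass, and affine
    independence becomes linear independence of the other vertices. *)
Lemma independent_hat s : (s `<=` hatV)%fset -> 0 \in s ->
  affinely_independent s <->
  forall l, (forall v, v \in W -> l v != 0 -> hat v \in s) -> vc l = 0 ->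
    forall v, v \in W -> l v = 0.
Proof.
move=> sV s0; split=> [si l ls lv v vW|h c c1 c2].
  have [c [ck cl c0]] := extend_coef l (- mass W l).
  have cs p : p \notin s -> c p = 0.
    move=> ps; have [/mem_hatV[pE|[w wW pE]]|/c0 ->//] := boolP (p \in hatV).
      by rewrite pE s0 in ps.
    by rewrite pE cl//; apply/eqP; apply: contraNT ps => /(ls w wW); rewrite pE.
  apply/eqP/negPn/negP => lv0; move: (lv0); rewrite -(cl v vW) (si c) ?eqxx//.
  - rewrite -/(mass s c) (mass_sub sV)// mass_hatV ck.
    by rewrite (@eq_mass _ _ W _ l) ?addNr// => w /cl.
  - rewrite -/(comb s c) (comb_sub sV)// comb_hatV -[RHS]lv.
    by apply: eq_vcomb => w /cl.
  - exact: ls.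
pose c' p := if p \in s then c p else 0.
have cs p : p \notin s -> c' p = 0 by rewrite /c' => /negbTE ->.
have mc : mass hatV c' = 0 by rewrite -(mass_sub sV)// mass_restrict.
have vcE : vc (c' \o hat) = 0.
  by rewrite -comb_hatV -(comb_sub sV)// comb_restrict.
have cz : forall v, v \in W -> c' (hat v) = 0.
  apply: (h (c' \o hat)) => // v vW.
  by apply: contraNT => /cs /= ->.
move=> p ps; have -> : c p = c' p by rewrite /c' ps.
have [->|[v vW ->]] := mem_hatV (fsubsetP sV p ps); last exact: cz.
move: mc; rewrite mass_hatV (@eq_mass _ _ W _ (fun=> 0)) ?/mass ?big1 ?addr0//.
Qed.

Lemma rank_hatV : \rank (hmx hatV) = e.+1.
Proof. exact: rank_Phi. Qed.

Lemma hatV_sub s : (s `<=` V)%fset -> ([fset hat v | v in s] `<=` hatV)%fset.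
Proof.
by move=> sV; apply/fsubsetP => _ /imfsetP[v /= vs ->]; apply/in_imfset/(fsubsetP sV).
Qed.

(** A set is a simplex when its indicator is optimal, which by [opt_sub] means that all conic
    combinations of its nonzero vertices are optimal. Adding or removing 0 does not affect this
    condition. *)
Lemma star_exists : exists S, star_triangulation e hatV S.
Proof.
have [g gP] := generic_exists W hat.
pose op := opt W hat g.
pose ind s v : R := (hat v \in s)%:R.
have ind0 s v : ind s v != 0 -> hat v \in s.
  by rewrite /ind; case: (hat v \in s) => //; rewrite eqxx.
have indE s v : hat v \in s -> ind s v != 0.
  by rewrite /ind => ->; rewrite oner_neq0.
pose S : {fset {fset 'rV[R]_d}} := [fset s in fpowerset hatV | `[< op (ind s) >]]%fset.
have SP s : s \in S <-> (s `<=` hatV)%fset /\ op (ind s).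
  rewrite !inE/= fpowersetE; split=> [/andP[-> /asboolP]//|[-> h]] /=.
  exact/asboolP.
have optS s l : op (ind s) -> nneg l ->
    (forall v, v \in W -> l v != 0 -> hat v \in s) -> op l.
  by move=> so l0 ls; apply: (opt_sub so l0) => v vW /(ls v vW)/indE.
have nnind s : nneg (ind s) by move=> v; exact: ler0n.
have SU0 s : s \in S -> (0 |` s)%fset \in S.
  move=> /SP[sV so]; apply/SP; split.
    by apply/fsubsetP => p; rewrite !inE => /orP[/eqP ->|/(fsubsetP sV)//]; exact: hat0.
  apply: optS so (nnind _) _ => v vW /ind0.
  by rewrite !inE (negbTE (hat_neq0 vW)).
have SI0 s : s \in S -> 0 \in s -> affinely_independent s.
  move=> /SP[sV so] s0; apply/(independent_hat sV s0) => l ls lv v vW.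
  apply/eqP/negPn/negP => lvn.
  apply: (@opt_independent _ _ W hat g gP (ind s) (fun v => if v \in W then l v else 0) so).
  split; last by exists v; rewrite ?vW.
    move=> w; rewrite mem_supp; case: ifP => //= wW; rewrite negbK => /eqP iw.
    apply/eqP; apply/negPn/negP => /(ls w wW)/indE.
    by rewrite iw eqxx.
  by rewrite -lv; apply: eq_vcomb => w ->.
have SI s : s \in S -> affinely_independent s.
  move=> sS; apply: (@affinely_independentS _ _ s (0 |` s)%fset).
    exact: fsubsetU1.
  by apply: SI0; [exact: SU0|rewrite !inE eqxx].
have cover y : convex_hull [set` hatV] y -> exists2 s, s \in S & convex_hull [set` s] y.
  move=> /conv_hatV[l [l0 l1 ->]].
  have [m mo ml] := opt_exists gP l0.
  have [m0 _] := mo.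
  have m1 : mass W m <= 1.
    by apply: le_trans l1; apply: (opt_mass_opt mo).2.
  (* The optimum has mass at most 1, and what is left over goes to the apex. *)
  pose s := (0 |` [fset hat v | v in supp W m])%fset.
  have sV : (s `<=` hatV)%fset.
    apply/fsubsetP => p; rewrite !inE => /orP[/eqP ->|/imfsetP[v /=]]; first exact: hat0.
    by rewrite mem_supp => /andP[vW _] ->; exact: hatW.
  have sS : s \in S.
    apply/SP; split => //; apply: (opt_sub mo (nnind _)) => v vW /ind0.
    rewrite !inE (negbTE (hat_neq0 vW))/= => /imfsetP[w /=].
    by rewrite mem_supp => /andP[wW mw] /(hat_inj vW wW) ->.
  exists s => //; apply/conv_hat => //; exists m, (1 - mass W m); split => //.
  - by rewrite subr_ge0.
  - by rewrite !inE eqxx.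
  - move=> v vW mv; rewrite !inE; apply/orP; right; apply/imfsetP; exists v => //=.
    by rewrite mem_supp vW mv.
  - by rewrite subrK ml.
exists S; split; first split; first split.
- exact: SI.
- move=> s t sS ts; have [sV so] := (SP _).1 sS; apply/SP; split.
    exact: fsubset_trans sV.
  by apply: optS so (nnind _) _ => v _ /ind0; exact: (fsubsetP ts).
- move=> s t /SP[sV so] /SP[tV to]; exists (s `&` t)%fset; split.
  + exact: fsubsetIl.
  + exact: fsubsetIr.
  apply/seteqP; split=> [y [/(conv_hat _ sV) + /(conv_hat _ tV)]|y ry]; last first.
    by split; apply: convex_hullS ry; [exact: fsubsetIl|exact: fsubsetIr].
  move=> [l [k [l0 k0 ks ls [m1 yE]]]] [m [j [m0 j0 js ms [m2 yE']]]].
  have lm : {in W, l =1 m}.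
    by apply: (@opt_unique _ _ W hat g gP); [exact: optS so l0 ls|exact: optS to m0 ms|rewrite -yE].
  have kj : k = j by move: m1; rewrite (eq_mass lm) -m2; exact: addIr.
  apply/conv_hat; first by apply: fsubset_trans sV; exact: fsubsetIl.
  exists l, k; split => //.
  + by move=> kn; rewrite inE ks// js// -kj.
  + by move=> v vW lv; rewrite inE ls// ms// -lm.
- apply/fsetP => p; apply/fcoverP/idP => [[s /SP[sV _] ps]|pV].
    exact: (fsubsetP sV).
  have [s sS ps] := cover p (convex_hull_point pV).
  have [sV so] := (SP _).1 sS.
  have [->|[v vW pE]] := mem_hatV pV.
    by exists (0 |` s)%fset; [exact: SU0|rewrite !inE eqxx].
  (* If [hat v] were not a vertex of the simplex covering it, it would lie in the hull of 0 and
     other projected vertices. *)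
  exists s => //; have [l [k [l0 k0 ks ls [m1 yE]]]] := (conv_hat _ sV).1 ps.
  rewrite pE; apply: ls => //; apply/eqP => lv.
  by apply: (hat_extreme vW l0 lv) => //; rewrite -?pE// -m1 lerDr.
- apply/seteqP; split=> [y [s /= /SP[sV _]]|y /cover[s sS sy]].
    exact: convex_hullS.
  by exists s.
(* Adding 0 to a simplex with [e.+1] vertices other than 0 would give [e.+2] independent points in
   dimension [e]. *)
- move=> s sS se; apply/negPn/negP => s0.
  have := @independent_card _ _ _ hatV _ (SI _ (SU0 s sS)) _ rank_hatV.
  rewrite cardfsU1 s0 se add1n ltnn => /(_ _)/negP; apply => //.
  by have /SP[] := SU0 s sS.
Qed.

Lemma lift_complexP S r : r \in lift_complex V U u1 S <->
  exists2 t, maximal_simplex S t & (r `<=` lift_simplex V U u1 t)%fset.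
Proof.
split=> [/bigfcupP[t /andP[_ tS]]|[t tS rt]]; first by rewrite fpowersetE; exists t.
apply/bigfcupP; exists t; last by rewrite fpowersetE.
by rewrite tS andbT; case/maximalP: tS.
Qed.

Lemma mem_lift t v : (v \in lift_simplex V U u1 t) = (v \in V) && (hat v \in t).
Proof. by rewrite /lift_simplex !inE. Qed.

Lemma star_maximal S t : star_triangulation e hatV S -> maximal_simplex S t ->
  0 \in t.
Proof.
move=> [tri star] /maximalP[tS tm].
have [t' [t'S tt' t'e]] := triangulation_pure tri rank_hatV tS.
by rewrite -(tm t' t'S tt'); exact: star.
Qed.

(** The factor [k] brings the common point into both hulls, hence into that of [r]. Its coefficients
    there are, by independence in [s] and in [t], the multiples by [k] of [l] and of [m]. *)
Lemma common_coef s t r l m k : affinely_independent s -> affinely_independent t ->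
  (s `<=` hatV)%fset -> (t `<=` hatV)%fset -> 0 \in s -> 0 \in t ->
  (r `<=` s)%fset -> (r `<=` t)%fset ->
  convex_hull [set` s] `&` convex_hull [set` t] `<=` convex_hull [set` r] ->
  nneg l -> (forall v, v \in W -> l v != 0 -> hat v \in s) ->
  nneg m -> (forall v, v \in W -> m v != 0 -> hat v \in t) ->
  0 < k -> k * mass W l <= 1 -> k * mass W m <= 1 ->
  vc l = vc m -> {in W, l =1 m}.
Proof.
move=> si ti sV tV s0 t0 rs rt rE l0 ls m0 mt k0 kl km lm v vW.
have kn := lt0r_neq0 k0.
have sup (n : 'rV[R]_d -> R) s' : (forall v, v \in W -> n v != 0 -> hat v \in s') ->
    forall v, v \in W -> k * n v != 0 -> hat v \in s'.
  by move=> h w wW; rewrite mulf_eq0 negb_or => /andP[_]; exact: h.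
have : convex_hull [set` r] (k *: vc l).
  apply: rE; split.
    apply/(conv_hat _ sV); exists (fun v => k * l v), (1 - k * mass W l).
    split; rewrite ?massZ ?vcombZ ?subrK ?subr_ge0//; last exact: sup.
    by move=> w; rewrite mulr_ge0// ltW.
  apply/(conv_hat _ tV); exists (fun v => k * m v), (1 - k * mass W m).
  split; rewrite ?massZ ?vcombZ ?subrK ?subr_ge0 ?lm//; last exact: sup.
  by move=> w; rewrite mulr_ge0// ltW.
have rV : (r `<=` hatV)%fset := fsubset_trans rs sV.
move=> /(conv_hat _ rV)[n [j [n0 j0 jr nr [n1 nE]]]].
have Es : {in W, l =1 fun v => k^-1 * n v}.
  move=> w wW; apply/eqP; rewrite -subr_eq0; apply/eqP.
  apply: (((independent_hat sV s0).1 si) (fun v => l v - k^-1 * n v)) => // [x xW|].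
    apply: contraNT => xs; have [lx|/(ls x xW)] := eqVneq (l x) 0; last by rewrite (negbTE xs).
    have [nx|/(nr x xW)/(fsubsetP rs)] := eqVneq (n x) 0; last by rewrite (negbTE xs).
    by rewrite lx nx mulr0 subr0.
  by rewrite vcombB vcombZ -nE scalerA mulVf// scale1r subrr.
have Et : {in W, m =1 fun v => k^-1 * n v}.
  move=> w wW; apply/eqP; rewrite -subr_eq0; apply/eqP.
  apply: (((independent_hat tV t0).1 ti) (fun v => m v - k^-1 * n v)) => // [x xW|].
    apply: contraNT => xs; have [lx|/(mt x xW)] := eqVneq (m x) 0; last by rewrite (negbTE xs).
    have [nx|/(nr x xW)/(fsubsetP rt)] := eqVneq (n x) 0; last by rewrite (negbTE xs).
    by rewrite lx nx mulr0 subr0.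
  by rewrite vcombB vcombZ -nE scalerA mulVf// scale1r lm subrr.
by rewrite Es// Et.
Qed.

Lemma star_cone_unique S s t l m : star_triangulation e hatV S ->
  maximal_simplex S s -> maximal_simplex S t ->
  nneg l -> (forall v, v \in W -> l v != 0 -> hat v \in s) ->
  nneg m -> (forall v, v \in W -> m v != 0 -> hat v \in t) ->
  vc l = vc m -> {in W, l =1 m}.
Proof.
move=> Sst sm tm l0 ls m0 mt; have [tri _] := Sst; have [[SI SC SX] _ _] := tri.
have s0 := star_maximal Sst sm; have t0 := star_maximal Sst tm.
have [/maximalP[sS _] /maximalP[tS _]] := (sm, tm).
have [r [rs rt rE]] := SX s t sS tS.
have lp : 0 <= mass W l by exact: mass_ge0.
have mp : 0 <= mass W m by exact: mass_ge0.
have kp : 0 < 1 + mass W l + mass W m by lra.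
apply: (@common_coef s t r l m (1 + mass W l + mass W m)^-1) => //.
- exact: SI.
- exact: SI.
- exact: triangulation_sub tri sS.
- exact: triangulation_sub tri tS.
- by rewrite rE.
- by rewrite invr_gt0.
- by rewrite mulrC ler_pdivrMr//; lra.
- by rewrite mulrC ler_pdivrMr//; lra.
Qed.

(** If [n] were cheaper, take [k] at least its mass and below that of [l]. The point [k^-1 *: vc n]
    lies in the projected polytope, hence in a maximal simplex with coefficients of mass at most 1.
    Uniqueness in the cones identifies [l] with [k] times these, so its mass is at most [k]. *)
Lemma star_mass_opt S t l : star_triangulation e hatV S -> maximal_simplex S t ->
  nneg l -> (forall v, v \in W -> l v != 0 -> hat v \in t) -> mass_opt W hat l.
Proof.
move=> Sst tm l0 lt; have [tri _] := Sst; have [[SI SC SX] _ Scov] := tri.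
split=> // n n0 nl; rewrite leNgt; apply/negP => lt_nl.
have np : 0 <= mass W n by exact: mass_ge0.
pose k := (mass W n + mass W l) / 2.
have k0 : 0 < k by rewrite /k; lra.
have nk : mass W n <= k by rewrite /k; lra.
have kl : k < mass W l by rewrite /k; lra.
have : convex_hull [set` hatV] (k^-1 *: vc n).
  apply/conv_hatV; exists (fun v => k^-1 * n v); rewrite massZ vcombZ; split => //.
    by move=> v; rewrite mulr_ge0// invr_ge0 ltW.
  by rewrite mulrC ler_pdivrMr// mul1r.
rewrite -Scov => -[s /= sS /(convex_hullS _)].
have [s' s'm ss'] := maximal_above sS.
move=> /(_ _ ss'); have [s'S _] := maximalP _ _ s'm.
move=> /(conv_hat _ (triangulation_sub tri s'S))[m [j [m0 j0 _ ms [m1 mE]]]].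
have : {in W, l =1 fun v => k * m v}.
  apply: (star_cone_unique Sst tm s'm) => //.
  - by move=> v; rewrite mulr_ge0// ltW.
  - by move=> v vW; rewrite mulf_eq0 negb_or => /andP[_]; exact: ms.
  - by rewrite vcombZ -mE scalerA divff ?scale1r// gt_eqF.
move=> /eq_mass; rewrite massZ => lE; move: kl; rewrite lE ltNge => /negP; apply.
by rewrite -[leRHS]mulr1 ler_pM2l//; move: m1 j0; lra.
Qed.

Lemma lift_spinal S : star_triangulation e hatV S ->
  spinal_triangulation V U (lift_complex V U u1 S).
Proof.
move=> Sst; have [tri _] := Sst; have [[SI SC SX] Sc Scov] := tri.
have Ulift t : maximal_simplex S t -> (U `<=` lift_simplex V U u1 t)%fset.
  move=> tm; apply/fsubsetP => u uU; rewrite mem_lift hatU// (star_maximal Sst tm).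
  by rewrite andbT; exact: (fsubsetP UV).
have liftV t : (lift_simplex V U u1 t `<=` V)%fset.
  by apply/fsubsetP => v; rewrite mem_lift => /andP[].
have LT t : maximal_simplex S t -> lift_simplex V U u1 t \in lift_complex V U u1 S.
  by move=> tm; apply/lift_complexP; exists t.
split; first split; first split.
- move=> s /lift_complexP[t tm st]; apply: affinely_independentS st _.
  have [tS _] := maximalP _ _ tm.
  move=> c c1 c2; set L := lift_simplex V U u1 t in c1 c2 *.
  pose c' v := if v \in L then c v else 0.
  have cL v : v \notin L -> c' v = 0 by rewrite /c' => /negbTE ->.
  have m1 : mass V c' = 0 by rewrite -(mass_sub (liftV t))// mass_restrict.
  have q1 : comb V c' = 0 by rewrite -(comb_sub (liftV t))// comb_restrict.
  have vc0 : vc c' = 0.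
    rewrite -[RHS](_ : vc (fun=> 0) = 0).
      apply: (@vc_comb _ _ c' (fun=> 0)).
        by rewrite -massV m1 /mass !big1 ?addr0.
      by rewrite -combV q1 /comb !big1 ?addr0// => v _; rewrite scale0r.
    by rewrite /vcomb big1// => v _; rewrite scale0r.
  have cW v : v \in W -> c' v = 0.
    apply: ((independent_hat (triangulation_sub tri tS) (star_maximal Sst tm)).1 (SI t tS)) => // w wW.
    by rewrite /c' mem_lift (WV wW) /=; case: ifP => //; rewrite eqxx.
  have cU : forall v, v \in U -> c' v = 0.
    apply: UI.
      move: m1; rewrite massV [X in X + _](_ : _ = 0) ?add0r//.
      by rewrite /mass big_seq big1// => v /cW.
    move: q1; rewrite combV [X in X + _](_ : _ = 0) ?add0r//.
    by rewrite /comb big_seq big1// => v /cW ->; rewrite scale0r.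
  move=> v vL; have -> : c v = c' v by rewrite /c' vL.
  by have [vU|vW] := UVW (fsubsetP (liftV t) _ vL); [exact: cU|exact: cW].
- move=> s t /lift_complexP[r rm sr] ts; apply/lift_complexP; exists r => //.
  exact: fsubset_trans sr.
- move=> s s' /lift_complexP[t tm st] /lift_complexP[t' tm' st'].
  exists (s `&` s')%fset; split; [exact: fsubsetIl|exact: fsubsetIr|].
  apply/seteqP; split=> [x|x rx]; last first.
    by split; apply: convex_hullS rx; [exact: fsubsetIl|exact: fsubsetIr].
  have sV := fsubset_trans st (liftV t); have sV' := fsubset_trans st' (liftV t').
  move=> [/(convex_hull_subP _ sV)[c [c0 cs c1 xc]] /(convex_hull_subP _ sV')[f [f0 fs f1 xf]]].
  (* The projection determines the [W]-coefficients by cone uniqueness; independence of [U] then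
     determines the rest. *)
  have cf : {in W, c =1 f}.
    apply: (star_cone_unique Sst tm tm') => //.
    - move=> v vW cv; have : v \in lift_simplex V U u1 t.
        by apply: (fsubsetP st); apply: contraNT cv => /cs ->.
      by rewrite mem_lift => /andP[].
    - move=> v vW fv; have : v \in lift_simplex V U u1 t'.
        by apply: (fsubsetP st'); apply: contraNT fv => /fs ->.
      by rewrite mem_lift => /andP[].
    - by apply: (@vc_comb c f c f); rewrite -?massV -?combV ?c1 ?f1 -?xc.
  have cfU : {in U, c =1 f}.
    apply: affinely_independent_coef UI _ _.
      by move: c1; rewrite -f1 !massV (eq_mass cf) => /addrI.
    by move: xc; rewrite xf !combV (eq_comb cf) => /addrI.
  have cfV v : v \in V -> c v = f v.
    by move=> /UVW[vU|vW]; [exact: cfU|exact: cf].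
  have IV : (s `&` s' `<=` V)%fset by apply: fsubset_trans sV; exact: fsubsetIl.
  apply/(convex_hull_subP _ IV); exists c; split => // v.
  rewrite inE negb_and => /orP[/cs//|vs'].
  have [vV|vV] := boolP (v \in V); first by rewrite cfV// fs.
  by rewrite cs//; apply: contra vV; exact: (fsubsetP sV).
- apply/fsetP => v; apply/fcoverP/idP => [[s /lift_complexP[t tm st] vs]|vV].
    by apply: (fsubsetP (liftV t)); exact: (fsubsetP st).
  have : hat v \in hatV by exact: in_imfset.
  rewrite -Sc => /fcoverP[t tS vt]; have [t' tm tt'] := maximal_above tS.
  exists (lift_simplex V U u1 t'); first exact: LT.
  by rewrite mem_lift vV (fsubsetP tt').
- apply/seteqP; split=> [x [s /= /lift_complexP[t tm st]]|x xP].
    by apply: convex_hullS; apply: fsubset_trans st (liftV t).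
  have : convex_hull [set` hatV] (hat x) by rewrite convex_hull_Phi; exists x.
  rewrite -Scov => -[t0 /= tS0 /(convex_hullS _)].
  have [t tm tt] := maximal_above tS0; move=> /(_ _ tt).
  have [tS _] := maximalP _ _ tm.
  move=> /(conv_hat _ (triangulation_sub tri tS))[l [k [l0 k0 kt lt [l1 lE]]]].
  have [a [m1 xE]] := hat_rep lE.
  (* The simplex over [hat x] fixes the [W]-part. Its minimality makes the remaining coefficients on
     [U] nonnegative, so that [x] lies in the lift. *)
  have a0 := mass_opt_hull (star_mass_opt Sst tm l0 lt) xP xE m1.
  exists (lift_simplex V U u1 t); first exact: LT.
  pose c v := if v \in U then a v else if v \in W then l v else 0.
  have cW : {in W, c =1 l} by move=> v vW; rewrite /c (negbTE (WU vW)) vW.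
  have cU : {in U, c =1 a} by move=> v; rewrite /c => ->.
  apply/(convex_hull_subP _ (liftV t)); exists c; split.
  + by move=> v; rewrite /c; case: ifP => [/a0//|_]; case: ifP.
  + move=> v; rewrite mem_lift /c; case: ifP => [vU|_].
      by rewrite hatU// (fsubsetP UV)// (star_maximal Sst tm).
    case: ifP => // vW; rewrite (WV vW)/= => vt; apply/eqP.
    by apply: contraNT vt; exact: lt.
  + by rewrite massV (eq_mass cW) (eq_mass cU).
  + by rewrite combV (eq_comb cW) (eq_comb cU).
- move=> s /maximalP[/lift_complexP[t tm st] sm].
  by rewrite -(sm _ (LT t tm) st); exact: Ulift.
Qed.

(** * From spinal triangulations to star triangulations *)

Section SpinalToStar.
Variable T : {fset {fset 'rV[R]_d}}.
Hypotheses (tri : triangulation V T) (spi : spinal U T).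

Lemma spinal_U s : s \in T -> (s `|` U)%fset \in T.
Proof.
move=> sT; have [t tm st] := maximal_above sT; have [[_ TC _] _ _] := tri.
apply: (TC t); first by case/maximalP: tm.
by rewrite fsubUset st spi.
Qed.

(** Both combinations are representations of one point [y] after adding coefficients on [U],
    possibly negative. Contracting towards the barycentre of [U] makes all of them nonnegative, so
    the contracted point lies in both simplices of the complex, and its coordinates in their common
    face agree with both. *)
Lemma spinal_cone_unique s t l m : s \in T -> t \in T ->
  nneg l -> (forall v, v \in W -> l v != 0 -> v \in s) ->
  nneg m -> (forall v, v \in W -> m v != 0 -> v \in t) ->
  vc l = vc m -> {in W, l =1 m}.
Proof.
move=> sT tT l0 ls m0 mt lm.
have [[TI TC TX] _ _] := tri.
pose n := #|` U|.
have np : (0 < n)%N by rewrite cardfs_gt0; apply/fset0Pn; exists u1.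
have nR : 0 < n%:R^-1 :> R by rewrite invr_gt0 ltr0n.
have mn : mass U (fun=> n%:R^-1) = 1.
  rewrite /mass big_const_seq count_predT iter_addr_0 -[LHS]mulr_natr mulVf//.
  by rewrite pnatr_eq0 -lt0n.
pose c0 := comb U (fun=> n%:R^-1).
(* The mass missing from [l] is spread evenly over [U]; it may be negative. *)
pose b u : R := (1 - mass W l) * n%:R^-1.
pose y := comb W l + comb U b.
have my : mass W l + mass U b = 1.
  have -> : mass U b = (1 - mass W l) * mass U (fun=> n%:R^-1) by rewrite -massZ.
  by rewrite mn mulr1 addrC subrK.
pose gl v := if v \in U then b v else if v \in W then l v else 0.
have hy : hat y = vc m.
  have glW : {in W, gl =1 l} by move=> v vW; rewrite /gl (negbTE (WU vW)) vW.
  have glU : {in U, gl =1 b} by move=> v; rewrite /gl => ->.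
  rewrite -lm -(eq_vcomb _ glW) -hat_comb ?massV ?(eq_mass glW) ?(eq_mass glU)//.
  by rewrite combV (eq_comb glW) (eq_comb glU).
have [a [ma ya]] := hat_rep hy.
(* The coefficients of [c0 + k *: (z - c0)] when [z] has coefficients [f] on [W] and [h] on [U]. *)
pose coef (k : R) (f h : 'rV[R]_d -> R) v :=
  if v \in U then n%:R^-1 + k * (h v - n%:R^-1) else if v \in W then k * f v else 0.
have [x0 x0p hx] : exists2 x0 : R, 0 < x0 & forall k, 0 < k -> k <= x0 ->
    forall u, u \in enum_fset U -> 0 <= n%:R^-1 + k * (b u - n%:R^-1) /\
      0 <= n%:R^-1 + k * (a u - n%:R^-1).
  apply: small_all => u uU.
  have [||x1 x1p h1] := @small_ge0 R n%:R^-1 (b u - n%:R^-1); first exact: ltW.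
    by move=> E; move: nR; rewrite E ltxx.
  have [||x2 x2p h2] := @small_ge0 R n%:R^-1 (a u - n%:R^-1); first exact: ltW.
    by move=> E; move: nR; rewrite E ltxx.
  exists (Num.min x1 x2); first by rewrite lt_min x1p x2p.
  move=> k xp; rewrite le_min => /andP[xx1 xx2]; split; [exact: h1|exact: h2].
have coefW k f h : {in W, coef k f h =1 fun v => k * f v}.
  by move=> v vW; rewrite /coef (negbTE (WU vW)) vW.
have coefU k f h : {in U, coef k f h =1 fun v => n%:R^-1 + k * (h v - n%:R^-1)}.
  by move=> v vU; rewrite /coef vU.
have coefV k f h v : v \notin V -> coef k f h v = 0.
  move=> vV; rewrite /coef; case: ifP => [/(fsubsetP UV)|_]; first by rewrite (negbTE vV).
  by case: ifP => // /WV; rewrite (negbTE vV).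
have coefM k f h : mass W f + mass U h = 1 -> mass V (coef k f h) = 1.
  move=> fh; rewrite massV (eq_mass (@coefW k f h)) (eq_mass (@coefU k f h)).
  by rewrite massD !massZ massB mn; move: fh; set A := mass W f; set B := mass U h; nra.
have coefC k f h z : z = comb W f + comb U h ->
    comb V (coef k f h) = c0 + k *: (z - c0).
  move=> ->; rewrite combV (eq_comb (@coefW k f h)) (eq_comb (@coefU k f h)).
  rewrite combD !combZ combB -/c0; apply/rowP => i; rewrite !mxE; ring.
have sU := spinal_U sT; have tU := spinal_U tT.
have sV := triangulation_sub tri sU; have tV := triangulation_sub tri tU.
have inH f h s' : (s' `|` U)%fset \in T -> nneg f ->
    (forall v, v \in W -> f v != 0 -> v \in s') ->
    (forall u, u \in U -> 0 <= n%:R^-1 + x0 * (h u - n%:R^-1)) ->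
    mass W f + mass U h = 1 -> y = comb W f + comb U h ->
    convex_hull [set` (s' `|` U)%fset] (c0 + x0 *: (y - c0)).
  move=> s'T f0 fs h0 fh yE; rewrite -(coefC x0 f h y yE).
  apply/(convex_hull_subP _ (triangulation_sub tri s'T)).
  exists (coef x0 f h); split => // [v|v|]; last exact: coefM.
    rewrite /coef; case: ifP => [/h0//|_]; case: ifP => // _.
    by rewrite mulr_ge0// ltW.
  rewrite /coef inE negb_or => /andP[vs /negbTE ->]; case: ifP => // vW.
  apply/eqP; rewrite mulf_eq0 orbC; apply/orP; left.
  by apply: contraNT vs; exact: fs.
have Hs := inH l b s sU l0 ls (fun u uU => (hx x0 x0p (lexx _) u uU).1) my erefl.
have Ht := inH m a t tU m0 mt (fun u uU => (hx x0 x0p (lexx _) u uU).2) ma ya.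
have [r [rs rt rE]] := TX _ _ sU tU.
have : convex_hull [set` r] (c0 + x0 *: (y - c0)) by rewrite -rE.
have rV := fsubset_trans rs sV.
move=> /(convex_hull_subP _ rV)[g [g0 gr g1 gE]].
have uniq f h s' : (s' `|` U)%fset \in T -> (r `<=` s' `|` U)%fset ->
    (forall v, v \in W -> f v != 0 -> v \in s') ->
    mass W f + mass U h = 1 -> y = comb W f + comb U h ->
    forall v, v \in W -> x0 * f v = g v.
  move=> s'T rs' fs fh yE v vW.
  have s'V := triangulation_sub tri s'T.
  have out w : w \notin (s' `|` U)%fset -> coef x0 f h w = 0.
    rewrite /coef inE negb_or => /andP[ws /negbTE ->]; case: ifP => // wW.
    apply/eqP; rewrite mulf_eq0 orbC; apply/orP; left.
    by apply: contraNT ws; exact: fs.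
  have gout w : w \notin (s' `|` U)%fset -> g w = 0.
    by move=> ws; apply: gr; apply: contra ws; exact: (fsubsetP rs').
  rewrite -(coefW x0 f h v vW).
  have [vs|vs] := boolP (v \in (s' `|` U)%fset); last by rewrite out// gout.
  apply: (affinely_independent_coef (TI _ s'T)) => //.
    by rewrite (mass_sub s'V)// (mass_sub s'V)// coefM.
  by rewrite (comb_sub s'V)// (comb_sub s'V)// (coefC _ _ _ _ yE).
move=> v vW; have x0n := lt0r_neq0 x0p; apply: (mulfI x0n).
rewrite (uniq l b s sU rs ls my erefl v vW).
by rewrite (uniq m a t tU rt mt ma ya v vW).
Qed.

Definition hat_complex : {fset {fset 'rV[R]_d}} :=
  [fset [fset hat v | v : 'rV[R]_d in (s : {fset 'rV[R]_d})]%fset | s : {fset 'rV[R]_d} in T]%fset.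

Lemma mem_hat_simplex s v : v \in W -> (s `<=` V)%fset ->
  (hat v \in [fset hat w | w in s]%fset) = (v \in s).
Proof.
move=> vW sV; apply/imfsetP/idP => [[w /= ws E]|vs]; last by exists v.
have [wU|wW] := UVW (fsubsetP sV _ ws); last by rewrite (hat_inj vW wW E).
by have := hat_neq0 vW; rewrite E hatU// eqxx.
Qed.

Lemma hat_complexP t : t \in hat_complex <->
  exists2 s : {fset 'rV[R]_d}, s \in T & t = [fset hat v | v in s]%fset.
Proof.
split=> [/imfsetP[s /= sT ->]|[s sT ->]]; first by exists s.
by apply: in_imfset.
Qed.

Lemma hat_simplexU s : s \in T ->
  [fset hat v | v in (s `|` U)%fset]%fset = (0 |` [fset hat v | v in s])%fset.
Proof.
move=> sT; apply/fsetP => p; rewrite !inE; apply/imfsetP/orP => [[v /=]|].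
  rewrite inE => /orP[vs|vU] ->; last by left; rewrite hatU.
  by right; exact: in_imfset.
case=> [/eqP ->|/imfsetP[v /= vs ->]]; last by exists v; rewrite //= inE vs.
by exists u1; rewrite ?hatU//= inE u1U orbT.
Qed.

(** A linear relation among projected vertices lifts, with suitable coefficients on [U], to an
    affine relation on a simplex that contains [U]. Intersections follow from cone uniqueness, the
    mass at the apex being what remains. The star property is again a count of independent
    points. *)
Lemma hat_complex_star : star_triangulation e hatV hat_complex.
Proof.
have [[TI TC TX] Tc Tcov] := tri.
have SI s : s \in T -> affinely_independent [fset hat v | v in s]%fset.
  move=> sT; have sU := spinal_U sT; have sUV := triangulation_sub tri sU.
  apply: (@affinely_independentS _ _ _ [fset hat v | v in (s `|` U)%fset]%fset).
    apply/fsubsetP => _ /imfsetP[v /= vs ->]; apply: in_imfset.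
    by rewrite /= inE vs.
  apply/independent_hat; first exact: hatV_sub.
    by rewrite hat_simplexU// !inE eqxx.
  move=> l ls /vc0_rep[a [m1 c1]] v vW.
  pose c w := if w \in U then a w else if w \in W then l w else 0.
  have cW : {in W, c =1 l} by move=> w wW; rewrite /c (negbTE (WU wW)) wW.
  have cU : {in U, c =1 a} by move=> w; rewrite /c => ->.
  have cs w : w \notin (s `|` U)%fset -> c w = 0.
    rewrite inE negb_or /c => /andP[ws /negbTE wU]; rewrite wU; case: ifP => // wW.
    apply/eqP; apply: contraNT ws => /(ls w wW).
    by rewrite mem_hat_simplex// inE wU orbF.
  rewrite -cW//; have [vs|/cs//] := boolP (v \in (s `|` U)%fset).
  apply: (TI _ sU c) vs.
    by rewrite -/(mass _ c) (mass_sub sUV)// massV (eq_mass cW) (eq_mass cU).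
  by rewrite -/(comb _ c) (comb_sub sUV)// combV (eq_comb cW) (eq_comb cU).
split; first split; first split.
- by move=> t /hat_complexP[s sT ->]; exact: SI.
- move=> t r /hat_complexP[s sT ->] rs; apply/hat_complexP.
  exists [fset v in s | hat v \in r]%fset.
    by apply: (TC s) => //; apply/fsubsetP => v; rewrite !inE => /andP[].
  apply/fsetP => p; apply/idP/imfsetP => [pr|[v /=]].
    have /imfsetP[v /= vs pE] := fsubsetP rs p pr.
    by exists v; rewrite //= !inE vs -pE.
  by rewrite !inE => /andP[_ vr] ->.
- move=> _ _ /hat_complexP[s sT ->] /hat_complexP[t tT ->].
  have sV := triangulation_sub tri sT; have tV := triangulation_sub tri tT.
  set hs := [fset hat v | v in s]%fset; set ht := [fset hat v | v in t]%fset.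
  have hsV : (hs `<=` hatV)%fset by exact: hatV_sub.
  have htV : (ht `<=` hatV)%fset by exact: hatV_sub.
  exists (hs `&` ht)%fset; split; [exact: fsubsetIl|exact: fsubsetIr|].
  apply/seteqP; split=> [y [/(conv_hat _ hsV) + /(conv_hat _ htV)]|y ry]; last first.
    by split; apply: convex_hullS ry; [exact: fsubsetIl|exact: fsubsetIr].
  move=> [l [k [l0 k0 ks ls [m1 yE]]]] [m [j [m0 j0 js ms [m2 yE']]]].
  have lm : {in W, l =1 m}.
    apply: (spinal_cone_unique sT tT) => //.
    + by move=> v vW /(ls v vW); rewrite mem_hat_simplex.
    + by move=> v vW /(ms v vW); rewrite mem_hat_simplex.
    + by rewrite -yE.
  have kj : k = j by move: m1; rewrite (eq_mass lm) -m2; exact: addIr.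
  apply/conv_hat; first by apply: fsubset_trans hsV; exact: fsubsetIl.
  exists l, k; split => //.
  + by move=> kn; rewrite inE ks// js// -kj.
  + by move=> v vW lv; rewrite inE ls// ms// -lm.
- apply/fsetP => p; apply/fcoverP/idP => [[_ /hat_complexP[s sT ->] ps]|].
    exact: (fsubsetP (hatV_sub (triangulation_sub tri sT))).
  move=> /imfsetP[v /= + ->]; rewrite -Tc => /fcoverP[s sT vs].
  exists [fset hat w | w in s]%fset; last exact: in_imfset.
  by apply/hat_complexP; exists s.
- apply/seteqP; split=> [y [_ /= /hat_complexP[s sT ->]]|y].
    by apply: convex_hullS; exact/hatV_sub/(triangulation_sub tri).
  rewrite convex_hull_Phi => -[x]; rewrite -Tcov => -[s /= sT sx] <-.
  exists [fset hat w | w in s]%fset; first by apply/hat_complexP; exists s.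
  by rewrite convex_hull_Phi; exists x.
- move=> _ /hat_complexP[s sT ->] se; apply/negPn/negP => s0.
  have := @independent_card _ _ _ hatV _ (SI _ (spinal_U sT)) _ rank_hatV.
  rewrite hat_simplexU// cardfsU1 s0 se add1n ltnn => /(_ _)/negP; apply => //.
  by rewrite -hat_simplexU//; exact/hatV_sub/(triangulation_sub tri)/spinal_U.
Qed.

(** Every simplex can be enlarged by [U], and outside [U] the projection loses no vertex; so lifting
    the projection of [s] gives back the union of [s] and [U]. *)
Lemma lift_hat_complex : T = lift_complex V U u1 hat_complex.
Proof.
have [[TI TC TX] Tc Tcov] := tri.
apply/fsetP => r; apply/idP/idP => [rT|/lift_complexP[t tm rt]].
  have [s sm rs] := maximal_above rT; have [sT sM] := maximalP _ _ sm.
  have sV := triangulation_sub tri sT.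
  apply/lift_complexP; exists [fset hat v | v in s]%fset; last first.
    apply/fsubsetP => v /(fsubsetP rs) vs.
    by rewrite mem_lift (fsubsetP sV)//=; exact: in_imfset.
  apply/maximalP; split; first by apply/hat_complexP; exists s.
  move=> _ /hat_complexP[s' s'T ->] ss'.
  have s'V := triangulation_sub tri s'T.
  have E : (s' `|` U)%fset = s.
    apply: sM; first exact: spinal_U.
    apply/fsubsetP => v vs; rewrite inE.
    have [vU|vW] := UVW (fsubsetP sV _ vs); first by rewrite vU orbT.
    by rewrite -(mem_hat_simplex vW s'V) (fsubsetP ss')// in_imfset.
  apply/eqP; rewrite eqEfsubset ss' andbT -E.
  apply/fsubsetP => _ /imfsetP[v /= vs ->]; apply: in_imfset.
  by rewrite /= inE vs.
have [/hat_complexP[s sT tE] _] := maximalP _ _ tm.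
have sV := triangulation_sub tri sT.
apply: (TC _ _ (spinal_U sT)); apply: fsubset_trans rt _.
apply/fsubsetP => v; rewrite mem_lift tE inE => /andP[/UVW[->|vW]]; first by rewrite orbT.
by rewrite mem_hat_simplex// => ->.
Qed.

End SpinalToStar.

End RadialPosition.
End Spine.

(** * Spines and spinal triangulations *)

Section SpinesAndTriangulations.
Context {R : realType} {d : nat}.
Implicit Types (V U s t : {fset 'rV[R]_d}) (T : {fset {fset 'rV[R]_d}}).

Lemma hull_tight V (a : 'rV[R]_d) b x : valid V a b -> convex_hull [set` V] x ->
  dot a x = b -> convex_hull [set` tight V a b] x.
Proof.
move=> ab /convex_hullP[c [c0 cs c1 xE]] ax.
apply/(convex_hull_subP _ (tight_sub V a b)); exists c; split => // v vt.
have [vV|/cs//] := boolP (v \in V); apply/eqP; apply: contraNT vt => cv.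
apply/tightP; split => //.
by apply: (valid_hull_tight ab _ c1) => //; rewrite -xE.
Qed.

(* Finitely many simplices with at most d-1 vertices on a facet do not cover it. *)
Lemma spinal_spine V U T : (0 < d)%N -> full_dimensional V -> (U `<=` V)%fset ->
  spinal_triangulation V U T -> spine V U.
Proof.
move=> d0 VF UV [tri spi]; split => // F [[a [b [ab FE]]] Fd].
have [[TI TC TX] Tc Tcov] := tri.
have abV : valid V a b by move=> v vV; apply: ab; exact: convex_hull_point.
have abs s : s \in T -> valid s a b.
  by move=> sT v vs; apply: abV; exact: (fsubsetP (triangulation_sub tri sT)).
have rF : (d <= \rank (hmx (tight V a b)))%N.
  apply: (@leq_trans d.-1.+1); first by rewrite prednK.
  apply: (has_dim_leq_rank Fd) => x.
  rewrite FE => -[xP /= ax]; have /convex_hullP[c [_ _ c1 ->]] := hull_tight abV xP ax.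
  by apply/affine_hullP; exists c.
(* Otherwise no tight part of a simplex spans all tight vertices, and a generic point of their hull
   lies in none of these parts although it is covered. *)
have [s sT ds] : exists2 s, s \in T & (d <= #|` tight s a b|)%N.
  have [//|ns] := pselect (exists2 s, s \in T & (d <= #|` tight s a b|)%N).
  exfalso.
  have [|t|z zt zL] := @generic_point R d (tight V a b)
      [seq tight s a b | s <- enum_fset T].
  - apply/eqP => t0; have := leq_trans rF (rank_leq_row _).
    by rewrite t0 cardfs0 leqNgt d0.
  - move=> /mapP[s sT ->].
    have [//|nv] := pselect (exists2 v, v \in tight V a b &
      ~~ (homog v <= hmx (tight s a b))%MS).
    exfalso; apply: ns; exists s => //; apply: leq_trans rF _.
    apply: leq_trans (rank_leq_row (hmx (tight s a b))); apply: mxrankS.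
    by apply: hmx_sub => v vt; apply/negPn/negP => h; apply: nv; exists v.
  have zP : convex_hull [set` V] z by apply: convex_hullS zt; exact: tight_sub.
  have az : dot a z = b.
    move: zt => /convex_hullP[c [_ _ c1 ->]]; apply/eqP.
    rewrite eq_sym -subr_eq0 slack_comb// big_seq big1// => v /tightP[_ ->].
    by rewrite subrr mulr0.
  move: zP; rewrite -Tcov => -[s /= sT /(hull_tight (abs s sT))/(_ az)].
  have [|a' [b' [h1 /eqP h2]]] := zL (tight s a b).
    by apply/mapP; exists s.
  move=> /convex_hullP[c [_ _ c1 zE]]; apply: h2; rewrite zE; apply/eqP.
  rewrite eq_sym -subr_eq0 slack_comb// big_seq big1// => v /h1 ->.
  by rewrite subrr mulr0.
have [s' sm ss'] := maximal_above sT; have [s'T _] := maximalP _ _ sm.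
have Us' := spi s' sm.
have s'd : (#|` s'| <= d.+1)%N.
  have rV : \rank (hmx V) = d.+1 by rewrite ((full_dimensionalP V).1 VF) addn1.
  by apply: independent_card (TI _ s'T) (triangulation_sub tri s'T) rV.
have ts' : (d <= #|` tight s' a b|)%N.
  apply: leq_trans ds _; apply: fsubset_leq_card; apply/fsubsetP => v.
  by move=> /tightP[vs av]; apply/tightP; split => //; exact: (fsubsetP ss').
have FU : tight U a b = [fset u in U | `[< F u >]]%fset.
  apply/fsetP => u; apply/tightP/idP => [[uU au]|].
    rewrite !inE/= uU/=; apply/asboolP; rewrite FE; split => //.
    by apply: convex_hull_point; exact: (fsubsetP UV).
  by rewrite !inE/= => /andP[uU /asboolP]; rewrite FE => -[].
rewrite -FU -(cardfsID (tight U a b) U).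
have -> : (U `&` tight U a b)%fset = tight U a b.
  by apply/fsetIidPr; exact: tight_sub.
rewrite -[X in (_ <= X)%N]addn1 leq_add2l.
(* The simplex [s'] contains [U] and has at most [d.+1] vertices, at least d of which lie on the
   facet. *)
apply: (@leq_trans #|` (s' `\` tight s' a b)%fset|).
  apply: fsubset_leq_card; apply/fsubsetP => u; rewrite !in_fsetD => /andP[ut uU].
  rewrite (fsubsetP Us')// andbT; apply: contra ut => /tightP[_ au].
  by apply/tightP.
rewrite cardfsD; have -> : (s' `&` tight s' a b)%fset = tight s' a b.
  by apply/fsetIidPr; exact: tight_sub.
by rewrite leq_subLR [X in (_ <= X)%N]addn1; apply: leq_trans s'd _; rewrite ltnS.
Qed.

Lemma spine_spinal V U : (0 < d)%N -> full_dimensional V -> convex_position V ->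
  spine V U -> exists T, spinal_triangulation V U T.
Proof.
move=> d0 VF VC.
have ne U' u1 : spine V U' -> u1 \in U' -> exists T, spinal_triangulation V U' T.
  move=> SU uU; have UV := SU.1.
  have UI := spine_independent d0 VF VC SU.
  have [S Sst] := star_exists d0 VF UV UI uU VC SU.
  exists (lift_complex V U' u1 S).
  exact: (lift_spinal d0 VF UV UI uU VC SU Sst).
have [->|/fset0Pn[u uU] SU] := eqVneq U fset0; last exact: ne SU uU.
move=> _; have [v vV _] := another_vertex 0 d0 VF.
(* For one point the count in the definition of a spine is trivial, and the resulting triangulation
   is spinal for the empty set. *)
have Sv : spine V [fset v]%fset.
  split; first by rewrite fsub1set.
  by move=> F _; rewrite cardfs1.
have [T [tri _]] := ne _ v Sv (fset11 v).
by exists T; split => // s _; exact: fsub0set.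
Qed.

Lemma spinal_lift_iff V U u1 T : (0 < d)%N -> full_dimensional V ->
  convex_position V -> spine V U -> u1 \in U ->
  spinal_triangulation V U T <->
    exists2 S, star_triangulation (codim U) [fset Phi U u1 v | v in V]%fset S
             & T = lift_complex V U u1 S.
Proof.
move=> d0 VF VC SU uU; have UV := SU.1.
have UI := spine_independent d0 VF VC SU.
split=> [[tri spi]|[S Sst ->]].
  exists (hat_complex U u1 T).
    exact: (hat_complex_star d0 VF UV UI uU VC SU tri spi).
  exact: (lift_hat_complex d0 VF UV UI uU VC SU tri spi).
exact: (lift_spinal d0 VF UV UI uU VC SU Sst).
Qed.

End SpinesAndTriangulations.

(** * Lebesgue measure on row vectors *)

Section Pushforward.
Context d1 d2 (X : measurableType d1) (Y : measurableType d2) (R : realType).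
Variable m : {sigma_finite_measure set X -> \bar R}.
Variables (f : X -> Y) (g : Y -> X).
Hypotheses (mf : measurable_fun setT f) (mg : measurable_fun setT g).
Hypothesis fK : cancel f g.

(** The proofs are carried as arguments so that the measure structures attached below can refer to
    them. The left inverse [g] transports a sigma-finite cover. *)
Definition image_measure of measurable_fun setT f & measurable_fun setT g & cancel f g : set Y -> \bar R := pushforward m f.

Let image0 : image_measure mf mg fK set0 = 0%E.
Proof. by rewrite /image_measure /pushforward preimage_set0 measure0. Qed.

Let image_ge0 A : (0 <= image_measure mf mg fK A)%E.
Proof. exact: measure_ge0. Qed.

Let image_sigma_additive : semi_sigma_additive (image_measure mf mg fK).
Proof. exact: (@measure_semi_sigma_additive _ _ _ (pushforward m f)). Qed.

HB.instance Definition _ := isMeasure.Build _ _ _ (image_measure mf mg fK)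
  image0 image_ge0 image_sigma_additive.

Let image_sigma_finite : sigma_finite setT (image_measure mf mg fK).
Proof.
have [F FT mF] := sigma_finiteT m.
exists (fun i => g @^-1` F i).
  by rewrite -preimage_bigcup -FT preimage_setT.
move=> i; have [mFi Fi] := mF i; split.
  by rewrite -[X in measurable X]setTI; exact: mg.
rewrite /image_measure /pushforward -comp_preimage.
by rewrite (_ : g \o f = id)//; apply/funext => x /=.
Qed.

HB.instance Definition _ := Measure_isSigmaFinite.Build _ _ _
  (image_measure mf mg fK) image_sigma_finite.

End Pushforward.

(* The library's canonical sigma-finite structure on [m1 \x m2] is only found for
   subprobabilities. *)
Section SigmaFiniteProduct.
Context d1 d2 (X : measurableType d1) (Y : measurableType d2) (R : realType).
Variable m1 : {sigma_finite_measure set X -> \bar R}.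
Variable m2 : {sigma_finite_measure set Y -> \bar R}.

Definition sf_product : set (X * Y) -> \bar R := (m1 \x m2)%E.

HB.instance Definition _ := Measure.on sf_product.

Let sf_product_sigma_finite : sigma_finite setT sf_product.
Proof.
have /sigma_finiteP[F [FT Fnd Ffin]] := sigma_finiteT m1.
have /sigma_finiteP[G [GT Gnd Gfin]] := sigma_finiteT m2.
exists (fun i => F i `*` G i) => [|i].
  apply/esym/seteqP; split => // -[x y] _.
  have [i _ Fx] : (\bigcup_i F i) x by rewrite -FT.
  have [j _ Gy] : (\bigcup_j G j) y by rewrite -GT.
  exists (i + j)%N => //; split => /=.
    exact: (subsetPset _ _ (Fnd _ _ (leq_addr j i))).
  exact: (subsetPset _ _ (Gnd _ _ (leq_addl i j))).
have [mF oF] := Ffin i; have [mG oG] := Gfin i.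
split; first exact: measurableX.
by rewrite /sf_product product_measure1E// lte_mul_pinfty// ge0_fin_numE.
Qed.

HB.instance Definition _ := Measure_isSigmaFinite.Build _ _ _ sf_product
  sf_product_sigma_finite.

Lemma sf_productE A : measurable A -> sf_product A = (\int[m1]_x m2 (xsection A x))%E.
Proof. by []. Qed.

Lemma sf_product_ysection A : measurable A ->
  sf_product A = (\int[m2]_y m1 (ysection A y))%E.
Proof.
move=> mA; rewrite /sf_product /product_measure1.
have := indic_fubini_tonelli m1 m2 mA.
by rewrite indic_fubini_tonelli_FE// (indic_fubini_tonelli_GE m1 mA).
Qed.

End SigmaFiniteProduct.

Lemma lebesgue_tuple_measure (R : realType) n :
  exists m : {sigma_finite_measure set (n.-tuple (measurableTypeR R)) -> \bar R},
    forall A, lebesgue_tuple A = m A.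
Proof.
elim: n => [|n [m mE]].
  by exists (\d_([tuple])).
pose f (z : measurableTypeR R * n.-tuple (measurableTypeR R)) :
  n.+1.-tuple (measurableTypeR R) := [tuple of z.1 :: z.2].
pose g (t : n.+1.-tuple (measurableTypeR R)) := (thead t, [tuple of behead t]).
have mf : measurable_fun setT f by exact: measurable_cons.
have mg : measurable_fun setT g.
  apply/measurable_fun_pair => /=; last exact: measurable_behead.
  exact: measurable_tnth.
have fK : cancel f g.
  move=> [x t]; rewrite /g /f /=; congr (_, _).
  by apply: val_inj.
exists (image_measure (sf_product (@lebesgue_measure R) m) mf mg fK) => A.
rewrite /= /image_measure /pushforward /sf_product /product_measure1.
by apply: eq_integral => x _ /=; rewrite mE.
Qed.

(** * Translation invariance and uniqueness of Lebesgue measure *)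

Section LebesgueTuple.
Context {R : realType}.
Local Notation mR := (measurableTypeR R).
Local Notation T n := (n.-tuple (measurableTypeR R)).
Implicit Types n : nat.

(** The set function [lebesgue_tuple] bundled as a sigma-finite measure, so that Tonelli's theorem
    applies to it. *)
Definition leb n : {sigma_finite_measure set (T n) -> \bar R} :=
  projT1 (cid (lebesgue_tuple_measure R n)).

Lemma lebE n (A : set (T n)) : lebesgue_tuple A = leb n A.
Proof. exact: (projT2 (cid (lebesgue_tuple_measure R n))). Qed.

Lemma leb_cons n (A : set (T n.+1)) :
  leb n.+1 A = (\int[@lebesgue_measure R]_x leb n [set t : T n | A [tuple of x :: t]])%E.
Proof.
rewrite -lebE /= /product_measure1; apply: eq_integral => x _ /=.
rewrite lebE; congr (leb n _); apply/seteqP; split => t.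
  by rewrite /xsection /= inE.
by rewrite /xsection /= inE.
Qed.

Lemma measurable_tcons n (A : set (T n.+1)) x : measurable A ->
  measurable [set t : T n | A [tuple of x :: t]].
Proof.
move=> mA; have mf : measurable_fun [set: T n] (fun t => [tuple of x :: t] : T n.+1).
  by apply: measurable_cons.
by rewrite -[X in measurable X]setTI; exact: mf.
Qed.

Lemma measurable_fun_leb_cons n (A : set (T n.+1)) : measurable A ->
  measurable_fun [set: mR] (fun x => leb n [set t : T n | A [tuple of x :: t]]).
Proof.
move=> mA; pose f (z : mR * T n) : T n.+1 := [tuple of z.1 :: z.2].
have mf : measurable_fun setT f by exact: measurable_cons.
have mB : measurable (f @^-1` A) by rewrite -[X in measurable X]setTI; exact: mf.
have := @measurable_fun_xsection _ _ _ _ R (leb n) _ mB.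
congr (measurable_fun _ _); apply/funext => x /=; congr (leb n _).
by apply/seteqP; split => t; rewrite /xsection /= inE.
Qed.

Definition tadd n (x y : T n) : T n := [tuple tnth x i + tnth y i | i < n].
Definition topp n (x : T n) : T n := [tuple - tnth x i | i < n].

Lemma taddC n (x y : T n) : tadd x y = tadd y x.
Proof. by apply: eq_from_tnth => i; rewrite !tnth_mktuple addrC. Qed.

Lemma taddNK n (x y : T n) : tadd (tadd x (topp y)) y = x.
Proof. by apply: eq_from_tnth => i; rewrite !tnth_mktuple subrK. Qed.

Lemma toppB n (x y : T n) : topp (tadd x (topp y)) = tadd y (topp x).
Proof. by apply: eq_from_tnth => i; rewrite !tnth_mktuple opprB. Qed.

Lemma measurable_fun_tnth_coord d (X : measurableType d) n (f : X -> T n) :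
  (forall i, measurable_fun setT (fun x => tnth (f x) i : mR)) ->
  measurable_fun setT f.
Proof. by move=> h; apply/measurable_fun_tnthP => i; exact: h. Qed.

Lemma measurable_coord d (X : measurableType d) n (f : X -> T n) i :
  measurable_fun setT f -> measurable_fun setT (fun x => tnth (f x) i : mR).
Proof. by move=> mf; exact: measurableT_comp (measurable_tnth i) mf. Qed.

Lemma measurable_tadd d (X : measurableType d) n (f g : X -> T n) :
  measurable_fun setT f -> measurable_fun setT g ->
  measurable_fun setT (fun x => tadd (f x) (g x)).
Proof.
move=> mf mg; apply: measurable_fun_tnth_coord => i.
under eq_fun do rewrite tnth_mktuple.
by apply: measurable_funD; exact: measurable_coord.
Qed.

Lemma measurable_topp d (X : measurableType d) n (f : X -> T n) :
  measurable_fun setT f -> measurable_fun setT (fun x => topp (f x)).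
Proof.
move=> mf; apply: measurable_fun_tnth_coord => i.
under eq_fun do rewrite tnth_mktuple.
exact: measurableT_comp (measurable_coord i mf).
Qed.

Lemma lebesgue_measure_shift (A : set mR) (w : R) : measurable A ->
  lebesgue_measure ((fun x => x + w) @^-1` A) = lebesgue_measure A.
Proof.
have mf : measurable_fun [set: mR] (fun x : mR => x + w : mR).
  by apply: measurable_funD.
move=> mA; rewrite -/(pushforward lebesgue_measure (fun x : mR => x + w : mR) A).
apply/esym; apply: (@lebesgue_measure_unique R (pushforward lebesgue_measure (fun x : mR => x + w : mR))) => //= _ [[a b]] _ <-.
rewrite /pushforward.
have -> : (fun x : mR => x + w) @^-1` `]a, b]%classic = `]a - w, b - w]%classic.
  apply/seteqP; split => x /=; rewrite !in_itv/= => /andP[h1 h2].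
    by rewrite ltrBlDr h1 lerBrDr.
  by rewrite -ltrBlDr h1 -lerBrDr.
rewrite !lebesgue_measure_itv/= !lte_fin ltrD2r.
by case: ifP => // _; rewrite -!EFinB opprD addrACA opprK addNr addr0.
Qed.

Lemma integral_shift (f : R -> \bar R) (w : R) : measurable_fun [set: mR] f ->
  (forall x, 0 <= f x)%E ->
  (\int[@lebesgue_measure R]_x f ((x : R) + w)%R)%E = (\int[@lebesgue_measure R]_x f x)%E.
Proof.
move=> mf f0.
have ms : measurable_fun [set: mR] (fun x : mR => x + w : mR).
  by apply: measurable_funD.
have := @ge0_integral_pushforward _ _ _ _ R (fun x : mR => x + w : mR) ms
  lebesgue_measure setT f measurableT mf.
rewrite preimage_setT /= => <- //.
by apply: eq_measure_integral => A mA _; exact: lebesgue_measure_shift.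
Qed.

Lemma leb_shift n (A : set (T n)) (w : T n) : measurable A ->
  leb n ((fun t => tadd t w) @^-1` A) = leb n A.
Proof.
elim: n A w => [|n IH] A w mA.
  by congr (leb 0 _); apply/seteqP; split => t /=; rewrite (tuple0 t) (tuple0 (tadd _ _)).
rewrite !leb_cons.
pose g x := leb n [set t : T n | A [tuple of x :: t]].
transitivity (\int[@lebesgue_measure R]_x g ((x : R) + (thead w : R))%R)%E; last first.
  by apply: integral_shift => //; exact: measurable_fun_leb_cons.
apply: eq_integral => x _; rewrite /g -[in RHS](IH _ [tuple of behead w]); last first.
  exact: measurable_tcons.
congr (leb n _).
have E (t : T n) : tadd [tuple of x :: t] w =
    [tuple of ((x : R) + (thead w : R) : mR) :: tadd t [tuple of behead w]] :> T n.+1.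
  apply: eq_from_tnth => i; rewrite tnth_mktuple.
  case: (unliftP ord0 i) => [j ->|->].
    by rewrite !tnthS tnth_mktuple tnth_behead (_ : inord j.+1 = lift ord0 j)//;
      apply: val_inj; rewrite /= inordK// ltnS.
  by rewrite !tnth0.
by apply/seteqP; split => t /=; rewrite E.
Qed.

(* Both sides are the (nu x leb)-measure of {(x, y) | x in A, x + y in B},
   up to the shear (x, y) |-> (x + y, y). *)
Lemma translation_invariant_unique n (nu : {sigma_finite_measure set (T n) -> \bar R})
    (A B : set (T n)) :
  (forall C w, measurable C -> nu ((fun t => tadd t w) @^-1` C) = nu C) ->
  measurable A -> measurable B -> (forall t, A t -> A (topp t)) ->
  (nu A * leb n B = nu B * leb n A)%E.
Proof.
move=> nuT mA mB As.
have mC (E F : set (T n)) (f : T n * T n -> T n) (g : T n * T n -> T n) :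
    measurable_fun setT f -> measurable_fun setT g -> measurable E -> measurable F ->
    measurable (f @^-1` E `&` g @^-1` F).
  move=> mf mg mE mF; apply: measurableI.
    by rewrite -[X in measurable X]setTI; exact: mf.
  by rewrite -[X in measurable X]setTI; exact: mg.
have msub : measurable_fun [set: T n * T n] (fun z => tadd z.1 (topp z.2)).
  by apply: measurable_tadd => //; exact: measurable_topp.
pose S := fst @^-1` A `&` (fun z : T n * T n => tadd z.1 z.2) @^-1` B.
pose S' := (fun z : T n * T n => tadd z.1 (topp z.2)) @^-1` A `&` fst @^-1` B.
have mS : measurable S by apply: mC => //; exact: (measurable_tadd measurable_fst measurable_snd).
have mS' : measurable S' by exact: mC.
have E : sf_product nu (leb n) S = sf_product nu (leb n) S'.
  rewrite !sf_product_ysection//; apply: eq_integral => y _.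
  rewrite -[in LHS](nuT _ (topp y)); last exact: measurable_ysection.
  congr (nu _); apply/seteqP; split => x /=; rewrite /ysection /= !inE /S /S' /=.
    by rewrite taddNK.
  by rewrite taddNK.
(* The nonempty sections of [S] are translates of [B]. Those of [S'] are translates of the
   reflection of [A], which is [A] by symmetry. *)
have cstI (C D : set (T n)) (F : set (T n * T n)) : measurable C ->
    (forall x, C x -> leb n (xsection F x) = leb n D) ->
    (forall x, ~ C x -> xsection F x = set0) -> measurable F ->
    sf_product nu (leb n) F = (nu C * leb n D)%E.
  move=> mC' h1 h2 mF; rewrite sf_productE//.
  transitivity (\int[nu]_x (leb n D * (\1_C x)%:E))%E.
    apply: eq_integral => x _; rewrite indicE; have [Cx|Cx] := pselect (C x).
      by rewrite mem_set// h1// mule1.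
    by rewrite memNset// h2// measure0 mule0.
  rewrite ge0_integralZl//; first by rewrite integral_indic// setIT muleC.
  exact/measurable_EFinP/measurable_indic.
rewrite -(cstI A B S)//.
- rewrite E -(cstI B A S')// => x Bx.
    rewrite -[in RHS](leb_shift (topp x))//; congr (leb n _).
    apply/seteqP; split => y; rewrite /xsection /= inE /S' /=.
      by move=> [/As + _]; rewrite toppB.
    by move=> /As; rewrite toppB.
  by apply/seteqP; split => y //; rewrite /xsection /= inE /S' /= => -[].
- move=> x Ax; rewrite -[in RHS](leb_shift x)//; congr (leb n _).
  apply/seteqP; split => y; rewrite /xsection /= inE /S /=.
    by move=> [_]; rewrite taddC.
  by rewrite taddC.
- move=> x Ax; apply/seteqP; split => y //; rewrite /xsection /= inE /S /=.
  by move=> [].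
Qed.

End LebesgueTuple.

(** * Scaling and orthogonal maps *)

Section LebesgueRow.
Context {R : realType}.
Local Notation mR := (measurableTypeR R).
Local Notation T n := (n.-tuple (measurableTypeR R)).
Implicit Types n : nat.

Definition rowt n (t : T n) : 'rV[R]_n := \row_i tnth t i.
Definition tupr n (v : 'rV[R]_n) : T n := [tuple (v 0 i : mR) | i < n].

Lemma rowtK n : cancel (@rowt n) (@tupr n).
Proof. by move=> t; apply: eq_from_tnth => i; rewrite tnth_mktuple mxE. Qed.

Lemma tuprK n : cancel (@tupr n) (@rowt n).
Proof. by move=> v; apply/rowP => i; rewrite mxE tnth_mktuple. Qed.

Lemma rowtD n (x y : T n) : rowt (tadd x y) = rowt x + rowt y.
Proof. by apply/rowP => i; rewrite !mxE tnth_mktuple. Qed.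

Lemma rowtN n (x : T n) : rowt (topp x) = - rowt x.
Proof. by apply/rowP => i; rewrite !mxE tnth_mktuple. Qed.

Lemma tuprD n (x y : 'rV[R]_n) : tupr (x + y) = tadd (tupr x) (tupr y).
Proof. by apply: eq_from_tnth => i; rewrite !tnth_mktuple mxE. Qed.

Lemma measurable_linear d (X : measurableType d) n (f : X -> T n) m (M : 'M[R]_(n, m)) i :
  measurable_fun setT f ->
  measurable_fun setT (fun x => ((rowt (f x) *m M) 0 i : mR)).
Proof.
move=> mf; under eq_fun do rewrite mxE.
apply: measurable_sum => j; under eq_fun do rewrite mxE.
by apply: measurable_funM => //; exact: measurable_coord.
Qed.

Lemma measurable_affine n m (M : 'M[R]_(n, m)) (w : 'rV[R]_m) :
  measurable_fun [set: T n] (fun t => tupr (rowt t *m M + w)).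
Proof.
apply: measurable_fun_tnth_coord => i.
under eq_fun do rewrite tnth_mktuple mxE.
by apply: measurable_funD => //; exact: measurable_linear.
Qed.

Lemma leb_fin_cancel (a : R) (x y : \bar R) : 0 < a ->
  (a%:E * x = y * a%:E)%E -> x = y.
Proof.
move=> a0 E; have : (a^-1%:E * (a%:E * x) = a^-1%:E * (y * a%:E))%E by rewrite E.
by rewrite muleA -EFinM mulVf ?gt_eqF// mul1e [(y * _)%E]muleC muleA -EFinM mulVf ?gt_eqF// mul1e.
Qed.

Definition cube n (r : R) : set (T n) := [set t | forall i, `|tnth t i : R| <= r].

Arguments cube : clear implicits.

Lemma measurable_cube n r : measurable (cube n r).
Proof.
have -> : cube n r = \bigcap_(i in [set: 'I_n]) [set t | `|tnth t i : R| <= r].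
  by apply/seteqP; split => t /= h i; [move=> _|]; exact: h.
apply: fin_bigcap_measurable => // i _.
have mf : measurable_fun [set: T n] (fun t => `|tnth t i : R| : mR).
  by apply: measurableT_comp => //; exact: measurable_tnth.
have := mf measurableT `]-oo, r]%classic (measurable_itv _).
by rewrite setTI; congr measurable; apply/seteqP; split => t /=; rewrite in_itv.
Qed.

Lemma leb_cube n r : 0 <= r -> leb n (cube n r) = ((2 * r) ^+ n)%:E.
Proof.
move=> r0; elim: n => [|n IH].
  rewrite expr0 -lebE /= diracE mem_set// => -[//].
rewrite leb_cons.
transitivity (\int[@lebesgue_measure R]_x (((2 * r) ^+ n)%:E *
    (\1_(`[- r, r]%classic : set mR) x)%:E))%E.
  apply: eq_integral => x _; rewrite indicE.
  have [xr|xr] := boolP (x \in (`[- r, r]%classic : set mR)).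
    rewrite mule1 -IH; congr (leb n _); apply/seteqP; split => t /= h.
      by move=> i; have := h (lift ord0 i); rewrite tnthS.
    move=> i; case: (unliftP ord0 i) => [j ->|->]; first by rewrite tnthS.
    by move: xr; rewrite inE /= in_itv /= tnth0 ler_norml.
  rewrite mule0 [X in leb n X](_ : _ = set0) ?measure0//.
  apply/seteqP; split => t //= /(_ ord0); rewrite tnth0 ler_norml => h.
  by move: xr; rewrite notin_setE /= in_itv /= => /negP; rewrite h.
rewrite ge0_integralZl//; last 2 first.
  by apply/measurable_EFinP/measurable_indic.
  by rewrite lee_fin exprn_ge0// mulr_ge0.
rewrite integral_indic// setIT.
rewrite /= lebesgue_measure_itv/= lte_fin.
case: ifPn => h; first by rewrite -EFinD -EFinM exprSr opprK; congr (_ * _)%:E; ring.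
have -> : r = 0.
  by apply/eqP; rewrite eq_le r0 andbT; move: h; rewrite -leNgt; lra.
by rewrite mule0 mulr0 expr0n.
Qed.

(** The image of the measure under a homothety is translation invariant, hence proportional to the
    measure; the unit cube gives the factor. *)
Lemma leb_scale n (B : set (T n)) (r : R) : 0 < r -> measurable B ->
  (leb n [set t | B (tupr (r *: rowt t))] * (r ^+ n)%:E = leb n B)%E.
Proof.
move=> r0 mB; pose f s (t : T n) : T n := tupr (s *: rowt t).
have mf s : measurable_fun setT (f s).
  have := @measurable_affine n n (s%:M) 0.
  congr (measurable_fun _ _); apply/funext => t.
  by rewrite /f addr0 mul_mx_scalar.
have fK s : s != 0 -> cancel (f s) (f s^-1).
  by move=> s0 t; rewrite /f tuprK scalerA mulVf// scale1r rowtK.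
pose nu : {sigma_finite_measure set (T n) -> \bar R} := image_measure (leb n) (mf r) (mf r^-1) (fK r (lt0r_neq0 r0)).
have nuE C : nu C = leb n (f r @^-1` C) by [].
have H := @translation_invariant_unique R n nu (cube n 1) B.
have {}H : (nu (cube n 1) * leb n B = nu B * leb n (cube n 1))%E.
  apply: H => // [C w mC||].
  - rewrite !nuE -(@leb_shift R n (f r @^-1` C) (f r^-1 w)).
      congr (leb n _); apply/seteqP; split => t /=; rewrite /f.
        by rewrite rowtD tuprK scalerDr scalerA divff ?gt_eqF// scale1r tuprD rowtK.
      by rewrite rowtD tuprK scalerDr scalerA divff ?gt_eqF// scale1r tuprD rowtK.
    by rewrite -[X in measurable X]setTI; exact: (mf r).
  - exact: measurable_cube.
  - by move=> t h i; rewrite tnth_mktuple normrN.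
have cE : f r @^-1` cube n 1 = cube n r^-1.
  apply/seteqP; split => t /= h i; have := h i; rewrite tnth_mktuple !mxE normrM gtr0_norm//.
    by rewrite -ler_pdivlMl// mulr1.
  by move=> _; rewrite -ler_pdivlMl// mulr1; exact: h.
move: H; rewrite nuE cE !leb_cube ?invr_ge0 ?ltW// => H.
apply/esym; apply: (@leb_fin_cancel ((2 / r) ^+ n)); first by rewrite exprn_gt0// divr_gt0.
rewrite H -/(f r) mulr1 -muleA -EFinM -exprMn; congr (_ * (_ ^+ _)%:E)%E.
by rewrite mulrCA divff ?mulr1// gt_eqF.
Qed.

(** The image measure is again proportional to [leb n]. The unit ball [A] is invariant under [Q], so
    the factor is 1 once the ball is known to have finite positive measure, for which it is compared
    with two cubes. *)
Lemma leb_orthogonal n (B : set (T n)) (Q : 'M[R]_n) : Q *m Q^T = 1%:M ->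
  measurable B -> leb n [set t | B (tupr (rowt t *m Q))] = leb n B.
Proof.
move=> QQ mB; pose f (M : 'M[R]_n) (t : T n) : T n := tupr (rowt t *m M).
have mf M : measurable_fun setT (f M).
  have := @measurable_affine n n M 0.
  by congr (measurable_fun _ _); apply/funext => t; rewrite /f addr0.
have fK : cancel (f Q) (f Q^T).
  by move=> t; rewrite /f tuprK -mulmxA QQ mulmx1 rowtK.
have QQ' := mulmx1C QQ.
pose nu : {sigma_finite_measure set (T n) -> \bar R} := image_measure (leb n) (mf Q) (mf Q^T) fK.
have nuE C : nu C = leb n (f Q @^-1` C) by [].
pose A : set (T n) := [set t | (rowt t *m (rowt t)^T) 0 0 <= 1].
have AE (t : T n) : (rowt t *m (rowt t)^T) 0 0 = \sum_i (tnth t i : R) ^+ 2.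
  by rewrite mxE; apply: eq_bigr => i _; rewrite !mxE expr2.
have mA : measurable A.
  have ms : measurable_fun [set: T n] (fun t => \sum_i (tnth t i : R) ^+ 2 : mR).
    apply: measurable_sum => i; apply: measurable_funX.
    exact: measurable_tnth.
  have := ms measurableT `]-oo, 1]%classic (measurable_itv _).
  rewrite setTI; congr measurable; apply/seteqP; split => t /=; rewrite in_itv/= /A /= AE//.
have H := @translation_invariant_unique R n nu A B.
have {}H : (nu A * leb n B = nu B * leb n A)%E.
  apply: H => // [C w mC|t].
  - rewrite !nuE -(@leb_shift R n (f Q @^-1` C) (f Q^T w)).
      congr (leb n _); apply/seteqP; split => t /=; rewrite /f.
        by rewrite rowtD tuprK mulmxDl -mulmxA QQ' mulmx1 tuprD rowtK.
      by rewrite rowtD tuprK mulmxDl -mulmxA QQ' mulmx1 tuprD rowtK.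
    by rewrite -[X in measurable X]setTI; exact: (mf Q).
  - by rewrite /A /= rowtN linearN /= mulNmx mulmxN opprK.
have nA : nu A = leb n A.
  have E t : rowt t *m Q *m (rowt t *m Q)^T = rowt t *m (rowt t)^T.
    by rewrite trmx_mul mulmxA -(mulmxA (rowt t)) QQ mulmx1.
  by rewrite nuE; congr (leb n _); apply/seteqP; split => t /=; rewrite /f /A /= tuprK E.
have Afin : (leb n A <= leb n (cube n 1))%E.
  apply: le_measure; rewrite ?inE//; first exact: measurable_cube.
  move=> t; rewrite /A /= AE => h i; rewrite leNgt; apply/negP => ti.
  move: h; apply/negP; rewrite -ltNge (bigD1 i)//= ltr_wpDr//.
    by apply: sumr_ge0 => j _; exact: sqr_ge0.
  by rewrite -real_normK ?num_real// exprn_egt1.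
(* With sides governed by [n.+1] instead of [n], the bound on the sum of squares holds and dimension
   0 needs no separate treatment. *)
have Apos : (leb n (cube n n.+1%:R^-1) <= leb n A)%E.
  apply: le_measure; rewrite ?inE//; first exact: measurable_cube.
  move=> t h; rewrite /A /= AE.
  apply: (@le_trans _ _ (\sum_(i < n) n.+1%:R^-1)).
    apply: ler_sum => i _; rewrite -real_normK ?num_real//.
    apply: le_trans (h i); rewrite expr2 ler_piMr//.
    by apply: le_trans (h i) _; rewrite invf_le1// ler1n.
  by rewrite sumr_const card_ord -[leLHS]mulr_natl ler_pdivrMr// mul1r ler_nat.
have Afn : leb n A \is a fin_num.
  rewrite ge0_fin_numE//; apply: le_lt_trans Afin _.
  by rewrite leb_cube// ltry.
have a0 : 0 < fine (leb n A).
  rewrite -lte_fin fineK//; apply: lt_le_trans Apos.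
  by rewrite leb_cube ?invr_ge0// lte_fin exprn_gt0// mulr_gt0// invr_gt0.
move: H; rewrite nA -(fineK Afn) => /(leb_fin_cancel a0) ->.
by rewrite nuE.
Qed.

End LebesgueRow.

(** * Fubini for row vectors and measurability of polytopes *)

Section LebesgueSplit.
Context {R : realType}.
Local Notation mR := (measurableTypeR R).
Local Notation T n := (n.-tuple (measurableTypeR R)).
Implicit Types n k e : nat.

Definition lpart k e (t : T (k + e)) : T k := [tuple tnth t (lshift e i) | i < k].
Definition rpart k e (t : T (k + e)) : T e := [tuple tnth t (rshift k i) | i < e].

Lemma leb_rectangle k e (A : set (T k)) (B : set (T e)) :
  measurable A -> measurable B ->
  leb (k + e) [set t | A (lpart t) /\ B (rpart t)] = (leb k A * leb e B)%E.
Proof.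
move=> + mB; elim: k A => [|k IH] A mA.
  have rE (t : T (0 + e)) : rpart t = t.
    apply: eq_from_tnth => i; rewrite tnth_mktuple; congr (tnth t _).
    exact: val_inj.
  have lE (t : T (0 + e)) : lpart t = [tuple] by rewrite (tuple0 (lpart t)).
  rewrite -[leb 0 A]lebE /= diracE.
  have [A0|A0] := pselect (A [tuple]).
    rewrite mem_set// mul1e; congr (leb e _); apply/seteqP.
    by split => t /=; rewrite ?rE ?lE// => -[].
  rewrite memNset// mul0e [X in leb _ X](_ : _ = set0) ?measure0//.
  by apply/seteqP; split => t //=; rewrite lE => -[].
rewrite [in RHS]leb_cons [LHS](@leb_cons R (k + e)) -ge0_integralZr//; last exact: measurable_fun_leb_cons.
apply: eq_integral => x _; rewrite -IH; last exact: measurable_tcons.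
congr (leb (k + e) _).
have lE (t : T (k + e)) : lpart (k := k.+1) [tuple of x :: t] = [tuple of x :: lpart t].
  apply: eq_from_tnth => i; rewrite tnth_mktuple.
  case: (unliftP ord0 i) => [j ->|->].
    rewrite tnthS tnth_mktuple -[RHS](tnthS x t); congr (tnth _ _); exact: val_inj.
  by rewrite tnth0 (_ : lshift e ord0 = ord0) ?tnth0//; exact: val_inj.
have rE (t : T (k + e)) : rpart (k := k.+1) [tuple of x :: t] = rpart t.
  apply: eq_from_tnth => i; rewrite !tnth_mktuple -[RHS](tnthS x t).
  by congr (tnth _ _); exact: val_inj.
by apply/seteqP; split => t /=; rewrite lE rE.
Qed.

(** Measurability of a set of row vectors is expressed in tuple coordinates, where [leb] lives. *)
Definition msetr n (X : set 'rV[R]_n) := measurable [set t : T n | X (rowt t)].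

Lemma lebesgue_rVE n (X : set 'rV[R]_n) : lebesgue_rV X = leb n [set t | X (rowt t)].
Proof. exact: lebE. Qed.

Lemma msetr_affine n m (X : set 'rV[R]_m) (M : 'M[R]_(n, m)) w : msetr X ->
  msetr [set x | X (x *m M + w)].
Proof.
move=> mX; have := measurable_affine M w measurableT mX.
rewrite setTI; congr measurable; apply/seteqP; split => t /=; by rewrite tuprK.
Qed.

Lemma lebesgue_rV_shift n (X : set 'rV[R]_n) w : msetr X ->
  lebesgue_rV [set x | X (x + w)] = lebesgue_rV X.
Proof.
move=> mX; rewrite !lebesgue_rVE -(leb_shift (tupr w) mX); congr (leb n _).
by apply/seteqP; split => t /=; rewrite rowtD tuprK.
Qed.

Lemma lebesgue_rV_scale n (X : set 'rV[R]_n) (r : R) : 0 < r -> msetr X ->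
  (lebesgue_rV [set x | X (r *: x)] * (r ^+ n)%:E = lebesgue_rV X)%E.
Proof.
move=> r0 mX; rewrite !lebesgue_rVE -[RHS](leb_scale r0 mX); congr (leb n _ * _)%E.
by apply/seteqP; split => t /=; rewrite tuprK.
Qed.

Lemma lebesgue_rV_orthogonal n (X : set 'rV[R]_n) (Q : 'M[R]_n) :
  Q *m Q^T = 1%:M -> msetr X -> lebesgue_rV [set x | X (x *m Q)] = lebesgue_rV X.
Proof.
move=> QQ mX; rewrite !lebesgue_rVE -[RHS](leb_orthogonal QQ mX); congr (leb n _).
by apply/seteqP; split => t /=; rewrite tuprK.
Qed.

Lemma measurable_cat k e (X : set 'rV[R]_(k + e)) : msetr X ->
  measurable [set z : T k * T e | X (row_mx (rowt z.1) (rowt z.2))].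
Proof.
move=> mX; pose f (z : T k * T e) : T (k + e) := tupr (row_mx (rowt z.1) (rowt z.2)).
have mf : measurable_fun setT f.
  apply: measurable_fun_tnth_coord => i.
  under eq_fun do rewrite tnth_mktuple.
  case: (split_ordP i) => j ->.
    under eq_fun do rewrite row_mxEl mxE.
    exact: measurable_coord.
  under eq_fun do rewrite row_mxEr mxE.
  exact: measurable_coord.
have := mf measurableT _ mX; rewrite setTI; congr measurable.
by apply/seteqP; split => t /=; rewrite tuprK.
Qed.

(** Splitting coordinates carries [leb (k + e)] to a measure that agrees with the product on
    rectangles, hence everywhere. The last [e] coordinates are integrated outermost. *)
Lemma lebesgue_rV_split k e (X : set 'rV[R]_(k + e)) : msetr X ->
  lebesgue_rV X =
  (\int[leb e]_y lebesgue_rV [set x : 'rV_k | X (row_mx x (rowt y))])%E.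
Proof.
move=> mX; pose g (t : T (k + e)) := (lpart t, rpart t).
pose f (z : T k * T e) : T (k + e) := tupr (row_mx (rowt z.1) (rowt z.2)).
have mg : measurable_fun setT g.
  apply/measurable_fun_pair => /=.
    apply: measurable_fun_tnth_coord => i; under eq_fun do rewrite tnth_mktuple.
    exact: measurable_tnth.
  apply: measurable_fun_tnth_coord => i; under eq_fun do rewrite tnth_mktuple.
  exact: measurable_tnth.
have mf : measurable_fun setT f.
  apply: measurable_fun_tnth_coord => i.
  under eq_fun do rewrite tnth_mktuple.
  case: (split_ordP i) => j ->.
    under eq_fun do rewrite row_mxEl mxE.
    exact: measurable_coord.
  under eq_fun do rewrite row_mxEr mxE.
  exact: measurable_coord.
have gK (t : T (k + e)) : row_mx (rowt (lpart t)) (rowt (rpart t)) = rowt t.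
  apply/rowP => i; case: (split_ordP i) => j ->.
    by rewrite row_mxEl !mxE tnth_mktuple.
  by rewrite row_mxEr !mxE tnth_mktuple.
have fK : cancel g f by move=> t; rewrite /f /= gK rowtK.
pose m' : {sigma_finite_measure set (T k * T e)%type -> \bar R} :=
  image_measure (leb (k + e)) mg mf fK.
have m'E (A : set (T k * T e)) : m' A = leb (k + e) (g @^-1` A) by [].
have mX' := measurable_cat mX; set X' := [set z | _] in mX'.
have -> : lebesgue_rV X = m' X'.
  rewrite lebesgue_rVE m'E; congr (leb _ _).
  by apply/seteqP; split => t; rewrite /X' /g /= gK.
rewrite -(@product_measure_unique _ _ _ _ R (leb k) (leb e) m')//; last first.
  by move=> A B mA mB; rewrite -(leb_rectangle mA mB).
rewrite -/(sf_product (leb k) (leb e) X') sf_product_ysection//.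
apply: eq_integral => y _; rewrite lebesgue_rVE; congr (leb k _).
by apply/seteqP; split => t /=; rewrite /ysection /= inE.
Qed.

Lemma msetr_halfspace n (a : 'rV[R]_n) b : msetr [set x | dot a x <= b].
Proof.
have mf : measurable_fun [set: T n] (fun t => (rowt t *m a^T) 0 0 : mR).
  exact: (measurable_linear _ _ (@measurable_id _ _ _)).
have := mf measurableT `]-oo, b]%classic (measurable_itv _).
by rewrite setTI; congr measurable; apply/seteqP; split => t /=; rewrite in_itv/= dotE.
Qed.

Lemma msetrI n (X Y : set 'rV[R]_n) : msetr X -> msetr Y -> msetr (X `&` Y).
Proof. exact: measurableI. Qed.

(** Finitely many inequalities suffice because one is chosen for each tight set of rank [n]. A point
    outside violates a rotated separating inequality, and the inequality chosen for the same tight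
    set is a positive multiple of it. *)
Lemma halfspaces_of_hull n (V : {fset 'rV[R]_n}) : full_dimensional V ->
  exists (L : seq ('rV[R]_n * R)),
    convex_hull [set` V] = [set x | forall h, h \in L -> dot h.1 x <= h.2].
Proof.
move=> VF.
pose good s (h : 'rV[R]_n * R) := [/\ valid V h.1 h.2, tight V h.1 h.2 = s,
  \rank (hmx s) = n & exists y, dot h.1 y <> h.2].
have /choice[F FP] : forall s, exists h, (exists h', good s h') -> good s h.
  move=> s; have [[h hs]|n0] := pselect (exists h', good s h'); first by exists h.
  by exists (0, 0).
pose r := [seq s <- enum_fset (fpowerset V) | `[<good s (F s)>]].
exists [seq F s | s <- r]; apply/seteqP; split => x /=.
  move=> xV h /mapP[s]; rewrite mem_filter => /andP[/asboolP[hv _ _ _] _] ->.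
  exact: valid_hull xV.
move=> hx; apply: contrapT => /separate_hull[a [b [ab xb]]].
have [|a' [b' [h1 h2 h3 h4]]] := rotate_to_facet VF ab (u := x).
  by move=> E; move: xb; rewrite E ltxx.
have a'x : b' < dot a' x by rewrite -subr_gt0 h2 subr_gt0.
set s := tight V a' b' in h4.
have [gv gt gr [y gy]] : good s (F s).
  apply: FP; exists (a', b'); split => //; exists x => /= E.
  by move: a'x; rewrite E ltxx.
have : F s \in [seq F s | s <- r].
  apply/mapP; exists s => //; rewrite mem_filter; apply/andP; split.
    by apply/asboolP; split => //; exists y.
  by have : s \in fpowerset V by rewrite fpowersetE tight_sub.
move=> /hx; set c := (F s).1; set m := (F s).2 => cx.
(* The functionals vanishing on [s] form a line. *)
pose h (a : 'rV[R]_n) (b : R) : 'cV[R]_(n + 1) := col_mx a^T (- b)%:M.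
have hE a0 b0 z : (homog z *m h a0 b0) 0 0 = dot a0 z - b0.
  by rewrite mul_row_col mul1mx !mxE dotE mxE eqxx.
have kers a0 b0 : (forall v, v \in s -> dot a0 v = b0) -> hmx s *m h a0 b0 = 0.
  move=> h0; apply/sub_kermxP; apply: hmx_sub => v vs.
  apply/sub_kermxP/matrixP => i j.
  by rewrite !ord1 hE h0// subrr mxE.
have rk : \rank (kermx (hmx s)^T) = 1%N by rewrite mxrank_ker mxrank_tr gr addnC addnK.
have inK a0 b0 : (forall v, v \in s -> dot a0 v = b0) ->
    ((h a0 b0)^T <= kermx (hmx s)^T)%MS.
  by move=> h0; apply/sub_kermxP; rewrite -trmx_mul kers// trmx0.
have K1 : ((h a' b')^T <= kermx (hmx s)^T)%MS by apply: inK => v /tightP[].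
have K2 : ((h c m)^T <= kermx (hmx s)^T)%MS.
  by apply: inK => v; rewrite -gt => /tightP[].
have nz : (h a' b')^T != 0.
  apply/eqP => h0; move: a'x; rewrite -subr_gt0 -hE -[h a' b']trmxK h0.
  by rewrite trmx0 mulmx0 mxE ltxx.
have : (kermx (hmx s)^T <= (h a' b')^T)%MS.
  have := mxrank_leqif_sup K1; rewrite rk => /leqifP.
  have -> : \rank (h a' b')^T = 1%N.
    by apply/eqP; rewrite eqn_leq rank_leq_row lt0n mxrank_eq0.
  by case: ifP => // _; rewrite ltnn.
move=> /(submx_trans K2)/sub_rVP[k kE].
have kz z : dot c z - m = k * (dot a' z - b').
  by rewrite -!hE -[h c m]trmxK kE linearZ /= trmxK -scalemxAr mxE.
(* The sign of the factor [k] is read off at a vertex with positive slack. *)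
have /existsNP[w /not_implyP[wV nw]] : ~ forall v, v \in V -> dot a' v = b'.
  move=> E; move: a'x; rewrite (affine_functional_eq x VF E).
  by rewrite ltxx.
have w1 : dot a' w - b' < 0.
  by rewrite subr_lt0 lt_neqAle h1// andbT; apply/eqP.
have k0 : 0 <= k.
  by rewrite -(nmulr_lle0 _ w1) -kz subr_le0; exact: gv.
have kn : k != 0.
  apply/eqP => k00; apply: gy; apply/eqP; rewrite -subr_eq0.
  by rewrite -/c -/m kz k00 mul0r.
have kp : 0 < k by rewrite lt_def kn.
have : 0 < dot c x - m by rewrite kz mulr_gt0// subr_gt0.
by rewrite subr_gt0 ltNge cx.
Qed.

Lemma msetr_hull n (V : {fset 'rV[R]_n}) : full_dimensional V ->
  msetr (convex_hull [set` V]).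
Proof.
move=> /halfspaces_of_hull[L ->]; elim: L => [|h L IH].
  rewrite /msetr (_ : [set t | _] = setT) //.
  by apply/seteqP; split => t //= _ h; rewrite in_nil.
have -> : [set x | forall h', h' \in h :: L -> dot h'.1 x <= h'.2] =
    [set x | dot h.1 x <= h.2] `&` [set x | forall h', h' \in L -> dot h'.1 x <= h'.2].
  apply/seteqP; split => x /=.
    move=> hx; split; first by apply: hx; exact: mem_head.
    by move=> h' h'L; apply: hx; rewrite in_cons h'L orbT.
  by move=> [h1 h2] h'; rewrite in_cons => /predU1P[->//|]; exact: h2.
by apply: msetrI => //; exact: msetr_halfspace.
Qed.

End LebesgueSplit.

(** * Volumes *)

Section Frames.
Context {R : realType}.

(** Gram-Schmidt: normalize one vector of the space and continue in its orthogonal complement within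
    the space. *)
Lemma orthonormal_basis n k m (A : 'M[R]_(m, n)) : \rank A = k ->
  exists2 B : 'M[R]_(k, n), B *m B^T = 1%:M & (B <= A)%MS.
Proof.
elim: k m A => [|k IH] m A rA.
  by exists 0; rewrite ?sub0mx// flatmx0 [RHS]flatmx0.
have [u uA u0] : exists2 u : 'rV[R]_n, (u <= A)%MS & u != 0.
  by apply/rowV0Pn; rewrite -mxrank_eq0 rA.
have q0 : 0 < dot u u.
  rewrite lt_def; apply/andP; split; last by apply: sumr_ge0 => i _; rewrite -expr2 sqr_ge0.
  apply: contra u0; rewrite /dot psumr_eq0 => [/allP h|i _]; last by rewrite -expr2 sqr_ge0.
  apply/eqP/rowP => i; have := h i (mem_index_enum _).
  by rewrite mulf_eq0 orbb mxE => /eqP.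
pose v := (Num.sqrt (dot u u))^-1 *: u.
have vv : v *m v^T = 1%:M.
  apply/matrixP => i j; rewrite !ord1 -dotE /v dotZ dotC dotZ mulrA -invfM.
  by rewrite -expr2 sqr_sqrtr ?ltW// mulVf ?gt_eqF// !mxE eqxx.
have vA : (v <= A)%MS by apply: scalemx_sub.
have rk : \rank (A :&: kermx v^T)%MS = k.
  have := mxrank_mul_ker A v^T; rewrite rA.
  suff -> : \rank (A *m v^T) = 1%N by rewrite add1n => -[].
  apply/eqP; rewrite eqn_leq rank_leq_col lt0n mxrank_eq0; apply/eqP => Av.
  have /submxP[w wE] := vA; have : v *m v^T = 0 by rewrite {1}wE -mulmxA Av mulmx0.
  by rewrite vv => /matrixP/(_ 0 0); rewrite !mxE/= => /eqP; rewrite oner_eq0.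
have [B BB BA] := IH _ _ rk.
have Bv : B *m v^T = 0 by apply/sub_kermxP; apply: submx_trans BA (capmxSr _ _).
exists (col_mx v B).
  have : col_mx v B *m (col_mx v B)^T = 1%:M; last exact.
  rewrite tr_col_mx mul_col_row vv BB Bv.
  have -> : v *m B^T = 0 by rewrite -[v]trmxK -trmx_mul Bv trmx0.
  by rewrite -scalar_mx_block.
have : (col_mx v B <= A)%MS; last exact.
by rewrite col_mx_sub vA (submx_trans BA)// capmxSl.
Qed.

Lemma rank_orthonormal n k (B : 'M[R]_(k, n)) : B *m B^T = 1%:M -> \rank B = k.
Proof. by move=> BB; apply/eqP/row_freeP; exists B^T. Qed.

Lemma orthonormal_proj n k (B : 'M[R]_(k, n)) m (A : 'M[R]_(m, n)) :
  B *m B^T = 1%:M -> (A <= B)%MS -> A *m B^T *m B = A.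
Proof. by move=> BB /submxP[Z ->]; rewrite -(mulmxA Z) BB mulmx1. Qed.

(** Two orthonormal frames of the flat spanned by [X] differ by an orthogonal matrix and a
    translation, so the infimum in [vol] is over a single value. The fourth hypothesis says that [X]
    really spans the flat. *)
Lemma vol_frame n k (X : set 'rV[R]_n) (p0 : 'rV[R]_n) (B0 : 'M[R]_(k, n)) :
  B0 *m B0^T = 1%:M -> X `<=` [set p0 + y *m B0 | y in [set: 'rV[R]_k]] ->
  (exists x, X x) ->
  (forall p (B : 'M[R]_(k, n)),
    X `<=` [set p + y *m B | y in [set: 'rV[R]_k]] -> (B0 <= B)%MS) ->
  msetr [set y | X (p0 + y *m B0)] ->
  vol k X = lebesgue_rV [set y | X (p0 + y *m B0)].
Proof.
move=> BB0 XB0 [x Xx] span mX; rewrite /vol.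
set S := [set v | _]; set c := lebesgue_rV _.
suff -> : S = [set c] by rewrite ereal_inf1.
apply/seteqP; split => [v [p [B [BB XB ->]]]|_ ->]; last by exists p0, B0.
have B0B : (B <= B0)%MS.
  have := mxrank_leqif_sup (span p B XB); rewrite !rank_orthonormal// => /leqifP.
  by case: ifP => // _; rewrite ltnn.
pose Q := B *m B0^T.
have QE : Q *m B0 = B by exact: orthonormal_proj.
have QQ : Q *m Q^T = 1%:M.
  by rewrite -BB -[in RHS]QE (trmx_mul Q) mulmxA -(mulmxA Q) BB0 mulmx1.
(* A point of [X] seen in both frames gives the translation between their origins. *)
have [y1 _ y1E] := XB x Xx; have [y2 _ y2E] := XB0 x Xx.
pose y0 := y2 - y1 *m Q.
have pE : p = p0 + y0 *m B0.
  by rewrite mulmxBl addrA y2E -mulmxA QE -y1E addrK.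
clearbody y0; rewrite /= /c -(lebesgue_rV_shift y0 mX) -[RHS](lebesgue_rV_orthogonal QQ); last first.
  have := msetr_affine 1%:M y0 mX.
  by congr msetr; apply/seteqP; split => z /=; rewrite mulmx1.
congr lebesgue_rV; apply/seteqP; split => z /=.
  by rewrite pE mulmxDl -mulmxA QE addrAC addrA.
by rewrite pE mulmxDl -mulmxA QE addrAC addrA.
Qed.

Definition coords n k (p : 'rV[R]_n) (B : 'M[R]_(k, n)) (s : {fset 'rV[R]_n}) :
  {fset 'rV[R]_k} := [fset (v - p) *m B^T | v in s]%fset.

Lemma coords_comb n k (p : 'rV[R]_n) (B : 'M[R]_(k, n)) m (q : 'I_m -> 'rV[R]_n) w :
  B *m B^T = 1%:M -> (forall i, (q i - p <= B)%MS) -> \sum_i w i = 1 ->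
  p + (\sum_i w i *: ((q i - p) *m B^T)) *m B = \sum_i w i *: q i.
Proof.
move=> BB qB w1; rewrite mulmx_suml.
under eq_bigr do rewrite -scalemxAl orthonormal_proj// scalerBr.
by rewrite sumrB -scaler_suml w1 scale1r addrC subrK.
Qed.

Lemma coords_point n k (p : 'rV[R]_n) (B : 'M[R]_(k, n)) y :
  B *m B^T = 1%:M -> (p + y *m B - p) *m B^T = y.
Proof. by move=> BB; rewrite addrAC subrr add0r -mulmxA BB mulmx1. Qed.

Lemma coords_sum n k (p : 'rV[R]_n) (B : 'M[R]_(k, n)) m (q : 'I_m -> 'rV[R]_n) w :
  \sum_i w i = 1 ->
  (\sum_i w i *: q i - p) *m B^T = \sum_i w i *: ((q i - p) *m B^T).
Proof.
move=> w1; rewrite mulmxBl mulmx_suml.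
under [RHS]eq_bigr do rewrite mulmxBl scalerBr scalemxAl.
by rewrite sumrB -scaler_suml w1 scale1r.
Qed.

Lemma convex_hull_coords n k (p : 'rV[R]_n) (B : 'M[R]_(k, n)) (s : {fset 'rV[R]_n}) :
  B *m B^T = 1%:M -> (forall v, v \in s -> (v - p <= B)%MS) ->
  [set y | convex_hull [set` s] (p + y *m B)] = convex_hull [set` coords p B s].
Proof.
move=> BB sB; apply/seteqP; split => y /= [m [q [w [qs w0 w1 yE]]]].
  exists m, (fun i => (q i - p) *m B^T), w; split => //.
    by move=> i; apply/imfsetP; exists (q i) => //; exact: qs.
  by rewrite -coords_sum// -yE coords_point.
have /choice[r rP] : forall i, exists v, v \in s /\ q i = (v - p) *m B^T.
  by move=> i; have /imfsetP[v vs ->] := qs i; exists v.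
exists m, r, w; split => //; first by move=> i; have [] := rP i.
rewrite yE -(coords_comb (p := p) BB (w := w))//; last by move=> i; apply: sB; have [] := rP i.
by congr (_ + _ *m _); apply: eq_bigr => i _; have [_ ->] := rP i.
Qed.

Lemma full_coords n k (p : 'rV[R]_n) (B : 'M[R]_(k, n)) (s : {fset 'rV[R]_n}) :
  B *m B^T = 1%:M -> (forall y, affine_hull [set` s] (p + y *m B)) ->
  full_dimensional (coords p B s).
Proof.
move=> BB h; rewrite /full_dimensional -subTset => y _.
have [m [q [w [qs w1 yE]]]] := h y.
exists m, (fun i => (q i - p) *m B^T), w; split => //.
  by move=> i; apply/imfsetP; exists (q i) => //; exact: qs.
by rewrite -coords_sum// -yE coords_point.
Qed.

Lemma lebesgue_rV_frame d n (Q : 'M[R]_(n, d)) (w : 'rV[R]_d) (X : set 'rV[R]_d) :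
  n = d -> Q *m Q^T = 1%:M -> msetr X ->
  lebesgue_rV [set z | X (w + z *m Q)] = lebesgue_rV X.
Proof.
move=> nd; subst n => QQ mX.
have mX' : msetr [set x | X (x + w)].
  have := msetr_affine 1%:M w mX.
  by congr msetr; apply/seteqP; split => z /=; rewrite mulmx1.
rewrite -(lebesgue_rV_shift w mX) -[RHS](lebesgue_rV_orthogonal QQ mX').
by congr lebesgue_rV; apply/seteqP; split => z /=; rewrite addrC.
Qed.

End Frames.

(** * One-dimensional integrals *)

Section PowerIntegrals.
Context {R : realType}.
Import numFieldNormedType.Exports.
Local Notation mu := (@lebesgue_measure R).
Implicit Types k e : nat.

Lemma integral_power k (t : R) : 0 <= t ->
  (\int[mu]_(s in `]0%R, t[) (k.+1%:R * s ^+ k)%:E = (t ^+ k.+1)%:E)%E.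
Proof.
rewrite le_eqVlt => /predU1P[<-|t0].
  by rewrite set_itv_ge ?integral_set0 ?expr0n//= bnd_simp ltxx.
pose f (s : R) : R := k.+1%:R * s ^+ k.
have cf : continuous f.
  by move=> s; apply: cvgM; [exact: cvg_cst|exact: exprn_continuous].
rewrite -(@integral_itv_bndoo _ 0 t (EFin \o f) true false); last first.
  apply/measurable_EFinP; apply: measurable_funTS.
  exact: continuous_measurable_fun.
rewrite (@continuous_FTC2 _ f (fun s => s ^+ k.+1))//.
- by rewrite expr0n /= sube0.
- exact: continuous_subspaceT.
- split.
  + by move=> s _; exact: exprn_derivable.
  + exact/cvg_at_right_filter/exprn_continuous.
  + exact/cvg_at_left_filter/exprn_continuous.
- by move=> s _; rewrite derive1E exp_derive scaler1 /f.
Qed.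

(** The integral is [k.+1] times the beta value with parameters [k.+1] and [e.+1], that is [k.+1]!
    [e]! / ([k.+1 + e])!; this is the origin of the binomial coefficient in the volume formula. *)
Lemma integral_beta k e :
  (\int[mu]_(s in `]0%R, 1%R[) (k.+1%:R * s ^+ k * (1 - s) ^+ e)%:E =
    ('C(k.+1 + e, k.+1)%:R^-1)%:E)%E.
Proof.
pose f (s : R) : R := s ^+ k * (1 - s) ^+ e.
have mf A : measurable_fun (A : set (measurableTypeR R)) f.
  exact: (@measurable_XMonemX R A k e).
have f0 s : (`[0%R, 1%R]%classic : set R) s -> (0 <= (f s)%:E)%E.
  by move=> s01; rewrite lee_fin; apply: (@XMonemX_ge0 R k e s).
transitivity (k.+1%:R%:E * \int[mu]_(s in `]0%R, 1%R[) (f s)%:E)%E.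
  rewrite -ge0_integralZl//.
  - by apply: eq_integral => s _; rewrite -EFinM mulrA.
  - by apply/measurable_EFinP; exact: mf.
  - by move=> s s01; apply: f0; exact: subset_itv_oo_cc.
rewrite -(@integral_itv_bndoo _ 0 1 (EFin \o f) true false); last by apply/measurable_EFinP; exact: mf.
have -> : (\int[mu]_(s in `[0%R, 1%R]) (f s)%:E = (beta_fun k.+1 e.+1)%:E)%E.
  rewrite EFin_beta_fun integral_mkcond; apply: eq_integral => s _.
  by rewrite !patchE; case: ifP.
rewrite beta_fun_fact -EFinM; congr _%:E.
have := @bin_fact (k.+1 + e) k.+1 (leq_addr _ _).
rewrite addKn => /(congr1 (fun n => n%:R : R)); rewrite natrM => E.
have F0 : ((k.+1 + e)`!%:R : R) != 0 by rewrite pnatr_eq0 -lt0n fact_gt0.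
rewrite -addSn; apply: (mulIf F0).
rewrite -[X in _ = _^-1 * X]E mulKf; last first.
  by rewrite pnatr_eq0 -lt0n bin_gt0 leq_addr.
by rewrite mulrA mulfVK// factS -natrM mulnA.
Qed.

End PowerIntegrals.

(** * Integrating a power of a height function by its superlevel sets *)

Section LayerCake.
Context {R : realType}.
Local Notation mR := (measurableTypeR R).
Local Notation T n := (n.-tuple (measurableTypeR R)).
Local Notation mu := (@lebesgue_measure R).
Implicit Types k e : nat.

Lemma lebesgue_rV_point n (c : 'rV[R]_n) : (0 < n)%N ->
  lebesgue_rV [set a | a + c = 0] = 0%E.
Proof.
move=> n0; have m0 : msetr [set a : 'rV[R]_n | a = 0] /\
    lebesgue_rV [set a : 'rV[R]_n | a = 0] = 0%E.
  rewrite /msetr lebesgue_rVE.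
  have -> : [set t : T n | rowt t = 0] = @cube R n 0.
    apply/seteqP; split => t /= h.
      by move=> i; have /rowP/(_ i) := h; rewrite !mxE => ->; rewrite normr0.
    by apply/rowP => i; have := h i; rewrite normr_le0 !mxE => /eqP.
  by split; [exact: measurable_cube|rewrite leb_cube// mulr0 expr0n gtn_eqF].
by rewrite (lebesgue_rV_shift c m0.1) m0.2.
Qed.

Lemma lebesgue_rV0 n : lebesgue_rV (set0 : set 'rV[R]_n) = 0%E.
Proof. by rewrite lebesgue_rVE; exact: measure0. Qed.

Section Cone.
Variables (e : nat) (s : {fset 'rV[R]_e}).
Hypothesis sF : full_dimensional s.
Let K := convex_hull [set` s].

(** The region below the graph of one minus the gauge of [K]: its slice at height r is
    [(1 - r) K]. *)
Definition cone_under : set (T e * mR) :=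
  [set z | 0 < (z.2 : R) < 1 /\ K ((1 - (z.2 : R))^-1 *: rowt z.1)].

Lemma measurable_cone_under : measurable cone_under.
Proof.
have [L LE] := halfspaces_of_hull sF.
(* Multiplying by [1 - r > 0] turns the facet inequalities of [K] into polynomial ones in both
   variables. *)
have -> : cone_under = [set z : T e * mR | 0 < (z.2 : R) < 1] `&`
    \bigcap_(h in [set` L]) [set z : T e * mR |
      dot h.1 (rowt z.1) - (1 - (z.2 : R)) * h.2 <= 0].
  apply/seteqP; split => [[y r] /= [r01]|[y r] /= [r01 h]].
    rewrite /K LE => h; split => // i /h; have [_ r1] := andP r01.
    by rewrite /= dotZ [_^-1 * _]mulrC ler_pdivrMr ?subr_gt0// subr_le0 [i.2 * _]mulrC.
  split => //; rewrite /K LE => i /h; have [_ r1] := andP r01.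
  by rewrite /= dotZ [_^-1 * _]mulrC ler_pdivrMr ?subr_gt0// subr_le0 [i.2 * _]mulrC.
apply: measurableI.
  have := @measurable_snd _ _ (T e) mR measurableT `]0, 1[%classic (measurable_itv _).
  by rewrite setTI; congr measurable; apply/seteqP; split => z /=; rewrite in_itv.
apply: fin_bigcap_measurable => [|h _]; first exact: finite_seq.
have mf : measurable_fun [set: T e * mR] (fun z => ((rowt z.1 *m h.1^T) 0 0 - (1 - (z.2 : R)) * h.2 : mR)).
  apply: measurable_funB.
    exact: measurable_linear.
  apply: measurable_funM => //; apply: measurable_funB => //.
have := mf measurableT `]-oo, 0]%classic (measurable_itv _).
by rewrite setTI; congr measurable; apply/seteqP; split => z /=; rewrite in_itv/= -dotE dotC.
Qed.

Variable k : nat.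

(** The density is the derivative of [r ^+ k.+1], so that integrating up to height t gives
    [t ^+ k.+1]. *)
Let H (z : T e * mR) : \bar R :=
  ((\1_cone_under z : R) * (k.+1%:R * (z.2 : R) ^+ k))%:E.

Let H0 z : (0 <= H z)%E.
Proof.
rewrite /H indicE lee_fin; case: (asboolP (cone_under z)) => [h|h].
  rewrite mem_set// mul1r mulr_ge0// exprn_ge0//.
  by case: h => /andP[/ltW].
by rewrite memNset// mul0r.
Qed.

Let mH : measurable_fun setT H.
Proof.
apply/measurable_EFinP; apply: measurable_funM.
  by apply: measurable_indic; exact: measurable_cone_under.
by apply: measurable_funM => //; apply: measurable_funX; exact: measurable_snd.
Qed.

Let mpow (A : set mR) : measurable_fun A (fun r : mR => (k.+1%:R * (r : R) ^+ k)%:E).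
Proof.
by apply/measurable_EFinP; apply: measurable_funM => //; apply: measurable_funX.
Qed.

Let fibre_integral (y : T e) t : 0 <= t <= 1 ->
  (forall r, 0 < r < 1 -> r <= t <-> K ((1 - r)^-1 *: rowt y)) ->
  (\int[mu]_r H (y, r) = (t ^+ k.+1)%:E)%E.
Proof.
move=> /andP[t0 t1] ht; rewrite -integral_power//.
(* Heights in [cone_under] satisfy r <= t but also r < 1, so the upper end is open exactly when t is
   1; the integral does not see the difference. *)
rewrite -(@integral_itv_bndoo _ 0 t _ false (t == 1)); last exact: mpow.
rewrite [RHS]integral_mkcond; apply: eq_integral => r _; rewrite /H patchE indicE.
suff -> : ((y, r) \in cone_under) =
    (r \in [set` Interval (BRight 0) (BSide (t == 1) t)]).
  by case: ifP => _; rewrite ?mul1r ?mul0r.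
apply/idP/idP; rewrite !inE /=.
  move=> [r01] /(ht _ r01) rt; rewrite in_itv/=; case/andP: r01 => -> r1 /=.
  by case: eqP => [->|//].
rewrite in_itv/= => /andP[r0]; case: eqP => [tE|/eqP tn1] rt /=.
  have r01 : 0 < (r : R) < 1 by rewrite r0 -tE.
  by split => //; apply/ht => //; exact: ltW.
have r01 : 0 < (r : R) < 1.
  by rewrite r0 (le_lt_trans rt)// lt_neqAle tn1.
by split => //; exact/ht.
Qed.

Let slice_integral (r : R) : (\int[leb e]_y H (y, r) =
  if (0 < r < 1)%R then (k.+1%:R * r ^+ k * (1 - r) ^+ e)%:E * lebesgue_rV K else 0)%E.
Proof.
case: ifPn => r01; last first.
  apply: integral0_eq => y _; rewrite /H indicE memNset ?mul0r//.
  by move=> [h _]; rewrite h in r01.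
have [/ltW r0 r1] := andP r01.
pose A : set (T e) := [set y | K ((1 - r)^-1 *: rowt y)].
have mA : measurable A.
  have := msetr_affine ((1 - r)^-1)%:M 0 (msetr_hull sF).
  by congr measurable; apply/seteqP; split => y /=; rewrite mul_mx_scalar addr0.
transitivity (\int[leb e]_y ((k.+1%:R * r ^+ k)%:E * (\1_A y)%:E))%E.
  apply: eq_integral => y _; rewrite /H !indicE -EFinM mulrC; congr (_ * _%:R)%:E.
  by congr (nat_of_bool _); apply/idP/idP; rewrite !inE /=; first by case.
rewrite ge0_integralZl//; last 2 first.
- exact/measurable_EFinP/measurable_indic.
- by rewrite lee_fin mulr_ge0// exprn_ge0.
rewrite integral_indic// setIT [in RHS]EFinM -muleA; congr (_ * _)%E.
have r1' : 0 < (1 - r)^-1 by rewrite invr_gt0 subr_gt0.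
rewrite -[lebesgue_rV K](lebesgue_rV_scale r1' (msetr_hull sF)) lebesgue_rVE.
rewrite [RHS]muleC -muleA -EFinM.
by rewrite -exprMn mulVf ?expr1n ?mule1// gt_eqF// subr_gt0.
Qed.

(** Tonelli for [H]: integrating over heights first gives [t ^+ k.+1], integrating over the base
    first gives the beta integrand times the volume of [K]. *)
Lemma layer_cake (F : 'rV[R]_e -> \bar R) (C : \bar R) : (0 <= C)%E ->
  (forall y, exists t, [/\ 0 <= t <= 1,
    forall r, 0 < r < 1 -> r <= t <-> K ((1 - r)^-1 *: y)
    & F y = ((t ^+ k.+1)%:E * C)%E]) ->
  (\int[leb e]_y F (rowt y) = ('C(k.+1 + e, k.+1)%:R^-1)%:E * (C * lebesgue_rV K))%E.
Proof.
move=> C0 hF.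
have mI : measurable_fun [set: T e] (fun y => \int[mu]_r H (y, r))%E.
  exact: (@measurable_fun_fubini_tonelli_F _ _ _ _ _ mu H mH).
transitivity (\int[leb e]_y (C * \int[mu]_r H (y, r)))%E.
  apply: eq_integral => y _; have [t [t01 ht ->]] := hF (rowt y).
  by rewrite (fibre_integral t01 ht) muleC.
rewrite ge0_integralZl//; last by move=> y _; apply: integral_ge0.
rewrite fubini_tonelli//.
transitivity (C * (\int[mu]_(r in `]0%R, 1%R[)
    (lebesgue_rV K * (k.+1%:R * r ^+ k * (1 - r) ^+ e)%:E)))%E.
  congr (_ * _)%E; rewrite [RHS]integral_mkcond; apply: eq_integral => r _.
  rewrite slice_integral patchE muleC.
  by have -> : (r \in (`]0%R, 1%R[%classic : set mR)) = (0 < (r : R) < 1);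
    [apply/idP/idP; rewrite inE /= in_itv|].
rewrite ge0_integralZl//.
- by rewrite integral_beta [RHS]muleC muleA.
- apply/measurable_EFinP; apply: measurable_funM.
    by apply: measurable_funM => //; apply: measurable_funX.
  by apply: measurable_funX; apply: measurable_funB.
- move=> r; rewrite /= in_itv/= => /andP[r0 r1].
  by rewrite lee_fin !mulr_ge0// exprn_ge0// ?subr_ge0 ltW.
- by rewrite lebesgue_rVE.
Qed.

End Cone.
End LayerCake.

(** * The volume formula *)

Section SpineVolume.
Context {R : realType} {d : nat}.
Variables (V U : {fset 'rV[R]_d}) (u1 : 'rV[R]_d).
Hypotheses (d0 : (0 < d)%N) (VF : full_dimensional V).
Hypotheses (VC : convex_position V) (SU : spine V U) (u1U : u1 \in U).
Implicit Types (x y z v : 'rV[R]_d).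

Local Notation W := (V `\` U)%fset.
Local Notation hat := (Phi U u1).
Local Notation hatV := [fset Phi U u1 v | v in V]%fset.
Local Notation P := (convex_hull [set` V]).

Let UV : (U `<=` V)%fset := SU.1.
Let UI : affinely_independent U := spine_independent d0 VF VC SU.

Section Frame.
(** The rows of [B] and [B'] are orthonormal bases of the direction of [U] and of its complement.
    The dimension of conv U is written [k.+1] here, which makes it positive. *)
Variables (k e : nat) (B : 'M[R]_(k.+1, d)) (B' : 'M[R]_(e, d)).
Hypotheses (BB : B *m B^T = 1%:M) (BD : (B <= direction U)%MS).
Hypothesis DB : (direction U <= B)%MS.
Hypotheses (BB' : B' *m B'^T = 1%:M) (BO : (B' <= direction_ortho U)%MS).
Hypothesis OB : (direction_ortho U <= B')%MS.

Let UB := [set a : 'rV[R]_k.+1 | convex_hull [set` U] (u1 + a *m B)].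
Let K := [set y : 'rV[R]_e | convex_hull [set` hatV] (y *m B')].

Let base_direction c : mass U c = 1 -> (comb U c - u1 <= direction U)%MS.
Proof.
move=> c1; apply/direction_sub; exists (fun v => c v - (v == u1)%:R).
by rewrite massB combB mass_point// comb_point// c1 subrr.
Qed.

Let subB v : v \in U -> (v - u1 <= B)%MS.
Proof.
move=> vU; apply: submx_trans DB; rewrite -[v](comb_point vU).
by apply: base_direction; rewrite mass_point.
Qed.

Let subB' v : v \in hatV -> (v - 0 <= B')%MS.
Proof.
by move=> /imfsetP[w /= _ ->]; rewrite subr0; apply: submx_trans OB; exact: proj_sub_ortho.
Qed.

Let UBE : UB = convex_hull [set` coords u1 B U].
Proof. exact: convex_hull_coords. Qed.

Let KE : K = convex_hull [set` coords 0 B' hatV].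
Proof.
rewrite -convex_hull_coords//.
by apply/seteqP; split => y; rewrite /K /= add0r.
Qed.

Let fullU : full_dimensional (coords u1 B U).
Proof.
apply: full_coords => // y; apply/affine_hullP.
have /direction_sub[c [c0 cE]] : (y *m B <= direction U)%MS.
  by apply: submx_trans BD; exact: submxMl.
exists (fun v => (v == u1)%:R + c v).
by rewrite massD combD mass_point// comb_point// c0 cE addr0.
Qed.

Let ortho_sum z : (z <= direction_ortho U)%MS ->
  exists m (p : 'I_m -> 'rV[R]_d) (w : 'I_m -> R),
    [/\ forall i, p i \in V, \sum_i w i = 1 & z = \sum_i w i *: hat (p i)].
Proof.
move=> zO; have : affine_hull [set` V] (u1 + z) by rewrite VF.
move=> [m [p [w [ps w1 E]]]]; exists m, p, w; split => //.
by rewrite -Phi_sum// -E /Phi addrAC subrr add0r proj_onto_ortho.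
Qed.

Let fullhat : full_dimensional (coords 0 B' hatV).
Proof.
apply: full_coords => // y; rewrite add0r.
have [|m [p [w [ps w1 ->]]]] := @ortho_sum (y *m B').
  by apply: submx_trans BO; exact: submxMl.
by exists m, (hat \o p), w; split => // i; apply: in_imfset; exact: ps.
Qed.

Let mUB : msetr UB. Proof. by rewrite UBE; exact: msetr_hull. Qed.

Let KP (y : 'rV[R]_e) : K y <-> exists l, [/\ nneg l, mass W l <= 1 & y *m B' = vcomb W hat l].
Proof. exact: conv_hatV. Qed.

Let hat_fibre a (y : 'rV[R]_e) : hat (u1 + a *m B + y *m B') = y *m B'.
Proof.
rewrite /Phi -[u1 + _ + _]addrA [u1 + _]addrC addrK mulmxDl.
have /(proj_ker UI u1U) -> : (a *m B <= direction U)%MS.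
  by apply: submx_trans BD; exact: submxMl.
by rewrite add0r proj_onto_ortho//; apply: submx_trans BO; exact: submxMl.
Qed.

Let shrinkK (r : R) (y : 'rV[R]_e) : 0 < r < 1 -> K ((1 - r)^-1 *: y) -> K y.
Proof.
move=> /andP[r0 r1] /KP[l [l0 l1 lE]]; apply/KP.
have s0 : 0 < 1 - r by rewrite subr_gt0.
exists (fun v => (1 - r) * l v); split=> [v||].
- by rewrite mulr_ge0// ltW.
- rewrite massZ; apply: mulr_ile1 => //; first exact: ltW.
    by apply: mass_ge0 => v _; exact: l0.
  by rewrite gerBl ltW.
- by rewrite vcombZ -lE -scalemxAl scalerA divff ?scale1r// gt_eqF.
Qed.

(* If [l] represents [y] with the least possible mass [1 - t], then mass [t]
   is left for [U], so the fibre of [P] over [y] is a translate of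
   [t *: conv U]. *)
Lemma spine_fibre (y : 'rV[R]_e) : exists t, [/\ 0 <= t <= 1,
  forall r, 0 < r < 1 -> r <= t <-> K ((1 - r)^-1 *: y)
  & lebesgue_rV [set a | P (u1 + a *m B + y *m B')] =
    ((t ^+ k.+1)%:E * lebesgue_rV UB)%E].
Proof.
have [Ky|nK] := pselect (K y); last first.
  (* Over a point outside [K] the fibre is empty, and height 0 is right because no r > 0 is
     admissible there. *)
  exists 0; split; first by rewrite lexx ler01.
    move=> r r01; split=> [|/(shrinkK r01)//].
    by have [+ _] := andP r01; rewrite ltNge => /negP.
  rewrite expr0n mul0e -[RHS](@lebesgue_rV0 R k.+1); congr lebesgue_rV.
  apply/seteqP; split => a //= Pa; apply: nK.
  by rewrite /K /= -(hat_fibre a) convex_hull_Phi; exists (u1 + a *m B + y *m B').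
have [l [l0 l1 yl]] := (KP _).1 Ky.
have [g gP] := generic_exists W hat.
have [m /opt_mass_opt mm ml] := opt_exists gP l0; have [m0 mmin] := mm.
have m1 : mass W m <= 1 by apply: le_trans l1; exact: mmin.
have yE : y *m B' = vcomb W hat m by rewrite ml.
have mge0 : 0 <= mass W m by apply: mass_ge0 => v _; exact: m0.
pose t := 1 - mass W m.
have tge0 : 0 <= t by rewrite subr_ge0.
exists t; split.
- by rewrite tge0 gerBl.
- move=> r /andP[r0 r1]; have s0 : 0 < 1 - r by rewrite subr_gt0.
  split=> [rt|/KP[n [n0 n1 nE]]].
    apply/KP; exists (fun v => (1 - r)^-1 * m v); split=> [v||].
    + by rewrite mulr_ge0// invr_ge0 ltW.
    + by rewrite massZ ler_pdivrMl// mulr1; move: rt; rewrite /t; lra.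
    + by rewrite vcombZ -yE -scalemxAl.
  have : mass W m <= mass W (fun v => (1 - r) * n v).
    apply: mmin => [v|]; first by rewrite mulr_ge0// ltW.
    by rewrite vcombZ -nE -scalemxAl scalerA divff ?scale1r// gt_eqF.
  have : (1 - r) * mass W n <= (1 - r) * 1 by rewrite ler_pM2l.
  by rewrite massZ /t; lra.
(* The offset that makes the fibre a translate: up to [c], what remains of a point of the fibre
   after removing the [W]-part is measured from [t *: u1]. *)
pose c := (mass W m *: u1 + y *m B' - comb W m) *m B^T.
have cE : c *m B = mass W m *: u1 + y *m B' - comb W m.
  apply: orthonormal_proj => //; apply: submx_trans DB; apply/(proj_ker UI u1U).
  rewrite addrAC -opprB addrC mulmxBl -vc_proj -yE proj_onto_ortho ?subrr//.
  by apply: submx_trans BO; exact: submxMl.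
have xE a : u1 + a *m B + y *m B' = comb W m + (t *: u1 + (a + c) *m B).
  rewrite mulmxDl cE /t; move: (a *m B) (y *m B') (comb W m) => p q r.
  by apply/rowP => i; rewrite !mxE; ring.
have PE a : P (u1 + a *m B + y *m B') <-> exists b, [/\ forall u, 0 <= b u,
    forall u, u \notin U -> b u = 0, mass U b = t & t *: u1 + (a + c) *m B = comb U b].
  split=> [Px|[b [b0 bU b1 bE]]].
    have /direction_sub[c' [c'0 c'E]] : ((a + c) *m B <= direction U)%MS.
      by apply: submx_trans BD; exact: submxMl.
    pose a' v := t * (v == u1)%:R + c' v.
    have ma : mass U a' = t by rewrite massD massZ mass_point// c'0 mulr1 addr0.
    have ca : comb U a' = t *: u1 + (a + c) *m B.
      by rewrite combD combZ comb_point// c'E.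
    have a'0 : forall u, u \in U -> 0 <= a' u.
      apply: (mass_opt_hull d0 VF UV UI u1U VC SU mm Px); first by rewrite ca.
      by rewrite ma addrC subrK.
    exists (fun v => if v \in U then a' v else 0).
    split; rewrite ?mass_restrict ?comb_restrict// => u; last by move=> /negbTE ->.
    by case: ifP => // /a'0.
  apply/convex_hullP; exists (fun v => if v \in U then b v else if v \in V then m v else 0).
  have EU : {in U, (fun v => if v \in U then b v else if v \in V then m v else 0) =1 b}.
    by move=> v /= ->.
  have EW : {in W, (fun v => if v \in U then b v else if v \in V then m v else 0) =1 m}.
    by move=> v /=; rewrite inE => /andP[/negbTE -> ->].
  rewrite (massV UV) (combV UV) (eq_mass EU) (eq_mass EW) (eq_comb EU) (eq_comb EW).
  split=> [v|v vV||]; last by rewrite xE bE.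
  - by case: ifP => // _; case: ifP.
  - by rewrite (negbTE vV); case: ifP => // vU; rewrite (fsubsetP UV) in vV.
  - by rewrite b1 addrC subrK.
(* With no mass left for [U] the fibre is a single point, which is null in dimension [k.+1];
   rescaling by [t^-1] would be meaningless. *)
have [t0|t0] := eqVneq t 0.
  rewrite t0 expr0n mul0e -[RHS](lebesgue_rV_point c (ltn0Sn k)); congr lebesgue_rV.
  apply/seteqP; split => a /=; rewrite PE.
    move=> [b [b0 _ b1]]; rewrite t0 scale0r add0r => abE.
    have bz u : u \in U -> b u = 0.
      move: b1; rewrite t0 /mass => /eqP; rewrite psumr_eq0// => /allP h uU.
      exact/eqP/h.
    rewrite -[a + c]mulmx1 -BB mulmxA abE /comb big_seq big1 ?mul0mx// => u uU.
    by rewrite bz// scale0r.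
  move=> ->; exists (fun=> 0); rewrite t0 scale0r mul0mx addr0.
  split => //; first by rewrite /mass big1.
  by rewrite /comb big1// => u _; rewrite scale0r.
have tp : 0 < t by rewrite lt_def t0.
have tV : 0 < t^-1 by rewrite invr_gt0.
pose X := [set a : 'rV[R]_k.+1 | UB (t^-1 *: a)].
have mX : msetr X.
  have := msetr_affine (t^-1)%:M 0 mUB.
  by congr msetr; apply/seteqP; split => z /=; rewrite mul_mx_scalar addr0.
have -> : [set a | P (u1 + a *m B + y *m B')] = [set a | X (a + c)].
  have tE a : u1 + t^-1 *: (a + c) *m B = t^-1 *: (t *: u1 + (a + c) *m B).
    by rewrite [RHS]scalerDr scalerA mulVf// scale1r scalemxAl.
  apply/seteqP; split => a /=; rewrite PE /X /UB /= tE.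
    move=> [b [b0 bU b1 ->]]; apply/convex_hullP; exists (fun u => t^-1 * b u).
    split=> [u|u /bU ->||]; rewrite ?mulr0 ?combZ//.
      by rewrite mulr_ge0// ltW.
    by rewrite massZ b1 mulVf.
  move=> /convex_hullP[b [b0 bU b1 bE]]; exists (fun u => t * b u).
  split=> [u|u /bU ->||]; rewrite ?mulr0//; first by rewrite mulr_ge0.
    by rewrite massZ b1 mulr1.
  by rewrite combZ -bE scalerA divff// scale1r.
rewrite lebesgue_rV_shift// -[lebesgue_rV UB](lebesgue_rV_scale tV mUB).
by rewrite [RHS]muleC -muleA -EFinM -exprMn mulVf// expr1n mule1.
Qed.

(** Stacking [B] on [B'] gives an orthonormal frame of the whole space; in it the volume is the
    integral over y of the fibres found in [spine_fibre]. *)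
Lemma lebesgue_rV_spine : (k.+1 + e)%N = d ->
  lebesgue_rV P = (('C(d, k.+1)%:R^-1)%:E * (lebesgue_rV UB * lebesgue_rV K))%E.
Proof.
move=> kd; pose Q : 'M[R]_(k.+1 + e, d) := col_mx B B'.
have QQ : Q *m Q^T = 1%:M.
  have O : B *m B'^T = 0.
    have /submxP[Z ->] := BD; have /sub_kermxP DO := BO.
    by rewrite -mulmxA -[direction U]trmxK -trmx_mul DO trmx0 mulmx0.
  rewrite /Q tr_col_mx mul_col_row BB BB' O.
  have -> : B' *m B^T = 0 by rewrite -[B']trmxK -trmx_mul O trmx0.
  by rewrite -scalar_mx_block.
have mP := msetr_hull VF.
rewrite -(lebesgue_rV_frame u1 kd QQ mP) lebesgue_rV_split; last first.
  have := msetr_affine Q u1 mP.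
  by congr msetr; apply/seteqP; split => z /=; rewrite addrC.
have E (y : 'rV[R]_e) : [set x : 'rV[R]_k.+1 | P (u1 + row_mx x y *m Q)] =
    [set a | P (u1 + a *m B + y *m B')].
  by apply/seteqP; split => a /=; rewrite mul_row_col addrA.
under eq_integral do rewrite E.
rewrite KE (layer_cake (k := k) fullhat (C := lebesgue_rV UB)
  (F := fun y : 'rV[R]_e => lebesgue_rV [set a | P (u1 + a *m B + y *m B')])) ?kd//.
  by rewrite lebesgue_rVE.
by move=> y; rewrite -KE; exact: spine_fibre.
Qed.

(** Any frame whose flat contains a hull has the differences of its vertices among its directions,
    as [vol_frame] demands. *)
Let hull_span (s : {fset 'rV[R]_d}) j p (M : 'M[R]_(j, d)) v w :
  convex_hull [set` s] `<=` [set p + y *m M | y in [set: 'rV[R]_j]] ->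
  v \in s -> w \in s -> (v - w <= M)%MS.
Proof.
move=> sM vs ws; have [y _ <-] := sM _ (convex_hull_point vs).
have [z _ <-] := sM _ (convex_hull_point ws).
by rewrite opprD addrACA subrr add0r -mulmxBl submxMl.
Qed.

Lemma vol_spine : vol k.+1 (convex_hull [set` U]) = lebesgue_rV UB.
Proof.
apply: vol_frame => //.
- move=> x /convex_hullP[c [_ _ c1 ->]].
  exists ((comb U c - u1) *m B^T) => //.
  rewrite orthonormal_proj ?[u1 + _]addrC ?subrK//.
  by apply: submx_trans DB; exact: base_direction.
- by exists u1; exact: convex_hull_point.
- move=> p M sM; apply: submx_trans BD _; apply/row_subP => i.
  have /direction_sub[c [c0 ->]] := row_sub i (direction U).
  have -> : comb U c = \sum_(v <- U) c v *: (v - u1).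
    under eq_bigr do rewrite scalerBr.
    by rewrite sumrB -scaler_suml -/(mass U c) c0 scale0r subr0.
  rewrite big_seq; apply: summx_sub => v vU; apply: scalemx_sub.
  exact: hull_span sM _ _.
Qed.

Lemma vol_projection : vol e (hat @` P) = lebesgue_rV K.
Proof.
rewrite -convex_hull_Phi.
have -> : K = [set y | convex_hull [set` hatV] (0 + y *m B')].
  by apply/seteqP; split => y; rewrite /K /= add0r.
have h0 : 0 \in hatV.
  by apply/imfsetP; exists u1; [exact: (fsubsetP UV)|rewrite Phi_base].
apply: vol_frame => //.
- rewrite convex_hull_Phi => _ [x _ <-]; exists (hat x *m B'^T) => //.
  by rewrite add0r orthonormal_proj//; apply: submx_trans OB; exact: proj_sub_ortho.
- by exists 0; exact: convex_hull_point.
- move=> p M sM; apply: submx_trans BO _; apply/row_subP => i.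
  have [m [q [w [qs _ ->]]]] := ortho_sum (row_sub i (direction_ortho U)).
  apply: summx_sub => j _; apply: scalemx_sub; rewrite -[hat _]subr0.
  by apply: hull_span sM _ _ => //; apply: in_imfset; exact: qs.
- have -> : [set y | convex_hull [set` hatV] (0 + y *m B')] = K.
    by apply/seteqP; split => y; rewrite /K /= add0r.
  by rewrite KE; exact: msetr_hull.
Qed.

End Frame.

Lemma spine_volume : (2 <= #|` U|)%N ->
  ('C(d, #|` U|.-1)%:R%:E * lebesgue_rV P =
   vol #|` U|.-1 (convex_hull [set` U]) * vol (codim U) (hat @` P))%E.
Proof.
move=> U2; case UE : #|` U| U2 => [|[|k]]// _.
have rD : \rank (direction U) = k.+1.
  by have := rank_direction UI u1U; rewrite UE => -[].
have rO := rank_direction_ortho UI u1U.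
have [B BB BD] := orthonormal_basis rD.
have [B' BB' BO] := orthonormal_basis rO.
have eqr (m n : nat) (A : 'M[R]_(m, d)) (C : 'M[R]_(n, d)) :
    (A <= C)%MS -> \rank A = \rank C -> (C <= A)%MS.
  by move=> AC; have := mxrank_leqif_sup AC => /leqifP; case: ifP => // _; rewrite ltn_neqAle => /andP[/eqP].
have DB : (direction U <= B)%MS by apply: eqr => //; rewrite rank_orthonormal.
have OB : (direction_ortho U <= B')%MS by apply: eqr => //; rewrite rank_orthonormal.
have kd : (k.+1 + codim U)%N = d.
  have := card_spine_le UI u1U; rewrite /codim UE ltnS => kd.
  by rewrite subSS subnKC.
rewrite (vol_spine BB BD DB) (vol_projection BB' BO OB).
rewrite (lebesgue_rV_spine BB BD DB BB' BO OB kd) muleA -EFinM divff ?mul1e//.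
by rewrite pnatr_eq0 -lt0n bin_gt0 -[X in (_ <= X)%N]kd leq_addr.
Qed.

End SpineVolume.

Theorem theorem1 (R : realType) (d : nat) (V U : {fset 'rV[R]_d}) :
  (1 <= d)%N ->
  full_dimensional V ->
  convex_position V ->
  (U `<=` V)%fset ->
  [/\ spine V U <-> (exists T, spinal_triangulation V U T),
      spine V U ->
        forall u1, u1 \in U ->
        forall T, spinal_triangulation V U T <->
          exists2 S, star_triangulation (codim U) [fset Phi U u1 v | v in V]%fset S
                   & T = lift_complex V U u1 S
    & spine V U -> (2 <= #|` U|)%N ->
        forall u1, u1 \in U ->
        ('C(d, #|` U|.-1)%:R%:E * lebesgue_rV (convex_hull [set` V]) =
         vol #|` U|.-1 (convex_hull [set` U]) *
         vol (codim U) (Phi U u1 @` convex_hull [set` V]))%E].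
Proof.
move=> d0 VF VC UV; split.
- split; first exact: spine_spinal.
  by move=> [T]; exact: spinal_spine.
- by move=> SU u1 uU T; exact: spinal_lift_iff.
- by move=> SU U2 u1 u1U; exact: spine_volume.
Qed.
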